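(* Let $u_0\in\mathcal S([0,\infty))$, $g_0\in C^\infty([0,\infty))$, and $f\in C^\infty(\overline Q)$, with $f(\cdot,t)\in\mathcal S([0,\infty))$ with respect to $x$, uniformly for $t$ in compact subsets of $[0,\infty)$, where $Q=(0,\infty)\times(0,\infty)$. Let $U(x,t)$ be the function defined for $x>0$, $t>0$ by the unified transform formula $$2\pi U(x,t)=\int_{-\infty}^{\infty}e^{i\lambda x-\lambda^2t}\hat u_0(\lambda)\,d\lambda-\int_\gamma e^{i\lambda x-\lambda^2t}\hat u_0(-\lambda)\,d\lambda-\int_\gamma e^{i\lambda x-\lambda^2t}\,2i\lambda\,\widetilde g_0(\lambda,t)\,d\lambda$$ $$\qquad\qquad+\int_{-\infty}^{\infty}e^{i\lambda x-\lambda^2t}\,\widetilde{\hat f}(\lambda,t)\,d\lambda-\int_\gamma e^{i\lambda x-\lambda^2t}\,\widetilde{\hat f}(-\lambda,t)\,d\lambda$$ (notation in the context), which is a solution of $U_t-U_{xx}=f$ in $Q$, $\lim_{t\to0^+}U(x,t)=u_0(x)$ for $x>0$, $\lim_{x\to0^+}U(x,t)=g_0(t)$ for $t>0$. Then for all nonnegative integers $k,m,\ell$ and every $T_0>0$, $$\lim_{x\to+\infty}\left(x^\ell\,\frac{\partial^{k+m}U(x,t)}{\partial x^k\,\partial t^m}\right)=0\quad\text{uniformly for }0<t\le T_0 .$$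
   Context: $\mathcal S([0,\infty))$ is the space of $C^\infty$ functions $\varphi$ on $[0,\infty)$ with $\sup_{x\ge0}|x^\ell\varphi^{(k)}(x)|<\infty$ for all integers $k,\ell\ge0$. The assumption that $f(\cdot,t)\in\mathcal S([0,\infty))$ with respect to $x$, uniformly for $t$ in compact subsets of $[0,\infty)$, means: for all integers $k,\ell\ge0$ and all $T>0$, $\sup_{x\ge0,\,0\le t\le T}|x^\ell\partial_x^k f(x,t)|<\infty$. For $\operatorname{Im}\lambda\le0$: $$\hat u_0(\lambda)=\int_0^\infty e^{-i\lambda y}u_0(y)\,dy,\qquad \hat f(\lambda,t)=\int_0^\infty e^{-i\lambda y}f(y,t)\,dy,\qquad \widetilde{\hat f}(\lambda,t)=\int_0^t e^{\lambda^2\tau}\hat f(\lambda,\tau)\,d\tau .$$ For $\lambda\in\mathbb C$: $\widetilde g_0(\lambda,t)=\int_0^t e^{\lambda^2\tau}g_0(\tau)\,d\tau$. The contour $\gamma$ is the boundary of $\{\lambda\in\mathbb C:\operatorname{Im}\lambda\ge0,\ \operatorname{Re}(\lambda^2)\le0\}$, i.e. the two rays $\arg\lambda=3\pi/4$ and $\arg\lambda=\pi/4$, oriented from $\infty e^{3\pi i/4}$ to $0$ and then to $\infty e^{i\pi/4}$ (so that the domain lies to the left). Integrals over $\mathbb R$ are understood as improper integrals.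
   Formalization: For m ≥ 2 the claim fails as stated (f may oscillate fast in t); the formal theorem adds, for m ≥ 2 only, that ∂_t^j f(·,t), 0<j<m, also lies in S([0,∞)) with respect to x, uniformly for t in compact subsets. *)

(* Defs.v *)
(* Stdlib real numbers with Coquelicot. *)
From Stdlib Require Import Reals.
From Coquelicot Require Import Coquelicot.

Open Scope R_scope.

Definition closed_half_line (x : R) : Prop := 0 <= x.
Definition open_half_line (x : R) : Prop := 0 < x.

(* Derivative within A; at the endpoint of [0,oo) this is the one-sided derivative. *)
Definition is_derive_on (A : R -> Prop) (u : R -> C) (x : R) (l : C) : Prop :=
  @filterdiff R_AbsRing R_NormedModule C_R_NormedModule
    u (within A (locally x)) (fun h : R => scal h l).

(* u is C^oo on A and d n is its n-th derivative there.  A function on A is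
   represented by a function on R whose values outside A are never used. *)
Definition derivatives_on (A : R -> Prop) (u : R -> C) (d : nat -> R -> C) : Prop :=
  (forall x, A x -> d 0%nat x = u x) /\
  (forall n x, A x -> is_derive_on A (d n) x (d (S n) x)).

Definition smooth_on (A : R -> Prop) (u : R -> C) : Prop :=
  exists d, derivatives_on A u d.

Definition schwartz_half_line (u : R -> C) : Prop :=
  exists d, derivatives_on closed_half_line u d /\
    forall k l : nat, exists M : R,
      forall x, 0 <= x -> Cmod (RtoC (x ^ l) * d k x)%C <= M.

(* v is C^oo on A x A and d k m is the partial derivative of v of order k in the
   first variable x and order m in the second variable t. *)
Definition partials_on (A : R -> Prop) (v : R -> R -> C)
    (d : nat -> nat -> R -> R -> C) : Prop :=
  (forall x t, A x -> A t -> d 0%nat 0%nat x t = v x t) /\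
  (forall k m x t, A x -> A t ->
     is_derive_on A (fun y => d k m y t) x (d (S k) m x t) /\
     is_derive_on A (fun s => d k m x s) t (d k (S m) x t) /\
     filterlim (fun p : R * R => d k m (fst p) (snd p))
       (within (fun p : R * R => A (fst p) /\ A (snd p)) (locally (x, t)))
       (locally (d k m x t))).

Definition smooth2_on (A : R -> Prop) (v : R -> R -> C) : Prop :=
  exists d, partials_on A v d.

(* The j-th t-derivative of f belongs to S([0,oo)) with respect to x, uniformly
   for t in compact subsets of [0,oo). *)
Definition dt_schwartz_in_x (j : nat) (f : R -> R -> C) : Prop :=
  exists d, partials_on closed_half_line f d /\
    forall (k l : nat) (T : R), 0 < T -> exists M : R,
      forall x t, 0 <= x -> 0 <= t <= T ->
        Cmod (RtoC (x ^ l) * d k j x t)%C <= M.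

Definition schwartz_in_x (f : R -> R -> C) : Prop := dt_schwartz_in_x 0 f.

Definition Cexp (z : C) : C :=
  (exp (Re z) * cos (Im z), exp (Re z) * sin (Im z)).

Definition CInt (F : R -> C) (a b : R) : C :=
  @RInt C_R_CompleteNormedModule F a b.

Definition CInt_half_line (F : R -> C) : C :=
  @RInt_gen C_R_CompleteNormedModule F (at_point 0) (Rbar_locally p_infty).

Definition CInt_line (F : C -> C) : C :=
  @RInt_gen C_R_CompleteNormedModule (fun s : R => F (RtoC s))
    (Rbar_locally m_infty) (Rbar_locally p_infty).

(* Integral over the ray arg = theta, oriented from 0 to infinity. *)
Definition CInt_ray (theta : R) (F : C -> C) : C :=
  CInt_half_line
    (fun r : R => F (RtoC r * Cexp (Ci * RtoC theta)) * Cexp (Ci * RtoC theta))%C.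

(* The contour comes in along arg = 3 pi / 4 and goes out along arg = pi / 4. *)
Definition CInt_gamma (F : C -> C) : C :=
  (CInt_ray (PI / 4) F - CInt_ray (3 * PI / 4) F)%C.

Definition hat (u : R -> C) (lambda : C) : C :=
  CInt_half_line (fun y : R => Cexp (- (Ci * lambda * RtoC y)) * u y)%C.

Definition tilde (g : R -> C) (lambda : C) (t : R) : C :=
  CInt (fun tau : R => Cexp (lambda * lambda * RtoC tau) * g tau)%C 0 t.

Definition tilde_hat (f : R -> R -> C) (lambda : C) (t : R) : C :=
  tilde (fun tau : R => hat (fun y : R => f y tau) lambda) lambda t.

Definition kernel (x t : R) (lambda : C) : C :=
  Cexp (Ci * lambda * RtoC x - lambda * lambda * RtoC t)%C.

(* The right-hand side of the unified transform formula, without the factor 1/(2 pi). *)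
Definition unified_transform (u0 g0 : R -> C) (f : R -> R -> C) (x t : R) : C :=
  ( CInt_line (fun lambda => kernel x t lambda * hat u0 lambda)
  - CInt_gamma (fun lambda => kernel x t lambda * hat u0 (- lambda))
  - CInt_gamma (fun lambda =>
      kernel x t lambda * (RtoC 2 * Ci * lambda) * tilde g0 lambda t)
  + CInt_line (fun lambda => kernel x t lambda * tilde_hat f lambda t)
  - CInt_gamma (fun lambda => kernel x t lambda * tilde_hat f (- lambda) t))%C.

Definition solves_heat_equation (U f : R -> R -> C) : Prop :=
  exists Ux Uxx Ut : R -> R -> C,
    forall x t, 0 < x -> 0 < t ->
      @is_derive R_AbsRing C_R_NormedModule (fun y => U y t) x (Ux x t) /\
      @is_derive R_AbsRing C_R_NormedModule (fun y => Ux y t) x (Uxx x t) /\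
      @is_derive R_AbsRing C_R_NormedModule (fun s => U x s) t (Ut x t) /\
      (Ut x t - Uxx x t)%C = f x t.

Definition lim_at_infinity_uniformly (w : R -> R -> C) (T0 : R) : Prop :=
  forall eps : R, 0 < eps -> exists X : R,
    forall x t, 0 < x -> X < x -> 0 < t <= T0 -> Cmod (w x t) < eps.

(* For m >= 2, the m-th t-derivative of a solution of U_t - U_xx = f contains
   t-derivatives of f up to order m - 1:
     d_t^m U = d_x^(2m) U + sum_(j < m) d_x^(2(m-1-j)) d_t^j f.
   Decay of the x-derivatives of f does not control these: with b a bump
   function supported in (-1/2, 1/2) and b(0) = 1,
     f(x,t) = sum_(n >= 1) exp(-n) sin(exp(2n) t) b(x - n)
   satisfies schwartz_in_x, whereas f_t(n,t) = exp(n) cos(exp(2n) t), so that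
   U_tt = U_xxxx + f_xx + f_t cannot tend to 0.  The condition below is what is
   needed for the derivatives of order m in t; it is void for m <= 1. *)
Definition dt_schwartz_below (m : nat) (f : R -> R -> C) : Prop :=
  forall j : nat, (0 < j < m)%nat -> dt_schwartz_in_x j f.

(* Main.v *)
(* Insert the definitions of the transforms into the formula.  Up to constant
   factors, every term becomes the difference, over the two rays lambda = r e of
   its contour, of integrals of
     exp(i lambda x) lambda^a W_(b,q)(lambda, t),
   where W_(b,q) is either t^b exp(- lambda^2 t) psi_q(lambda) or
   int_0^t s^b exp(- lambda^2 s) psi_q(lambda, t - s) ds and psi_q is the
   transform of y^q u0, of y^q f, or g0 itself.  Differentiation in x raises a by
   one.  Integration by parts in lambda expresses x times the integral (a, b, q)
   by the integrals (a - 1, b, q), (a + 1, b + 1, q) and (a, b, q + 1); the boundary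
   terms at the vertex lambda = 0 cancel between the two rays.  On the real line
   W_(b,q) decays like |lambda|^-(2b+q), uniformly in 0 < t <= T, so that the three
   new integrands have one more power of decay than the old one; on gamma
   exp(i lambda x) decays exponentially for x > 0 and the order is irrelevant.
   Hence, by iteration, U has x-derivatives of all orders which are continuous in
   (x, t) and decrease faster than every power of x.  Derivatives in t are reduced
   to derivatives in x by U_t = U_xx + f; for this the equation is integrated in t
   and then differentiated in x. *)

Require Import Defs.
From Stdlib Require Import Reals Lra Lia Factorial Classical ClassicalEpsilon.
From Stdlib Require Import FunctionalExtensionality.
From Coquelicot Require Import Coquelicot.

Open Scope R_scope.

(** * Complex-valued functions of a real variable *)

Notation is_deriveC := (@is_derive R_AbsRing C_R_NormedModule).

Ltac as_C_eq := match goal with |- @eq _ ?u ?v => change (@eq C u v) end.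

Ltac parts_ring :=
  unfold Cexp, Re, Im; simpl; unfold Re, Im; simpl;
  match goal with |- @eq _ ?a ?b => change (@eq R a b) end; ring.

(** The proof is driven by the order [2 * b + q + o - a] of an integral. Each of the three integrals
    produced by integration by parts has order one higher; a derivative in x lowers the order by
    one. Two thresholds matter on the real line. From order 0 on, the integral converges absolutely
    for t bounded away from 0, because the heat factor, or its integral over s, yields two further
    powers of decay. Only from order 2 on does the plain count give bounds uniform down to t = 0.
    The five terms start at order 0 or 1. Uniform bounds, and any number of x-derivatives, are
    therefore reached only after several integrations by parts, each paid for by a factor 1/x. This
    is harmless because the bounds concern x >= 1 only. The weights s^b and y^q close the family of
    integrals under differentiation in lambda: the derivative of exp(- lambda^2 s) brings down s,
    that of exp(-+ i lambda y) brings down y. The offset [o] is 0 on the line and can be chosen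
    freely on gamma. *)

Lemma norm_Cmod (z : C) : @norm R_AbsRing C_R_NormedModule z = Cmod z.
Proof. exact (eq_sym (Cmod_norm z)). Qed.

Lemma C_ext (z w : C) : Re z = Re w -> Im z = Im w -> z = w.
Proof. destruct z, w; simpl; intros -> ->; reflexivity. Qed.

Lemma Cmod_le_parts (z : C) : Cmod z <= Rabs (Re z) + Rabs (Im z).
Proof.
  replace z with (RtoC (Re z) + Ci * RtoC (Im z))%C
    by (apply C_ext; simpl; ring).
  eapply Rle_trans; [apply Cmod_triangle|].
  rewrite Cmod_mult, Cmod_Ci, !Cmod_R; simpl.
  apply Req_le; f_equal; [f_equal; ring|]. rewrite Rmult_1_l; f_equal; ring.
Qed.

Lemma Im_le_Cmod (z : C) : Rabs (Im z) <= Cmod z.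
Proof.
  eapply Rle_trans; [|apply Rmax_Cmod]. apply Rmax_r.
Qed.

Lemma continuous_C {T : UniformSpace} (f : T -> C) (x : T) :
  continuous (fun p => Re (f p)) x -> continuous (fun p => Im (f p)) x ->
  continuous f x.
Proof.
  intros H1 H2.
  apply (filterlim_ext (fun p => (Re (f p), Im (f p)))).
  - intros p; destruct (f p); reflexivity.
  - replace (f x) with (Re (f x), Im (f x)) by (destruct (f x); reflexivity).
    unfold continuous in *. intros P [eps HP].
    specialize (H1 (ball (Re (f x)) eps) (locally_ball _ _)).
    specialize (H2 (ball (Im (f x)) eps) (locally_ball _ _)).
    unfold filtermap in *. generalize (filter_and _ _ H1 H2).
    apply filter_imp. intros p [Ha Hb]. apply HP. split; assumption.
Qed.

Lemma continuous_Re (z : C) : continuous Re z.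
Proof. destruct z as [a b]. exact (continuous_fst (U:=R_UniformSpace) (V:=R_UniformSpace) a b). Qed.

Lemma continuous_Im (z : C) : continuous Im z.
Proof. destruct z as [a b]. exact (continuous_snd (U:=R_UniformSpace) (V:=R_UniformSpace) a b). Qed.

Section Continuity.
Context {T : UniformSpace}.

Lemma continuous_Re_comp (f : T -> C) x :
  continuous f x -> continuous (fun p => Re (f p)) x.
Proof. intros H. apply (continuous_comp f Re); [exact H|apply continuous_Re]. Qed.

Lemma continuous_Im_comp (f : T -> C) x :
  continuous f x -> continuous (fun p => Im (f p)) x.
Proof. intros H. apply (continuous_comp f Im); [exact H|apply continuous_Im]. Qed.

Lemma continuous_RtoC (f : T -> R) x :
  continuous f x -> continuous (fun p => RtoC (f p)) x.
Proof. intros H. apply continuous_C; simpl; [exact H|apply continuous_const]. Qed.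

Lemma continuous_Rmult (f g : T -> R) x :
  continuous f x -> continuous g x -> continuous (fun p => f p * g p) x.
Proof. intros. exact (continuous_mult (K:=R_AbsRing) f g x H H0). Qed.

Lemma continuous_Rplus (f g : T -> R) x :
  continuous f x -> continuous g x -> continuous (fun p => f p + g p) x.
Proof. intros. exact (continuous_plus (V:=R_NormedModule) f g x H H0). Qed.

Lemma continuous_Ropp (f : T -> R) x :
  continuous f x -> continuous (fun p => - f p) x.
Proof. intros. exact (continuous_opp (V:=R_NormedModule) f x H). Qed.

Lemma continuous_Rminus (f g : T -> R) x :
  continuous f x -> continuous g x -> continuous (fun p => f p - g p) x.
Proof. intros. exact (continuous_minus (V:=R_NormedModule) f g x H H0). Qed.

Lemma continuous_Rpow (f : T -> R) n x :
  continuous f x -> continuous (fun p => f p ^ n) x.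
Proof.
  intros H; induction n as [|n IH]; simpl; [apply continuous_const|].
  apply continuous_Rmult; assumption.
Qed.

Lemma continuous_Cplus (f g : T -> C) x :
  continuous f x -> continuous g x -> continuous (fun p => f p + g p)%C x.
Proof.
  intros Hf Hg; apply continuous_C; simpl; apply continuous_Rplus;
    auto using continuous_Re_comp, continuous_Im_comp.
Qed.

Lemma continuous_Copp (f : T -> C) x :
  continuous f x -> continuous (fun p => - f p)%C x.
Proof.
  intros Hf; apply continuous_C; simpl; apply continuous_Ropp;
    auto using continuous_Re_comp, continuous_Im_comp.
Qed.

Lemma continuous_Cminus (f g : T -> C) x :
  continuous f x -> continuous g x -> continuous (fun p => f p - g p)%C x.
Proof. intros. apply continuous_Cplus; auto using continuous_Copp. Qed.

Lemma continuous_Cmult (f g : T -> C) x :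
  continuous f x -> continuous g x -> continuous (fun p => f p * g p)%C x.
Proof.
  intros Hf Hg; apply continuous_C; simpl;
    [apply continuous_Rminus|apply continuous_Rplus]; apply continuous_Rmult;
    first [apply continuous_Re_comp|apply continuous_Im_comp]; assumption.
Qed.

Lemma continuous_Cpow (f : T -> C) n x :
  continuous f x -> continuous (fun p => f p ^ n)%C x.
Proof.
  intros H; induction n as [|n IH]; simpl; [apply continuous_const|].
  apply continuous_Cmult; assumption.
Qed.

Lemma continuous_Cexp (f : T -> C) x :
  continuous f x -> continuous (fun p => Cexp (f p)) x.
Proof.
  intros H. apply continuous_C; simpl; apply continuous_Rmult.
  1,3: apply (continuous_comp (fun p => Re (f p)) exp);
    [apply continuous_Re_comp, H|apply (ex_derive_continuous exp); auto_derive; trivial].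
  - apply (continuous_comp (fun p => Im (f p)) cos);
    [apply continuous_Im_comp, H|apply (ex_derive_continuous cos); auto_derive; trivial].
  - apply (continuous_comp (fun p => Im (f p)) sin);
    [apply continuous_Im_comp, H|apply (ex_derive_continuous sin); auto_derive; trivial].
Qed.

Lemma continuous_Rmax0 (f : T -> R) x :
  continuous f x -> continuous (fun p => Rmax 0 (f p)) x.
Proof.
  intros H. apply (continuous_comp f (Rmax 0)); [exact H|].
  apply (continuous_ext (fun y => (y + Rabs y) / 2)).
  - intros y. unfold Rmax, Rabs. destruct (Rle_dec 0 y), (Rcase_abs y); lra.
  - apply (continuous_mult (K:=R_AbsRing) (fun y => y + Rabs y) (fun _ => / 2));
      [|apply continuous_const].
    apply (continuous_plus (V:=R_NormedModule) (fun y => y) Rabs);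
      [apply continuous_id|apply continuous_Rabs].
Qed.

End Continuity.

Lemma continuous_fst' {U V : UniformSpace} (z : U * V) : continuous fst z.
Proof. destruct z; apply continuous_fst. Qed.

Lemma continuous_snd' {U V : UniformSpace} (z : U * V) : continuous snd z.
Proof. destruct z; apply continuous_snd. Qed.

Lemma is_deriveC_pair (f : R -> C) x l :
  is_derive (fun y => Re (f y)) x (Re l) ->
  is_derive (fun y => Im (f y)) x (Im l) -> is_deriveC f x l.
Proof.
  intros H1 H2.
  assert (H : @filterdiff R_AbsRing R_NormedModule C_R_NormedModule
     (fun y => (Re (f y), Im (f y))) (locally x)
     (fun y => (scal y (Re l), scal y (Im l)))).
  { apply (filterdiff_comp_2 (K:=R_AbsRing) (T:=R_NormedModule) (U:=R_NormedModule)
      (V:=R_NormedModule) (W:=C_R_NormedModule)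
      (fun y => Re (f y)) (fun y => Im (f y)) (fun a b => (a, b) : C)
      (fun y => scal y (Re l)) (fun y => scal y (Im l)) (fun a b => (a, b) : C));
      [exact H1|exact H2|].
    apply (filterdiff_ext_lin _ (fun t : R * R => t)).
    - apply (filterdiff_ext (fun t : R * R => t)).
      + intros [a b]; reflexivity.
      + apply filterdiff_id.
    - intros [a b]; reflexivity. }
  apply (filterdiff_ext (fun y => (Re (f y), Im (f y)))).
  - intros y; destruct (f y); reflexivity.
  - apply (filterdiff_ext_lin _ _ _ H). intros y; reflexivity.
Qed.

Lemma is_deriveC_Re (f : R -> C) x l :
  is_deriveC f x l -> is_derive (fun y => Re (f y)) x (Re l).
Proof.
  intros H.
  apply (filterdiff_comp' (K:=R_AbsRing) (U:=R_NormedModule) (V:=C_R_NormedModule)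
    (W:=R_NormedModule) f Re x _ Re H).
  apply filterdiff_linear, (is_linear_fst (K:=R_AbsRing) (U:=R_NormedModule) (V:=R_NormedModule)).
Qed.

Lemma is_deriveC_Im (f : R -> C) x l :
  is_deriveC f x l -> is_derive (fun y => Im (f y)) x (Im l).
Proof.
  intros H.
  apply (filterdiff_comp' (K:=R_AbsRing) (U:=R_NormedModule) (V:=C_R_NormedModule)
    (W:=R_NormedModule) f Im x _ Im H).
  apply filterdiff_linear, (is_linear_snd (K:=R_AbsRing) (U:=R_NormedModule) (V:=R_NormedModule)).
Qed.

Lemma is_deriveC_unique (f : R -> C) x l l' :
  is_deriveC f x l -> is_deriveC f x l' -> l = l'.
Proof.
  intros H H'. apply C_ext.
  - rewrite <- (is_derive_unique _ _ _ (is_deriveC_Re _ _ _ H)).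
    apply is_derive_unique, is_deriveC_Re, H'.
  - rewrite <- (is_derive_unique _ _ _ (is_deriveC_Im _ _ _ H)).
    apply is_derive_unique, is_deriveC_Im, H'.
Qed.

Lemma is_deriveC_continuous (f : R -> C) x l : is_deriveC f x l -> continuous f x.
Proof.
  intros H. apply (ex_derive_continuous (V:=C_R_NormedModule) f x). exists l; exact H.
Qed.

Lemma is_deriveC_const (c : C) x : is_deriveC (fun _ => c) x (RtoC 0).
Proof. exact (is_derive_const (V:=C_R_NormedModule) c x). Qed.

Lemma is_deriveC_plus f g x l m :
  is_deriveC f x l -> is_deriveC g x m -> is_deriveC (fun y => f y + g y)%C x (l + m)%C.
Proof. intros; exact (is_derive_plus (V:=C_R_NormedModule) f g x l m H H0). Qed.

Lemma is_deriveC_minus f g x l m :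
  is_deriveC f x l -> is_deriveC g x m -> is_deriveC (fun y => f y - g y)%C x (l - m)%C.
Proof. intros; exact (is_derive_minus (V:=C_R_NormedModule) f g x l m H H0). Qed.

Lemma is_deriveC_opp f x l : is_deriveC f x l -> is_deriveC (fun y => - f y)%C x (- l)%C.
Proof. intros; exact (is_derive_opp (V:=C_R_NormedModule) f x l H). Qed.

Lemma is_derive_Rplus (f g : R -> R) (x l m : R) :
  is_derive f x l -> is_derive g x m -> is_derive (fun y : R => f y + g y) x (l + m).
Proof. intros; exact (is_derive_plus (V:=R_NormedModule) f g x l m H H0). Qed.

Lemma is_derive_Rminus (f g : R -> R) (x l m : R) :
  is_derive f x l -> is_derive g x m -> is_derive (fun y : R => f y - g y) x (l - m).
Proof. intros; exact (is_derive_minus (V:=R_NormedModule) f g x l m H H0). Qed.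

Lemma is_derive_Rmult (f g : R -> R) (x l m : R) :
  is_derive f x l -> is_derive g x m ->
  is_derive (fun y : R => f y * g y) x (l * g x + f x * m).
Proof.
  intros; exact (is_derive_mult (K:=R_AbsRing) f g x l m H H0 Rmult_comm).
Qed.

Lemma is_derive_value {V : NormedModule R_AbsRing} (f : R -> V) (x : R) (l l' : V) :
  is_derive f x l -> l = l' -> is_derive f x l'.
Proof. intros H <-; exact H. Qed.

Lemma is_deriveC_mult f g x l m :
  is_deriveC f x l -> is_deriveC g x m ->
  is_deriveC (fun y => f y * g y)%C x (l * g x + f x * m)%C.
Proof.
  intros H H'.
  pose proof (is_deriveC_Re _ _ _ H) as H1; pose proof (is_deriveC_Im _ _ _ H) as H2.
  pose proof (is_deriveC_Re _ _ _ H') as H3; pose proof (is_deriveC_Im _ _ _ H') as H4.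
  pose proof (is_derive_Rminus _ _ _ _ _ (is_derive_Rmult _ _ _ _ _ H1 H3)
    (is_derive_Rmult _ _ _ _ _ H2 H4)) as HRe.
  pose proof (is_derive_Rplus _ _ _ _ _ (is_derive_Rmult _ _ _ _ _ H1 H4)
    (is_derive_Rmult _ _ _ _ _ H2 H3)) as HIm.
  apply is_deriveC_pair.
  - eapply is_derive_value; [exact HRe|parts_ring].
  - eapply is_derive_value; [exact HIm|parts_ring].
Qed.

Lemma is_deriveC_RtoC (f : R -> R) x l :
  is_derive f x l -> is_deriveC (fun y => RtoC (f y)) x (RtoC l).
Proof.
  intros H. apply is_deriveC_pair; simpl; [exact H|].
  apply (is_derive_const (V:=R_NormedModule)).
Qed.

Lemma is_deriveC_Cexp f x l :
  is_deriveC f x l -> is_deriveC (fun y => Cexp (f y)) x (Cexp (f x) * l)%C.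
Proof.
  intros H.
  pose proof (is_deriveC_Re _ _ _ H) as H1; pose proof (is_deriveC_Im _ _ _ H) as H2.
  assert (He : is_derive (fun y => exp (Re (f y))) x (Re l * exp (Re (f x)))).
  { apply (is_derive_comp (V:=R_NormedModule) exp (fun y => Re (f y))); [|exact H1].
    auto_derive; [trivial|ring]. }
  assert (Hc : is_derive (fun y => cos (Im (f y))) x (Im l * - sin (Im (f x)))).
  { apply (is_derive_comp (V:=R_NormedModule) cos (fun y => Im (f y))); [|exact H2].
    auto_derive; [trivial|ring]. }
  assert (Hs : is_derive (fun y => sin (Im (f y))) x (Im l * cos (Im (f x)))).
  { apply (is_derive_comp (V:=R_NormedModule) sin (fun y => Im (f y))); [|exact H2].
    auto_derive; [trivial|ring]. }
  pose proof (is_derive_Rmult _ _ _ _ _ He Hc) as HRe.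
  pose proof (is_derive_Rmult _ _ _ _ _ He Hs) as HIm.
  apply is_deriveC_pair.
  - eapply is_derive_value; [exact HRe|parts_ring].
  - eapply is_derive_value; [exact HIm|parts_ring].
Qed.

(** Serves to remove a clamp [Rmax 0] before differentiating at an interior point. *)
Lemma is_deriveC_ext_pos (f g : R -> C) x l : 0 < x ->
  (forall y, 0 < y -> f y = g y) -> is_deriveC f x l -> is_deriveC g x l.
Proof.
  intros Hx Hfg H. apply (is_derive_ext_loc (V:=C_R_NormedModule) f); [|exact H].
  generalize (locally_open (fun y => 0 < y) (fun y => 0 < y) (open_gt 0) (fun _ h => h) x Hx).
  apply filter_imp. exact Hfg.
Qed.

(** Real and imaginary parts are bounded separately by the real mean value theorem, which costs the
    factor 2. *)
Lemma mean_value_C (f g : R -> C) D x y :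
  (forall t, Rabs (t - x) <= Rabs (y - x) -> is_deriveC f t (g t) /\ Cmod (g t) <= D) ->
  Cmod (f y - f x) <= 2 * D * Rabs (y - x).
Proof.
  intros H. eapply Rle_trans; [apply Cmod_le_parts|].
  assert (H1 : Rabs (Re (f y) - Re (f x)) <= D * Rabs (y - x)).
  { apply (bounded_variation (fun t => Re (f t)) (fun t => Re (g t))). intros t Ht.
    destruct (H t Ht) as [Ha Hb]. split; [apply is_deriveC_Re, Ha|].
    eapply Rle_trans; [apply re_le_Cmod|exact Hb]. }
  assert (H2 : Rabs (Im (f y) - Im (f x)) <= D * Rabs (y - x)).
  { apply (bounded_variation (fun t => Im (f t)) (fun t => Im (g t))). intros t Ht.
    destruct (H t Ht) as [Ha Hb]. split; [apply is_deriveC_Im, Ha|].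
    eapply Rle_trans; [apply Im_le_Cmod|exact Hb]. }
  change (Re (f y - f x)%C) with (Re (f y) + - Re (f x)).
  change (Im (f y - f x)%C) with (Im (f y) + - Im (f x)).
  unfold Rminus in *. lra.
Qed.

Lemma Cmod_Cexp z : Cmod (Cexp z) = exp (Re z).
Proof.
  unfold Cmod, Cexp; simpl.
  replace (_ + _) with (Rsqr (exp (Re z))).
  - apply sqrt_Rsqr, Rlt_le, exp_pos.
  - pose proof (sin2_cos2 (Im z)) as H. unfold Rsqr in *.
    transitivity (exp (Re z) * exp (Re z) * (sin (Im z) * sin (Im z) + cos (Im z) * cos (Im z)));
      [rewrite H; ring|ring].
Qed.

Lemma Cexp_plus z w : Cexp (z + w) = (Cexp z * Cexp w)%C.
Proof.
  destruct z as [a b], w as [c d]. unfold Cexp, Cmult; simpl. rewrite exp_plus, cos_plus, sin_plus.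
  f_equal; ring.
Qed.

Lemma Cexp_0 : Cexp 0 = RtoC 1.
Proof. unfold Cexp; simpl. rewrite exp_0, cos_0, sin_0. apply C_ext; simpl; ring. Qed.

Lemma continuous_pair {T U V : UniformSpace} (f : T -> U) (g : T -> V) x :
  continuous f x -> continuous g x -> continuous (fun p => (f p, g p)) x.
Proof.
  intros Hf Hg. apply (continuous_comp_2 f g (fun a b => (a, b))); [exact Hf|exact Hg|].
  apply (continuous_ext (fun p : U * V => p)); [intros [u v]; reflexivity|apply continuous_id].
Qed.

Lemma is_deriveC_Cpow f x l n : is_deriveC f x l ->
  is_deriveC (fun y => f y ^ n)%C x (RtoC (INR n) * f x ^ pred n * l)%C.
Proof.
  intros H. induction n as [|n IH].
  - apply (is_derive_value (V:=C_R_NormedModule) _ _ (RtoC 0)).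
    + exact (is_deriveC_const (RtoC 1) x).
    + as_C_eq. simpl. ring.
  - eapply is_derive_value; [exact (is_deriveC_mult _ _ _ _ _ H IH)|].
    as_C_eq.
    rewrite S_INR, RtoC_plus. destruct n as [|n]; simpl; ring.
Qed.

(** * Dominated integrals over the half line *)

Notation ex_CInt := (@ex_RInt C_R_NormedModule).
Notation is_CInt := (@is_RInt C_R_NormedModule).

Lemma ex_CInt_continuous (F : R -> C) a b :
  (forall s, continuous F s) -> ex_CInt F a b.
Proof. intros H. apply (ex_RInt_continuous (V:=C_R_CompleteNormedModule)). auto. Qed.

Lemma is_CInt_CInt (F : R -> C) a b : ex_CInt F a b -> is_CInt F a b (CInt F a b).
Proof. exact (RInt_correct (V:=C_R_CompleteNormedModule) F a b). Qed.

Lemma CInt_unique (F : R -> C) a b l : is_CInt F a b l -> CInt F a b = l.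
Proof. exact (is_RInt_unique (V:=C_R_CompleteNormedModule) F a b l). Qed.

Lemma CInt_ext (F G : R -> C) a b : a <= b ->
  (forall s, a < s < b -> F s = G s) -> CInt F a b = CInt G a b.
Proof.
  intros Hab H. apply (RInt_ext (V:=C_R_CompleteNormedModule)).
  rewrite Rmin_left, Rmax_right by exact Hab. exact H.
Qed.

Lemma CInt_Chasles (F : R -> C) a b c : ex_CInt F a b -> ex_CInt F b c ->
  (CInt F a b + CInt F b c)%C = CInt F a c.
Proof. exact (RInt_Chasles (V:=C_R_CompleteNormedModule) F a b c). Qed.

Lemma is_CInt_plus F G a b l m : is_CInt F a b l -> is_CInt G a b m ->
  is_CInt (fun s => F s + G s)%C a b (l + m)%C.
Proof. exact (is_RInt_plus (V:=C_R_NormedModule) F G a b l m). Qed.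

Lemma is_CInt_minus F G a b l m : is_CInt F a b l -> is_CInt G a b m ->
  is_CInt (fun s => F s - G s)%C a b (l - m)%C.
Proof. exact (is_RInt_minus (V:=C_R_NormedModule) F G a b l m). Qed.

(** The scalars of the module are real, so multiplication by the complex [c] is carried out on real
    and imaginary parts. *)
Lemma is_CInt_scal F a b l c : is_CInt F a b l -> is_CInt (fun s => c * F s)%C a b (c * l)%C.
Proof.
  intros H.
  pose proof (is_RInt_fct_extend_fst (U:=R_NormedModule) (V:=R_NormedModule) F a b l H) as H1.
  pose proof (is_RInt_fct_extend_snd (U:=R_NormedModule) (V:=R_NormedModule) F a b l H) as H2.
  apply (is_RInt_fct_extend_pair (U:=R_NormedModule) (V:=R_NormedModule)
    (fun s => c * F s)%C a b (Re (c * l)%C) (Im (c * l)%C)).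
  - exact (is_RInt_minus (V:=R_NormedModule) _ _ a b _ _
      (is_RInt_scal (V:=R_NormedModule) _ a b (Re c) _ H1)
      (is_RInt_scal (V:=R_NormedModule) _ a b (Im c) _ H2)).
  - exact (is_RInt_plus (V:=R_NormedModule) _ _ a b _ _
      (is_RInt_scal (V:=R_NormedModule) _ a b (Re c) _ H2)
      (is_RInt_scal (V:=R_NormedModule) _ a b (Im c) _ H1)).
Qed.

Lemma CInt_bound (F : R -> C) (g : R -> R) a b lg : a <= b -> ex_CInt F a b ->
  (forall s, a <= s <= b -> Cmod (F s) <= g s) -> is_RInt g a b lg ->
  Cmod (CInt F a b) <= lg.
Proof.
  intros Hab HF Hg Hlg. rewrite <- norm_Cmod.
  apply (norm_RInt_le (V:=C_R_NormedModule) F g a b); [exact Hab| |apply is_CInt_CInt, HF|exact Hlg].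
  intros s Hs. rewrite norm_Cmod. auto.
Qed.

Lemma CInt_bound_const (F : R -> C) D a b : a <= b -> ex_CInt F a b ->
  (forall s, a <= s <= b -> Cmod (F s) <= D) -> Cmod (CInt F a b) <= (b - a) * D.
Proof.
  intros Hab HF HD. apply (CInt_bound F (fun _ => D) a b); auto.
  exact (is_RInt_const (V:=R_NormedModule) a b D).
Qed.

Lemma is_RInt_majorant M a b : 0 <= a <= b ->
  is_RInt (fun s => M / (1 + s) ^ 2) a b (M / (1 + a) - M / (1 + b)).
Proof.
  intros Hab.
  replace (M / (1 + a) - M / (1 + b)) with (minus (- M / (1 + b)) (- M / (1 + a)))
    by (unfold minus, plus, opp; simpl; unfold Rdiv; ring).
  apply (is_RInt_derive (V:=R_CompleteNormedModule) (fun s => - M / (1 + s)));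
    rewrite Rmin_left, Rmax_right by lra; intros s Hs.
  - auto_derive; [lra|field; lra].
  - apply (ex_derive_continuous (V:=R_NormedModule)). auto_derive. nra.
Qed.

(** One fixed profile serves as majorant throughout: its primitive is explicit and its tail from a
    on is M / (1 + a). Continuity on all of R makes integrability on every segment automatic; data
    given on a half line are clamped by [Rmax 0] to achieve it. *)
Definition dominated (M : R) (F : R -> C) : Prop :=
  (forall s, continuous F s) /\ forall s, 0 <= s -> Cmod (F s) <= M / (1 + s) ^ 2.

Lemma dominated_pos M F : dominated M F -> 0 <= M.
Proof.
  intros [_ H]. specialize (H 0 (Rle_refl 0)). pose proof (Cmod_ge_0 (F 0)).
  replace (M / (1 + 0) ^ 2) with M in H by field. lra.
Qed.

Lemma dominated_le M M' F : M <= M' -> dominated M F -> dominated M' F.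
Proof.
  intros HMM [HF HF']. split; [exact HF|]. intros s Hs.
  eapply Rle_trans; [apply HF', Hs|]. apply Rmult_le_compat_r; [|exact HMM].
  apply Rlt_le, Rinv_0_lt_compat. nra.
Qed.

Lemma dominated_segment M F a b : dominated M F -> 0 <= a <= b ->
  Cmod (CInt F a b) <= M / (1 + a).
Proof.
  intros HM Hab. pose proof (dominated_pos _ _ HM).
  apply Rle_trans with (M / (1 + a) - M / (1 + b)).
  - apply (CInt_bound F (fun s => M / (1 + s) ^ 2)); [lra|apply ex_CInt_continuous, HM| |].
    + intros s Hs. apply HM; lra.
    + apply is_RInt_majorant, Hab.
  - assert (0 <= M / (1 + b)); [|lra]. apply Rdiv_le_0_compat; lra.
Qed.

Lemma ball_C_Cmod (z w : C) (eps : posreal) : Cmod (w - z) < eps -> @ball C_UniformSpace z eps w.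
Proof. exact (C_NormedModule_mixin_compat1 z w eps). Qed.

Lemma Rdiv_small M eps : 0 <= M -> 0 < eps -> exists N, 0 <= N /\ forall a, N <= a -> M / (1 + a) < eps.
Proof.
  intros HM He. exists (M / eps). assert (0 <= M / eps) by (apply Rdiv_le_0_compat; lra).
  split; [assumption|]. intros a Ha.
  apply Rmult_lt_reg_r with (1 + a); [lra|]. unfold Rdiv at 1. rewrite Rmult_assoc, Rinv_l by lra.
  apply Rle_lt_trans with (eps * (M / eps)); [|nra]. right. field. lra.
Qed.

Lemma is_CInt_half_line_lim (F : R -> C) l :
  (forall b, 0 <= b -> ex_CInt F 0 b) ->
  filterlim (fun b => CInt F 0 b) (Rbar_locally p_infty) (locally l) ->
  @is_RInt_gen C_R_NormedModule F (at_point 0) (Rbar_locally p_infty) l.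
Proof.
  intros HF H P HP. specialize (H P HP). unfold filtermapi, filtermap in *.
  apply (Filter_prod _ _ _ (fun a => a = 0) (fun b => P (CInt F 0 b) /\ 0 <= b)).
  - reflexivity.
  - apply filter_and; [exact H|]. exists 0. intros; lra.
  - intros a b -> [Hb Hb0]. exists (CInt F 0 b). split; [|exact Hb].
    apply is_CInt_CInt, HF, Hb0.
Qed.

Lemma CInt_half_line_unique (F : R -> C) (l : C) :
  @is_RInt_gen C_R_NormedModule F (at_point 0) (Rbar_locally p_infty) l ->
  CInt_half_line F = l.
Proof.
  intros H. unfold CInt_half_line.
  exact (is_RInt_gen_unique (V:=C_R_CompleteNormedModule)
    (Fa:=at_point 0) (Fb:=Rbar_locally p_infty) F l H).
Qed.

(** The tails M / (1 + a) give the Cauchy criterion, so some limit exists; uniqueness of the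
    generalized integral identifies it with [CInt_half_line F]. *)
Lemma half_line_lim M F : dominated M F ->
  filterlim (fun b => CInt F 0 b) (Rbar_locally p_infty) (locally (CInt_half_line F)).
Proof.
  intros HM. pose proof (dominated_pos _ _ HM) as HM0.
  assert (Hex : exists l : C, filterlim (fun b => CInt F 0 b) (Rbar_locally p_infty) (locally l)).
  { apply (filterlim_locally_cauchy (U:=C_R_CompleteNormedModule)). intros eps.
    destruct (Rdiv_small M eps HM0 (cond_pos eps)) as [N [HN HNs]].
    exists (fun b => N < b). split; [exists N; auto|].
    assert (Hw : forall u v, N < u -> u <= v -> Cmod (CInt F 0 v - CInt F 0 u) < eps).
    { intros u v Hu Huv. rewrite <- (CInt_Chasles F 0 u v) by (apply ex_CInt_continuous, HM).
      replace (CInt F 0 u + CInt F u v - CInt F 0 u)%C with (CInt F u v) by ring.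
      eapply Rle_lt_trans; [apply (dominated_segment M); [exact HM|lra]|]. apply HNs; lra. }
    intros u v Hu Hv. apply ball_C_Cmod.
    destruct (Rle_dec u v) as [h|h]; [apply Hw; auto|].
    rewrite <- Cmod_opp. replace (- (CInt F 0 v - CInt F 0 u))%C with (CInt F 0 u - CInt F 0 v)%C by ring.
    apply Hw; [exact Hv|lra]. }
  destruct Hex as [l Hl].
  replace (CInt_half_line F) with l; [exact Hl|]. symmetry.
  apply CInt_half_line_unique.
  apply is_CInt_half_line_lim; [intros; apply ex_CInt_continuous, HM|exact Hl].
Qed.

Lemma half_line_unique M F (l : C) : dominated M F ->
  filterlim (fun b => CInt F 0 b) (Rbar_locally p_infty) (locally l) -> CInt_half_line F = l.
Proof.
  intros HM H. exact (filterlim_locally_unique (V:=C_R_NormedModule) _ _ _ (half_line_lim M F HM) H).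
Qed.

Lemma Cmod_limit_le {T} (F : (T -> Prop) -> Prop) {FF : ProperFilter F} (f : T -> C) (l : C) D :
  filterlim f F (locally l) -> F (fun x => Cmod (f x) <= D) -> Cmod l <= D.
Proof.
  intros H HD. apply Rle_plus_epsilon. intros eps Heps.
  assert (Hs : 0 < eps / 2) by lra.
  specialize (H _ (locally_ball l (mkposreal _ Hs))). unfold filtermap in H.
  destruct (filter_ex _ (filter_and _ _ H HD)) as [x [[H1 H2] Hx]].
  replace l with (f x - (f x - l))%C by ring.
  eapply Rle_trans; [apply Cmod_triangle|]. rewrite Cmod_opp.
  apply Rplus_le_compat; [exact Hx|].
  eapply Rle_trans; [apply Cmod_le_parts|].
  change (Rabs (Re (f x) + - Re l) < eps / 2) in H1.
  change (Rabs (Im (f x) + - Im l) < eps / 2) in H2.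
  change (Rabs (Re (f x) + - Re l) + Rabs (Im (f x) + - Im l) <= eps). lra.
Qed.

(** The form in which dominated convergence is used: smallness on [0, N] comes from uniform
    convergence on a compact segment, and M / (1 + N) is made small by the choice of N. *)
Lemma half_line_bound M F N eps : dominated M F -> 0 <= N ->
  (forall s, 0 <= s <= N -> Cmod (F s) <= eps) ->
  Cmod (CInt_half_line F) <= N * eps + M / (1 + N).
Proof.
  intros HM HN He. apply (Cmod_limit_le _ _ _ _ (half_line_lim M F HM)).
  exists N. intros b Hb.
  rewrite <- (CInt_Chasles F 0 N b) by (apply ex_CInt_continuous, HM).
  eapply Rle_trans; [apply Cmod_triangle|]. apply Rplus_le_compat.
  - replace N with (N - 0) at 2 by ring.
    apply CInt_bound_const; [exact HN|apply ex_CInt_continuous, HM|exact He].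
  - apply dominated_segment; [exact HM|lra].
Qed.

Lemma half_line_le M F : dominated M F -> Cmod (CInt_half_line F) <= M.
Proof.
  intros HM. pose proof (dominated_pos _ _ HM).
  pose proof (half_line_bound M F 0 M HM (Rle_refl 0)) as Hb.
  replace (0 * M + M / (1 + 0)) with M in Hb by field. apply Hb.
  intros s Hs. replace s with 0 by lra.
  eapply Rle_trans; [apply HM; lra|]. right; field.
Qed.

Lemma dominated_plus M N F G : dominated M F -> dominated N G ->
  dominated (M + N) (fun s => F s + G s)%C.
Proof.
  intros [HF HM] [HG HN]. split; [intros s; apply continuous_Cplus; auto|].
  intros s Hs. eapply Rle_trans; [apply Cmod_triangle|].
  specialize (HM s Hs); specialize (HN s Hs). unfold Rdiv in *. lra.
Qed.

Lemma dominated_scal M F c : dominated M F -> dominated (Cmod c * M) (fun s => c * F s)%C.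
Proof.
  intros [HF HM]. split; [intros s; apply continuous_Cmult; auto; apply continuous_const|].
  intros s Hs. rewrite Cmod_mult. unfold Rdiv. rewrite Rmult_assoc.
  apply Rmult_le_compat_l; [apply Cmod_ge_0|apply HM, Hs].
Qed.

Lemma half_line_plus M N F G : dominated M F -> dominated N G ->
  CInt_half_line (fun s => F s + G s)%C = (CInt_half_line F + CInt_half_line G)%C.
Proof.
  intros HF HG. apply (half_line_unique (M + N)); [apply dominated_plus; assumption|].
  apply (filterlim_ext (fun b => CInt F 0 b + CInt G 0 b)%C).
  - intros b. symmetry. apply CInt_unique, is_CInt_plus; apply is_CInt_CInt, ex_CInt_continuous;
      [apply HF|apply HG].
  - exact (filterlim_comp_2 (F:=Rbar_locally p_infty) _ _ (fun x y => x + y)%C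
      (half_line_lim M F HF) (half_line_lim N G HG)
      (filterlim_plus (V:=C_R_NormedModule) _ _)).
Qed.

Lemma half_line_scal M F c : dominated M F ->
  CInt_half_line (fun s => c * F s)%C = (c * CInt_half_line F)%C.
Proof.
  intros HF. apply (half_line_unique (Cmod c * M)); [apply dominated_scal; assumption|].
  apply (filterlim_ext (fun b => c * CInt F 0 b)%C).
  - intros b. symmetry. apply CInt_unique, is_CInt_scal, is_CInt_CInt, ex_CInt_continuous, HF.
  - apply (filterlim_comp _ _ _ _ (fun z => c * z)%C _ _ _ (half_line_lim M F HF)).
    apply (continuous_Cmult (T:=C_UniformSpace) (fun _ => c) (fun z => z));
      [apply continuous_const|apply continuous_id].
Qed.

(** Regularity is asked of [G] alone. In the applications [F] is an integrand of the original
    formula and [G] its clamped counterpart, equal to it off the endpoint. *)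
Lemma half_line_ext M F G : dominated M G -> (forall s, 0 < s -> F s = G s) ->
  CInt_half_line F = CInt_half_line G.
Proof.
  intros HG H. apply CInt_half_line_unique.
  apply is_CInt_half_line_lim.
  - intros b Hb. apply (ex_RInt_ext G); [|apply ex_CInt_continuous, HG].
    rewrite Rmin_left, Rmax_right by exact Hb. intros s Hs. symmetry; apply H; lra.
  - apply (filterlim_ext_loc (fun b => CInt G 0 b)); [|apply (half_line_lim M), HG].
    exists 0. intros b Hb. apply CInt_ext; [lra|]. intros s Hs. symmetry; apply H; lra.
Qed.

(** * Integrals depending on a variable *)

Lemma ball_C_lt (z w : C) eps : @ball C_UniformSpace z eps w -> Cmod (w - z) < 2 * eps.
Proof.
  intros [H1 H2].
  change (Rabs (Re w + - Re z) < eps) in H1. change (Rabs (Im w + - Im z) < eps) in H2.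
  eapply Rle_lt_trans; [apply Cmod_le_parts|].
  change (Rabs (Re w + - Re z) + Rabs (Im w + - Im z) < 2 * eps). lra.
Qed.

Lemma continuous_C_eps {T : UniformSpace} (f : T -> C) x :
  (forall eps, 0 < eps -> locally x (fun y => Cmod (f y - f x) < eps)) -> continuous f x.
Proof.
  intros H P [eps HP]. specialize (H eps (cond_pos eps)). unfold filtermap.
  revert H. apply filter_imp. intros y Hy. apply HP, ball_C_Cmod, Hy.
Qed.

Lemma continuous_C_locally {T : UniformSpace} (f : T -> C) x eps :
  continuous f x -> 0 < eps -> locally x (fun y => Cmod (f y - f x) < eps).
Proof.
  intros H He. assert (Hs : 0 < eps / 2) by lra.
  specialize (H _ (locally_ball (f x) (mkposreal _ Hs))). unfold filtermap in H.
  revert H. apply filter_imp. intros y Hy. apply ball_C_lt in Hy. simpl in Hy. lra.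
Qed.

(** A Heine argument along [a, b] x {p0}: pointwise continuity gives a gauge in s, and compactness
    of [a, b] turns it into a single radius for p. *)
Lemma tube {P : UniformSpace} (F : R -> P -> C) (p0 : P) a b eps : 0 < eps ->
  (forall s, a <= s <= b -> continuous (fun z : R * P => F (fst z) (snd z)) (s, p0)) ->
  locally p0 (fun p => forall s, a <= s <= b -> Cmod (F s p - F s p0) < eps).
Proof.
  intros He HF.
  assert (Hs : 0 < eps / 2) by lra.
  assert (Hd : forall s, exists d : posreal, a <= s <= b -> forall s' p,
    Rabs (s' - s) < d -> ball p0 d p -> Cmod (F s' p - F s p0) < eps / 2).
  { intros s. destruct (classic (a <= s <= b)) as [h|h].
    - destruct (continuous_C_locally _ _ _ (HF s h) Hs) as [d Hd]. exists d.
      intros _ s' p Hs' Hp. apply (Hd (s', p)). split; assumption.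
    (* Outside [a, b] the radius is arbitrary; the compactness theorem takes a gauge on all of R. *)
    - exists (mkposreal 1 Rlt_0_1). intros h'; contradiction. }
  set (delta := fun s => proj1_sig (constructive_indefinite_description _ (Hd s))).
  assert (Hdelta : forall s, a <= s <= b -> forall s' p,
    Rabs (s' - s) < delta s -> ball p0 (delta s) p -> Cmod (F s' p - F s p0) < eps / 2).
  { intros s. exact (proj2_sig (constructive_indefinite_description _ (Hd s))). }
  destruct (compactness_value_1d a b delta) as [d Hd'].
  (* The compactness theorem yields a doubly negated existence, hence the argument by
     contradiction. *)
  exists d. intros p Hp s Hsab. apply NNPP. intros Hn.
  apply (Hd' s Hsab). intros [t [Ht [Hst Hdt]]]. apply Hn.
  replace (F s p - F s p0)%C with ((F s p - F t p0) - (F s p0 - F t p0))%C by ring.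
  eapply Rle_lt_trans; [apply Cmod_triangle|]. rewrite Cmod_opp.
  assert (Cmod (F s p - F t p0) < eps / 2).
  { apply Hdelta; [exact Ht|exact Hst|]. apply (ball_le _ d); assumption. }
  assert (Cmod (F s p0 - F t p0) < eps / 2).
  { apply Hdelta; [exact Ht|exact Hst|]. apply ball_center. }
  lra.
Qed.

Lemma is_CInt_sub F G a b : ex_CInt F a b -> ex_CInt G a b ->
  (CInt F a b - CInt G a b)%C = CInt (fun s => F s - G s)%C a b /\
  ex_CInt (fun s => F s - G s)%C a b.
Proof.
  intros HF HG.
  pose proof (is_CInt_minus _ _ _ _ _ _ (is_CInt_CInt _ _ _ HF) (is_CInt_CInt _ _ _ HG)) as H.
  split; [symmetry; apply CInt_unique, H|eexists; exact H].
Qed.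

Lemma continuous_CInt_param {P : UniformSpace} (F : R -> P -> C) (p0 : P) a b : a <= b ->
  locally p0 (fun p => ex_CInt (fun s => F s p) a b) ->
  (forall s, a <= s <= b -> continuous (fun z : R * P => F (fst z) (snd z)) (s, p0)) ->
  continuous (fun p => CInt (fun s => F s p) a b) p0.
Proof.
  intros Hab Hex HF. apply continuous_C_eps. intros eps He.
  assert (He' : 0 < eps / (b - a + 1)) by (apply Rdiv_lt_0_compat; lra).
  generalize (filter_and _ _ Hex (tube F p0 a b _ He' HF)). apply filter_imp.
  intros p [Hp Ht]. pose proof (locally_singleton _ _ Hex) as H0; cbv beta in H0.
  destruct (is_CInt_sub _ _ _ _ Hp H0) as [-> Hs].
  eapply Rle_lt_trans; [apply CInt_bound_const; [exact Hab|exact Hs|]|].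
  - intros s Hs'. apply Rlt_le, Ht, Hs'.
  - replace eps with (eps / (b - a + 1) * (b - a + 1)) at 2 by (field; lra). nra.
Qed.

Lemma half_line_sub M N F G : dominated M F -> dominated N G ->
  dominated (M + N) (fun s => F s - G s)%C /\
  (CInt_half_line F - CInt_half_line G)%C = CInt_half_line (fun s => F s - G s)%C.
Proof.
  intros HF HG.
  assert (HG' : dominated N (fun s => (- (1)) * G s)%C).
  { pose proof (dominated_scal N G (- (1))%C HG) as H. rewrite Cmod_m1, Rmult_1_l in H. exact H. }
  pose proof (dominated_plus M N _ _ HF HG') as HD.
  assert (HD' : dominated (M + N) (fun s => F s - G s)%C).
  { destruct HD as [Hc Hm]. split.
    - intros s. apply continuous_Cminus; [apply HF|apply HG].
    - intros s Hs. specialize (Hm s Hs).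
      replace (F s - G s)%C with (F s + (- (1)) * G s)%C by ring. exact Hm. }
  split; [exact HD'|].
  rewrite (half_line_ext (M + N) (fun s => F s - G s)%C (fun s => F s + (- (1)) * G s)%C HD)
    by (intros; ring).
  rewrite (half_line_plus M N), (half_line_scal N) by assumption. ring.
Qed.

Lemma continuous_half_line_param {P : UniformSpace} (F : R -> P -> C) (p0 : P) M :
  locally p0 (fun p => dominated M (fun s => F s p)) ->
  (forall s, 0 <= s -> continuous (fun z : R * P => F (fst z) (snd z)) (s, p0)) ->
  continuous (fun p => CInt_half_line (fun s => F s p)) p0.
Proof.
  intros HM HF. apply continuous_C_eps. intros eps He.
  pose proof (locally_singleton _ _ HM) as H0; cbv beta in H0.
  pose proof (dominated_pos _ _ H0) as HM0.
  destruct (Rdiv_small (M + M) (eps / 2)) as [N [HN HNs]]; [lra|lra|].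
  assert (He' : 0 < eps / 2 / (N + 1)) by (apply Rdiv_lt_0_compat; lra).
  generalize (filter_and _ _ HM (tube F p0 0 N _ He' (fun s h => HF s (proj1 h)))).
  apply filter_imp. intros p [Hp Ht].
  destruct (half_line_sub M M _ _ Hp H0) as [Hd ->].
  eapply Rle_lt_trans; [apply (half_line_bound (M + M) _ N (eps / 2 / (N + 1))); [exact Hd|exact HN|]|].
  - intros s Hs. apply Rlt_le, Ht, Hs.
  - specialize (HNs N (Rle_refl N)).
    assert (N * (eps / 2 / (N + 1)) <= eps / 2); [|lra].
    replace (eps / 2) with (eps / 2 / (N + 1) * (N + 1)) at 2 by (field; lra). nra.
Qed.

Lemma is_deriveC_eps (f : R -> C) x0 l :
  (forall eps, 0 < eps -> locally x0 (fun x =>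
     Cmod (f x - f x0 - RtoC (x - x0) * l) <= eps * Rabs (x - x0))) ->
  is_deriveC f x0 l.
Proof.
  intros H. split.
  - apply (is_linear_scal_l (K:=R_AbsRing) (V:=C_R_NormedModule)).
  - intros x Hx. apply (is_filter_lim_locally_unique (V:=R_NormedModule)) in Hx. subst x.
    intros eps. generalize (H eps (cond_pos eps)). apply filter_imp.
    intros x Hx. rewrite norm_Cmod.
    eapply Rle_trans; [|exact Hx]. apply Req_le. f_equal.
    destruct l as [l1 l2]. apply C_ext; simpl;
      unfold minus, plus, opp, scal, mult; simpl; unfold mult; simpl; ring.
Qed.

(** The mean value bound is applied to F s y - y G s x0, whose y-derivative G s y - G s x0 is
    uniformly small by [tube]; eps / 2 offsets the factor 2 of that bound. *)
Lemma tube_derive (F G : R -> R -> C) x0 a b eps : 0 < eps ->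
  locally x0 (fun x => forall s, a <= s <= b -> is_deriveC (F s) x (G s x)) ->
  (forall s, a <= s <= b -> continuous (fun z : R * R => G (fst z) (snd z)) (s, x0)) ->
  locally x0 (fun x => forall s, a <= s <= b ->
    Cmod (F s x - F s x0 - RtoC (x - x0) * G s x0) <= eps * Rabs (x - x0)).
Proof.
  intros He HF HG. assert (He' : 0 < eps / 2) by lra.
  destruct (filter_and _ _ HF (tube (P:=R_UniformSpace) G x0 a b _ He' HG)) as [d Hd].
  exists d. intros x Hx s Hs.
  assert (Hxd : Rabs (x - x0) < d) by exact Hx.
  replace (F s x - F s x0 - RtoC (x - x0) * G s x0)%C
    with ((F s x - RtoC x * G s x0) - (F s x0 - RtoC x0 * G s x0))%C
    by (rewrite RtoC_minus; ring).
  replace (eps * Rabs (x - x0)) with (2 * (eps / 2) * Rabs (x - x0)) by field.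
  apply (mean_value_C (fun y => F s y - RtoC y * G s x0)%C (fun y => G s y - G s x0)%C).
  intros t Ht.
  destruct (Hd t (Rle_lt_trans _ _ _ Ht Hxd)) as [H1 H2]. split.
  - eapply is_derive_value.
    + apply is_deriveC_minus; [apply H1, Hs|].
      apply (is_deriveC_mult (fun y => RtoC y) (fun _ => G s x0)).
      * apply is_deriveC_RtoC, (is_derive_id (K:=R_AbsRing)).
      * apply is_deriveC_const.
    + simpl. change (@one (AbsRing.Ring R_AbsRing)) with 1.
      as_C_eq. ring.
  - apply Rlt_le, H2, Hs.
Qed.

Lemma is_deriveC_CInt_param (F G : R -> R -> C) x0 a b : a <= b ->
  locally x0 (fun x => ex_CInt (fun s => F s x) a b) ->
  ex_CInt (fun s => G s x0) a b ->
  locally x0 (fun x => forall s, a <= s <= b -> is_deriveC (F s) x (G s x)) ->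
  (forall s, a <= s <= b -> continuous (fun z : R * R => G (fst z) (snd z)) (s, x0)) ->
  is_deriveC (fun x => CInt (fun s => F s x) a b) x0 (CInt (fun s => G s x0) a b).
Proof.
  intros Hab HF HG HFG Hc. apply is_deriveC_eps. intros eps He.
  assert (He' : 0 < eps / (b - a + 1)) by (apply Rdiv_lt_0_compat; lra).
  generalize (filter_and _ _ HF (tube_derive F G x0 a b _ He' HFG Hc)). apply filter_imp.
  intros x [Hx Ht]. pose proof (locally_singleton _ _ HF) as H0; cbv beta in H0.
  pose proof (is_CInt_minus _ _ _ _ _ _ (is_CInt_minus _ _ _ _ _ _ (is_CInt_CInt _ _ _ Hx)
    (is_CInt_CInt _ _ _ H0)) (is_CInt_scal _ _ _ _ (RtoC (x - x0)) (is_CInt_CInt _ _ _ HG))) as H.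
  cbv beta in H. rewrite <- (CInt_unique _ _ _ _ H).
  eapply Rle_trans; [apply CInt_bound_const; [exact Hab|eexists; exact H|exact Ht]|].
  assert (0 <= Rabs (x - x0)) by apply Rabs_pos.
  replace (eps * Rabs (x - x0)) with (eps / (b - a + 1) * (b - a + 1) * Rabs (x - x0)) by (field; lra).
  assert (0 <= eps / (b - a + 1) * Rabs (x - x0)) by (apply Rmult_le_pos; lra). nra.
Qed.

(** The remainder of the first order expansion is small on [0, N] by [tube_derive]. Beyond N it is
    merely dominated, but with a constant proportional to |x - x0|, which suffices. *)
Lemma is_deriveC_half_line_param (F G : R -> R -> C) x0 M :
  locally x0 (fun x => dominated M (fun s => F s x)) ->
  locally x0 (fun x => dominated M (fun s => G s x)) ->
  locally x0 (fun x => forall s, 0 <= s -> is_deriveC (F s) x (G s x)) ->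
  (forall s, 0 <= s -> continuous (fun z : R * R => G (fst z) (snd z)) (s, x0)) ->
  is_deriveC (fun x => CInt_half_line (fun s => F s x)) x0 (CInt_half_line (fun s => G s x0)).
Proof.
  intros HF HG HFG Hc. apply is_deriveC_eps. intros eps He.
  pose proof (locally_singleton _ _ HF) as HF0; pose proof (locally_singleton _ _ HG) as HG0.
  cbv beta in HF0, HG0. pose proof (dominated_pos _ _ HF0) as HM0.
  (* The increment contributes 2 M by the mean value bound and the linear term M; 4 M covers
     both. *)
  destruct (Rdiv_small (4 * M) (eps / 2)) as [N [HN HNs]]; [lra|lra|].
  assert (He' : 0 < eps / 2 / (N + 1)) by (apply Rdiv_lt_0_compat; lra).
  assert (HFG' : locally x0 (fun x => forall s, 0 <= s <= N -> is_deriveC (F s) x (G s x))).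
  { revert HFG. apply filter_imp. intros x Hx s Hs. apply Hx; lra. }
  pose proof (tube_derive F G x0 0 N _ He' HFG' (fun s h => Hc s (proj1 h))) as [d1 Hd1].
  destruct (filter_and _ _ HF (filter_and _ _ HG HFG)) as [d2 Hd2].
  exists (mkposreal _ (Rmin_stable_in_posreal d1 d2)). intros x Hx.
  assert (Hxd : Rabs (x - x0) < Rmin d1 d2) by exact Hx.
  pose proof (Rmin_l d1 d2); pose proof (Rmin_r d1 d2).
  assert (Hx1 : @ball R_UniformSpace x0 d1 x) by (change (Rabs (x - x0) < d1); lra).
  assert (Hx2 : @ball R_UniformSpace x0 d2 x) by (change (Rabs (x - x0) < d2); lra).
  destruct (Hd2 x Hx2) as [HFx _]. pose proof (Hd1 x Hx1) as Ht.
  destruct (half_line_sub _ _ _ _ HFx HF0) as [Hs1 E1].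
  pose proof (dominated_scal _ _ (RtoC (x - x0)) HG0) as Hs2.
  destruct (half_line_sub _ _ _ _ Hs1 Hs2) as [Hs3 E3].
  rewrite E1, <- (half_line_scal M) by exact HG0. rewrite E3.
  assert (Hpos : 0 <= Rabs (x - x0)) by apply Rabs_pos.
  eapply Rle_trans.
  - apply (half_line_bound (4 * M * Rabs (x - x0)) _ N (eps / 2 / (N + 1) * Rabs (x - x0)));
      [|exact HN|exact Ht].
    split; [apply Hs3|]. intros s Hs.
    eapply Rle_trans; [apply Cmod_triangle|].
    rewrite Cmod_opp, Cmod_mult, Cmod_R.
    assert (H1 : Cmod (F s x - F s x0) <= 2 * (M / (1 + s) ^ 2) * Rabs (x - x0)).
    { apply (mean_value_C (F s) (G s)). intros t Ht'.
      assert (Hx3 : @ball R_UniformSpace x0 d2 t) by (change (Rabs (t - x0) < d2); lra).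
      destruct (Hd2 t Hx3) as [_ [Hg Hfg]]. split; [apply Hfg, Hs|apply Hg, Hs]. }
    assert (H2 : Cmod (G s x0) <= M / (1 + s) ^ 2) by (apply HG0, Hs).
    assert (0 <= M / (1 + s) ^ 2) by (pose proof (Cmod_ge_0 (G s x0)); lra).
    replace (4 * M * Rabs (x - x0) / (1 + s) ^ 2) with (4 * (M / (1 + s) ^ 2) * Rabs (x - x0)) by (unfold Rdiv; ring).
    assert (0 <= M / (1 + s) ^ 2 * Rabs (x - x0)) by (apply Rmult_le_pos; assumption).
    assert (Rabs (x - x0) * Cmod (G s x0) <= Rabs (x - x0) * (M / (1 + s) ^ 2))
      by (apply Rmult_le_compat_l; assumption). lra.
  - specialize (HNs N (Rle_refl N)).
    assert (N * (eps / 2 / (N + 1)) <= eps / 2).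
    { replace (eps / 2) with (eps / 2 / (N + 1) * (N + 1)) at 2 by (field; lra). nra. }
    replace (N * (eps / 2 / (N + 1) * Rabs (x - x0)) + 4 * M * Rabs (x - x0) / (1 + N))
      with ((N * (eps / 2 / (N + 1)) + 4 * M / (1 + N)) * Rabs (x - x0)) by (unfold Rdiv; ring).
    apply Rmult_le_compat_r; lra.
Qed.

(* The derivative is only required in the interior, where two-sided derivatives make sense. *)
Lemma CInt_FTC (f g : R -> C) b : 0 < b ->
  (forall s, continuous f s) -> (forall s, continuous g s) ->
  (forall s, 0 < s -> is_deriveC f s (g s)) ->
  CInt g 0 b = (f b - f 0)%C.
Proof.
  intros Hb Hf Hg Hfg.
  set (h := fun r => (CInt g 0 r - f r)%C).
  assert (Hh : forall r, 0 < r -> is_deriveC h r (RtoC 0)).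
  { intros r Hr. eapply is_derive_value.
    - apply is_deriveC_minus; [|apply Hfg, Hr].
      apply (is_derive_RInt (V:=C_R_NormedModule) g _ 0); [|apply Hg].
      exists (mkposreal 1 Rlt_0_1). intros y _. apply is_CInt_CInt, ex_CInt_continuous, Hg.
    - as_C_eq. ring. }
  assert (Hhc : continuous h 0).
  { apply continuous_Cminus; [|apply Hf].
    apply (is_deriveC_continuous _ _ (g 0)).
    apply (is_derive_RInt (V:=C_R_NormedModule) g _ 0); [|apply Hg].
    exists (mkposreal 1 Rlt_0_1). intros y _. apply is_CInt_CInt, ex_CInt_continuous, Hg. }
  assert (Hconst : forall r, 0 < r <= b -> h r = h b).
  { intros r Hr. assert (Hz : Cmod (h r - h b) <= 0).
    { replace 0 with (2 * 0 * Rabs (r - b)) by ring.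
      apply (mean_value_C h (fun _ => RtoC 0)). intros t Ht. split; [|rewrite Cmod_0; lra].
      apply Hh. rewrite (Rabs_left1 (r - b)) in Ht by lra. apply Rabs_le_between in Ht. lra. }
    assert (E : (h r - h b)%C = RtoC 0).
    { apply Cmod_eq_0. pose proof (Cmod_ge_0 (h r - h b)). lra. }
    replace (h r) with (h r - h b + h b)%C by ring. rewrite E. ring. }
  (* Continuity extends the constant value from (0, b] to 0: otherwise some point near 0 would carry
     the value h b at distance less than |h b - h 0| from h 0. *)
  assert (E : h 0 = h b).
  { apply NNPP. intros Hne.
    assert (Hpos : 0 < Cmod (h b - h 0)).
    { apply Cmod_gt_0. intros Hz. apply Hne.
      replace (h b) with (h b - h 0 + h 0)%C by ring. rewrite Hz. ring. }
    destruct (continuous_C_locally h 0 _ Hhc Hpos) as [d Hd].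
    assert (Hd2 : 0 < Rmin (d / 2) b) by (apply Rmin_glb_lt; [pose proof (cond_pos d); lra|exact Hb]).
    pose proof (Rmin_l (d / 2) b); pose proof (Rmin_r (d / 2) b).
    specialize (Hd (Rmin (d / 2) b)). rewrite Hconst in Hd by lra.
    assert (Hball : @ball R_UniformSpace 0 d (Rmin (d / 2) b)).
    { change (Rabs (Rmin (d / 2) b - 0) < d). rewrite Rminus_0_r, Rabs_pos_eq by lra.
      pose proof (cond_pos d). lra. }
    specialize (Hd Hball). lra. }
  unfold h in E.
  assert (E0 : CInt g 0 0 = RtoC 0)
    by exact (RInt_point (V:=C_R_CompleteNormedModule) 0 g).
  rewrite E0 in E.
  replace (CInt g 0 b) with (CInt g 0 b - f b + f b)%C by ring. rewrite <- E. ring.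
Qed.

(** * Rapidly decreasing functions and contour integrals *)

Definition continuous_on_quadrant (h : R -> R -> C) : Prop :=
  forall x t, 0 < x -> 0 < t ->
    continuous (fun p : R * R => h (fst p) (snd p)) (x, t).

(** The bounds reach down to t = 0 but start at x = 1, so that a factor 1/x never spoils them;
    elsewhere only continuity in the open quadrant is recorded. *)
Definition rapid0 (h : R -> R -> C) : Prop :=
  continuous_on_quadrant h /\
  forall (l : nat) T, 0 < T -> exists M, forall x t, 1 <= x -> 0 < t <= T ->
    x ^ l * Cmod (h x t) <= M.

Fixpoint rapid (n : nat) (h : R -> R -> C) : Prop :=
  rapid0 h /\
  match n with
  | O => True
  | S n => exists h' : R -> R -> C,
      (forall x t, 0 < x -> 0 < t -> is_deriveC (fun y => h y t) x (h' x t)) /\ rapid n h'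
  end.

Lemma locally_quadrant (x t : R) : 0 < x -> 0 < t ->
  locally (T:=prod_UniformSpace R_UniformSpace R_UniformSpace) (x, t)
    (fun p => x / 2 < fst p < 2 * x /\ t / 2 < snd p < 2 * t).
Proof.
  intros Hx Ht. assert (Hd : 0 < Rmin (x / 2) (t / 2)) by (apply Rmin_glb_lt; lra).
  exists (mkposreal _ Hd). intros [y s] [H1 H2].
  change (Rabs (y - x) < Rmin (x / 2) (t / 2)) in H1.
  change (Rabs (s - t) < Rmin (x / 2) (t / 2)) in H2.
  pose proof (Rmin_l (x / 2) (t / 2)); pose proof (Rmin_r (x / 2) (t / 2)).
  apply Rabs_def2 in H1; apply Rabs_def2 in H2. simpl. lra.
Qed.

Lemma continuous_on_quadrant_ext (h k : R -> R -> C) :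
  (forall x t, 0 < x -> 0 < t -> h x t = k x t) ->
  continuous_on_quadrant h -> continuous_on_quadrant k.
Proof.
  intros H Hh x t Hx Ht.
  apply (continuous_ext_loc _ (fun p : R * R => h (fst p) (snd p))); [|apply Hh; assumption].
  generalize (locally_quadrant x t Hx Ht). apply filter_imp. intros p Hp. destruct p as [y s]; simpl in *; apply H; lra.
Qed.

Lemma rapid_ext n : forall h k : R -> R -> C,
  (forall x t, 0 < x -> 0 < t -> h x t = k x t) -> rapid n h -> rapid n k.
Proof.
  assert (H0 : forall h k : R -> R -> C,
    (forall x t, 0 < x -> 0 < t -> h x t = k x t) -> rapid0 h -> rapid0 k).
  { intros h k H [Hc Hb]. split; [apply (continuous_on_quadrant_ext h); assumption|].
    intros l T HT. destruct (Hb l T HT) as [M HM]. exists M. intros x t Hx Ht.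
    rewrite <- H by lra. apply HM; assumption. }
  destruct n as [|n]; intros h k H [Hh Hn]; (split; [apply (H0 h); assumption|]); [exact I|].
  destruct Hn as [h' [Hd Hn]]. exists h'. split; [|exact Hn].
  intros x t Hx Ht. apply (is_deriveC_ext_pos (fun y => h y t)); auto.
Qed.

Lemma rapid_rapid0 n h : rapid n h -> rapid0 h.
Proof. destruct n; intros [H _]; exact H. Qed.

Lemma rapid_pred n : forall h, rapid (S n) h -> rapid n h.
Proof.
  induction n as [|n IH]; intros h [H0 [h' [Hd Hn]]]; (split; [exact H0|]); [exact I|].
  exists h'. split; [exact Hd|apply IH, Hn].
Qed.

Lemma rapid_plus n : forall h k, rapid n h -> rapid n k -> rapid n (fun x t => h x t + k x t)%C.
Proof.
  assert (H0 : forall h k, rapid0 h -> rapid0 k -> rapid0 (fun x t => h x t + k x t)%C).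
  { intros h k [Hc Hb] [Kc Kb]. split.
    - intros x t Hx Ht. apply continuous_Cplus; auto.
    - intros l T HT. destruct (Hb l T HT) as [M HM], (Kb l T HT) as [N HN].
      exists (M + N). intros x t Hx Ht. specialize (HM x t Hx Ht); specialize (HN x t Hx Ht).
      assert (0 <= x ^ l) by (apply pow_le; lra).
      pose proof (Rmult_le_compat_l _ _ _ H (Cmod_triangle (h x t) (k x t))). lra. }
  induction n as [|n IH]; intros h k [Hh Hn] [Hk Kn]; (split; [apply H0; assumption|]); [exact I|].
  destruct Hn as [h' [Hd Hn]], Kn as [k' [Kd Kn]].
  exists (fun x t => h' x t + k' x t)%C. split; [|apply IH; assumption].
  intros x t Hx Ht. apply is_deriveC_plus; auto.
Qed.

Lemma rapid_scal n c : forall h, rapid n h -> rapid n (fun x t => c * h x t)%C.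
Proof.
  assert (H0 : forall h, rapid0 h -> rapid0 (fun x t => c * h x t)%C).
  { intros h [Hc Hb]. split.
    - intros x t Hx Ht. apply continuous_Cmult; [apply continuous_const|auto].
    - intros l T HT. destruct (Hb l T HT) as [M HM]. exists (Cmod c * M).
      intros x t Hx Ht. specialize (HM x t Hx Ht). rewrite Cmod_mult.
      pose proof (Cmod_ge_0 c). nra. }
  induction n as [|n IH]; intros h [Hh Hn]; (split; [apply H0; assumption|]); [exact I|].
  destruct Hn as [h' [Hd Hn]].
  exists (fun x t => c * h' x t)%C. split; [|apply IH; assumption].
  intros x t Hx Ht. eapply is_derive_value.
  - apply (is_deriveC_mult (fun _ => c)); [apply is_deriveC_const|apply Hd; assumption].
  - as_C_eq. cbv beta. ring.
Qed.

(** By the quotient rule the derivative is h'/x - h/x^2; the second term is reached by applying the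
    induction hypothesis twice. For x >= 1 the factor 1/x is at most 1. *)
Lemma rapid_div_x n : forall h, rapid n h -> rapid n (fun x t => RtoC (/ x) * h x t)%C.
Proof.
  assert (H0 : forall h, rapid0 h -> rapid0 (fun x t => RtoC (/ x) * h x t)%C).
  { intros h [Hc Hb]. split.
    - intros x t Hx Ht. apply continuous_Cmult; [|auto].
      apply continuous_RtoC.
      apply (continuous_comp fst Rinv); [apply continuous_fst'|].
      apply (ex_derive_continuous (V:=R_NormedModule)). auto_derive. simpl. lra.
    - intros l T HT. destruct (Hb l T HT) as [M HM]. exists M.
      intros x t Hx Ht. specialize (HM x t Hx Ht). rewrite Cmod_mult, Cmod_R.
      assert (0 < / x) by (apply Rinv_0_lt_compat; lra).
      assert (/ x <= 1) by (rewrite <- Rinv_1; apply Rinv_le_contravar; lra).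
      rewrite Rabs_pos_eq by lra.
      assert (0 <= x ^ l * Cmod (h x t)) by (apply Rmult_le_pos; [apply pow_le; lra|apply Cmod_ge_0]).
      nra. }
  induction n as [|n IH]; intros h Hh; (split; [apply H0, (rapid_rapid0 _ _ Hh)|]); [exact I|].
  pose proof (IH _ (rapid_pred _ _ Hh)) as H1.
  destruct Hh as [_ [h' [Hd Hn]]].
  exists (fun x t => RtoC (/ x) * h' x t + (- (1)) * (RtoC (/ x) * (RtoC (/ x) * h x t)))%C. split.
  - intros x t Hx Ht. eapply is_derive_value.
    + apply (is_deriveC_mult (fun y => RtoC (/ y))); [|apply Hd; assumption].
      apply is_deriveC_RtoC. apply (is_derive_inv (fun y => y) x 1); [|lra].
      apply (is_derive_id (K:=R_AbsRing)).
    + as_C_eq. cbv beta.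
      replace (- (1) / x ^ 2) with (- (/ x * / x)) by (field; lra).
      rewrite RtoC_opp, RtoC_mult. ring.
  - apply rapid_plus; [apply IH, Hn|]. apply rapid_scal, IH, H1.
Qed.

Lemma rapid_zero n : rapid n (fun _ _ => RtoC 0).
Proof.
  induction n as [|n IH]; (split; [split|]).
  1,4: intros x t _ _; apply continuous_const.
  1,3: intros l T _; exists 0; intros; rewrite Cmod_0, Rmult_0_r; apply Rle_refl.
  - exact I.
  - exists (fun _ _ => RtoC 0). split; [intros; apply is_deriveC_const|exact IH].
Qed.

(** The last factor [e] is d lambda / dr. For r < 0 the clamp freezes lambda at the vertex. *)
Definition ray_integrand (e : C) (W : nat -> nat -> R -> R -> C) (a b q : nat) (x t r : R) : C :=
  (Cexp (Ci * (RtoC (Rmax 0 r) * e) * RtoC x) * ((RtoC (Rmax 0 r) * e) ^ a * W b q r t) * e)%C.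

Definition ray_integral (e : C) (W : nat -> nat -> R -> R -> C) (a b q : nat) (x t : R) : C :=
  CInt_half_line (ray_integrand e W a b q x t).

(* [W b q r t] plays the role of the function of lambda = r e obtained from
   exp(- lambda^2 s) and the transform of y^q f by inserting the weight s^b;
   [c] is - i or i according to the sign in the transform exp(-+ i lambda y). *)
Record symbol_family (o : nat) (e c : C) (W : nat -> nat -> R -> R -> C) : Prop := {
  symbol_unit : Cmod e = 1;
  symbol_continuous : forall b q p,
    continuous (fun p : R * R => W b q (fst p) (snd p)) p;
  symbol_derive : forall b q r t, 0 < r -> 0 < t ->
    is_deriveC (fun r => W b q r t) r
      (e * (c * W b (S q) r t - 2 * (RtoC r * e) * W (S b) q r t))%C;
  symbol_local_bound : forall a b q, (a <= 2 * b + q + o)%nat ->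
    forall d eps T, 0 < d -> 0 < eps -> exists M, forall x t, d <= x -> eps <= t <= T ->
      forall r, 0 <= r -> Cmod (ray_integrand e W a b q x t r) <= M / (1 + r) ^ 2;
  symbol_uniform_bound : forall a b q, (a + 2 <= 2 * b + q + o)%nat ->
    forall d T, 0 < d -> exists M, forall x t, d <= x -> 0 < t <= T ->
      forall r, 0 <= r -> Cmod (ray_integrand e W a b q x t r) <= M / (1 + r) ^ 2
}.

(** * Integrals along one ray *)

Section Ray.
Context (o : nat) (e c : C) (W : nat -> nat -> R -> R -> C) (HW : symbol_family o e c W).

Lemma ray_integrand_continuous a b q (z : R * (R * R)) :
  continuous (fun z : R * (R * R) => ray_integrand e W a b q (fst (snd z)) (snd (snd z)) (fst z)) z.
Proof.
  assert (Hl : continuous (fun z : R * (R * R) => RtoC (Rmax 0 (fst z)) * e)%C z).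
  { apply continuous_Cmult; [|apply continuous_const].
    apply continuous_RtoC, continuous_Rmax0, continuous_fst'. }
  assert (Hx : continuous (fun z : R * (R * R) => RtoC (fst (snd z))) z).
  { apply continuous_RtoC. apply (continuous_comp snd fst); [apply continuous_snd'|apply continuous_fst']. }
  apply continuous_Cmult; [|apply continuous_const]. apply continuous_Cmult.
  - apply continuous_Cexp, continuous_Cmult; [|exact Hx].
    apply continuous_Cmult; [apply continuous_const|exact Hl].
  - apply continuous_Cmult; [apply continuous_Cpow, Hl|].
    apply (continuous_comp_2 (U:=prod_UniformSpace R_UniformSpace (prod_UniformSpace R_UniformSpace R_UniformSpace))
       (V:=R_UniformSpace) (W:=R_UniformSpace) (X:=C_UniformSpace)
       (fun z => fst z) (fun z => snd (snd z)) (fun r t => W b q r t)).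
    + apply continuous_fst'.
    + apply (continuous_comp snd snd); apply continuous_snd'.
    + apply (symbol_continuous _ _ _ _ HW).
Qed.

Lemma ray_integrand_continuous_r a b q x t r : continuous (ray_integrand e W a b q x t) r.
Proof.
  apply (continuous_comp_2 (U:=R_UniformSpace) (V:=R_UniformSpace)
    (W:=prod_UniformSpace R_UniformSpace R_UniformSpace) (X:=C_UniformSpace)
    (fun r => r) (fun _ => (x, t)) (fun r p => ray_integrand e W a b q (fst p) (snd p) r)).
  - apply continuous_id.
  - apply continuous_const.
  - apply ray_integrand_continuous.
Qed.

Lemma ray_dominated a b q d eps T : (a <= 2 * b + q + o)%nat -> 0 < d -> 0 < eps ->
  exists M, forall x t, d <= x -> eps <= t <= T -> dominated M (ray_integrand e W a b q x t).
Proof.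
  intros Ha Hd He.
  destruct (symbol_local_bound _ _ _ _ HW a b q Ha d eps T Hd He) as [M HM].
  exists M. intros x t Hx Ht. split; [apply ray_integrand_continuous_r|auto].
Qed.

Lemma ray_integral_continuous a b q : (a <= 2 * b + q + o)%nat ->
  continuous_on_quadrant (ray_integral e W a b q).
Proof.
  intros Ha x t Hx Ht. assert (Hx2 : 0 < x / 2) by lra. assert (Ht2 : 0 < t / 2) by lra.
  destruct (ray_dominated a b q (x / 2) (t / 2) (2 * t) Ha Hx2 Ht2) as [M HM].
  apply (continuous_half_line_param (P:=prod_UniformSpace R_UniformSpace R_UniformSpace)
    (fun r p => ray_integrand e W a b q (fst p) (snd p) r) (x, t) M).
  - generalize (locally_quadrant x t Hx Ht). apply filter_imp.
    intros p Hp. apply HM; lra.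
  - intros s _. apply ray_integrand_continuous.
Qed.

(** The differentiated integrand has index [S a] and must itself meet the condition for convergence,
    so one unit of order is spent. *)
Lemma ray_integral_derive a b q x t : (a + 1 <= 2 * b + q + o)%nat -> 0 < x -> 0 < t ->
  is_deriveC (fun y => ray_integral e W a b q y t) x (Ci * ray_integral e W (S a) b q x t)%C.
Proof.
  intros Ha Hx Ht. assert (Hx2 : 0 < x / 2) by lra.
  destruct (ray_dominated a b q (x / 2) t t ltac:(lia) Hx2 Ht) as [M1 HM1].
  destruct (ray_dominated (S a) b q (x / 2) t t ltac:(lia) Hx2 Ht) as [M2 HM2].
  assert (Hloc : locally x (fun y : R => x / 2 <= y)).
  { exists (mkposreal _ Hx2). intros y Hy. change (Rabs (y - x) < x / 2) in Hy.
    apply Rabs_def2 in Hy. lra. }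
  assert (Hx' : x / 2 <= x) by lra. assert (Ht' : t <= t <= t) by lra.
  eapply is_derive_value;
    [|exact (half_line_scal M2 (ray_integrand e W (S a) b q x t) Ci (HM2 x t Hx' Ht'))].
  pose proof (dominated_pos _ _ (HM1 x t Hx' Ht')).
  pose proof (dominated_pos _ _ (HM2 x t Hx' Ht')).
  apply (is_deriveC_half_line_param (fun r y => ray_integrand e W a b q y t r)
    (fun r y => Ci * ray_integrand e W (S a) b q y t r)%C x (M1 + M2)).
  - revert Hloc. apply filter_imp. intros y Hy. apply (dominated_le M1); [lra|]. apply HM1; assumption.
  - revert Hloc. apply filter_imp. intros y Hy.
    pose proof (dominated_scal _ _ Ci (HM2 y t Hy Ht')) as HD.
    rewrite Cmod_Ci, Rmult_1_l in HD. apply (dominated_le M2); [lra|exact HD].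
  - exists (mkposreal 1 Rlt_0_1). intros y _ r _. unfold ray_integrand.
    eapply is_derive_value.
    + apply (is_deriveC_mult (fun y => _) (fun _ => e)); [|apply is_deriveC_const].
      apply (is_deriveC_mult (fun y => _) (fun _ => _)); [|apply is_deriveC_const].
      apply is_deriveC_Cexp.
      apply (is_deriveC_mult (fun _ => _) (fun y => RtoC y)); [apply is_deriveC_const|].
      apply is_deriveC_RtoC, (is_derive_id (K:=R_AbsRing)).
    + as_C_eq. cbv beta. simpl Cpow.
      change (@one (AbsRing.Ring R_AbsRing)) with 1. ring.
  - intros s _. apply continuous_Cmult; [apply continuous_const|].
    apply (continuous_comp (fun z : R * R => (fst z, (snd z, t)))
      (fun z : R * (R * R) => ray_integrand e W (S a) b q (fst (snd z)) (snd (snd z)) (fst z)));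
      [|apply ray_integrand_continuous].
    apply continuous_pair; [apply continuous_fst'|].
    apply continuous_pair; [apply continuous_snd'|apply continuous_const].
Qed.

(** The function to integrate is the derivative of f = exp(i lambda x) lambda^a W: its three factors
    give the term with i x, the term with a, and the two terms of [symbol_derive]. As |e| = 1, f has
    the modulus of the dominated integrand and tends to 0 at infinity, so only - f(0) remains. *)
Lemma ray_integral_by_parts a b q x t : (a <= 2 * b + q + o)%nat -> 0 < x -> 0 < t ->
  (RtoC x * ray_integral e W a b q x t =
   Ci * ((RtoC 0 * e) ^ a * W b q 0 t)
   + Ci * (RtoC (INR a) * ray_integral e W (pred a) b q x t
           + (- (2)) * ray_integral e W (S a) (S b) q x t
           + c * ray_integral e W a b (S q) x t))%C.
Proof.
  intros Ha Hx Ht.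
  assert (Hdom : forall a b q, (a <= 2 * b + q + o)%nat ->
    exists M, dominated M (ray_integrand e W a b q x t)).
  { intros a' b' q' H. destruct (ray_dominated a' b' q' x t t H Hx Ht) as [M HM].
    exists M. apply HM; lra. }
  destruct (Hdom a b q Ha) as [M HM].
  destruct (Hdom (pred a) b q ltac:(lia)) as [M1 HM1].
  destruct (Hdom (S a) (S b) q ltac:(lia)) as [M2 HM2].
  destruct (Hdom a b (S q) ltac:(lia)) as [M3 HM3].
  set (f := fun r => (Cexp (Ci * (RtoC (Rmax 0 r) * e) * RtoC x) *
    ((RtoC (Rmax 0 r) * e) ^ a * W b q r t))%C).
  set (g := fun r => (Ci * RtoC x * ray_integrand e W a b q x t r
    + (RtoC (INR a) * ray_integrand e W (pred a) b q x t r
       + (- (2)) * ray_integrand e W (S a) (S b) q x t r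
       + c * ray_integrand e W a b (S q) x t r))%C).
  pose proof (dominated_scal _ _ (Ci * RtoC x)%C HM) as D0.
  pose proof (dominated_scal _ _ (RtoC (INR a)) HM1) as D1.
  pose proof (dominated_scal _ _ (- (2))%C HM2) as D2.
  pose proof (dominated_scal _ _ c HM3) as D3.
  pose proof (dominated_plus _ _ _ _ D1 D2) as D12.
  pose proof (dominated_plus _ _ _ _ D12 D3) as D123.
  pose proof (dominated_plus _ _ _ _ D0 D123) as D.
  assert (Hint : CInt_half_line g = (Ci * RtoC x * ray_integral e W a b q x t
    + (RtoC (INR a) * ray_integral e W (pred a) b q x t
       + (- (2)) * ray_integral e W (S a) (S b) q x t
       + c * ray_integral e W a b (S q) x t))%C).
  { unfold g, ray_integral.
    rewrite (half_line_plus _ _ _ _ D0 D123), (half_line_plus _ _ _ _ D12 D3),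
      (half_line_plus _ _ _ _ D1 D2).
    rewrite (half_line_scal _ _ _ HM), (half_line_scal _ _ _ HM1),
      (half_line_scal _ _ _ HM2), (half_line_scal _ _ _ HM3). reflexivity. }
  assert (Hfe : forall r, (f r * e = ray_integrand e W a b q x t r)%C) by reflexivity.
  assert (Hfc : forall r, continuous f r).
  { intros r.
    assert (Hl : continuous (fun r => RtoC (Rmax 0 r) * e)%C r).
    { apply continuous_Cmult; [|apply continuous_const].
      apply continuous_RtoC, continuous_Rmax0, continuous_id. }
    apply continuous_Cmult.
    - apply continuous_Cexp, continuous_Cmult; [|apply continuous_const].
      apply continuous_Cmult; [apply continuous_const|exact Hl].
    - apply continuous_Cmult; [apply continuous_Cpow, Hl|].
      apply (continuous_comp_2 (U:=R_UniformSpace) (fun r => r) (fun _ => t) (W b q));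
        [apply continuous_id|apply continuous_const|apply (symbol_continuous _ _ _ _ HW)]. }
  assert (Hfg : forall r, 0 < r -> is_deriveC f r (g r)).
  { intros r Hr.
    apply (is_deriveC_ext_pos (fun r => Cexp (Ci * (RtoC r * e) * RtoC x) *
      ((RtoC r * e) ^ a * W b q r t))%C); [exact Hr| |].
    { intros y Hy. unfold f. rewrite Rmax_right by lra. reflexivity. }
    assert (Hl : is_deriveC (fun r => RtoC r * e)%C r e).
    { eapply is_derive_value.
      - apply (is_deriveC_mult (fun y => RtoC y) (fun _ => e)); [|apply is_deriveC_const].
        apply is_deriveC_RtoC, (is_derive_id (K:=R_AbsRing)).
      - as_C_eq.
        change (@one (AbsRing.Ring R_AbsRing)) with 1. ring. }
    eapply is_derive_value.
    - apply is_deriveC_mult.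
      + apply is_deriveC_Cexp. apply (is_deriveC_mult _ (fun _ => RtoC x)); [|apply is_deriveC_const].
        apply (is_deriveC_mult (fun _ => Ci)); [apply is_deriveC_const|exact Hl].
      + apply is_deriveC_mult; [apply is_deriveC_Cpow, Hl|].
        apply (symbol_derive _ _ _ _ HW); assumption.
    - as_C_eq.
      unfold g, ray_integrand. rewrite Rmax_right by lra. simpl Cpow. ring. }
  assert (Hlim : CInt_half_line g = (- f 0)%C).
  { apply (half_line_unique _ _ _ D).
    apply (filterlim_ext_loc (fun r => f r - f 0)%C).
    { exists 0. intros r Hr. symmetry. apply CInt_FTC; [exact Hr|exact Hfc|apply D|exact Hfg]. }
    intros P [eps HP]. pose proof (dominated_pos _ _ HM) as HM0.
    destruct (Rdiv_small M eps HM0 (cond_pos eps)) as [N [HN HNs]].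
    exists N. intros r Hr. apply HP, ball_C_Cmod.
    replace (f r - f 0 - - f 0)%C with (f r) by ring.
    replace (Cmod (f r)) with (Cmod (ray_integrand e W a b q x t r))
      by (rewrite <- Hfe, Cmod_mult, (symbol_unit _ _ _ _ HW); ring).
    eapply Rle_lt_trans; [apply HM; lra|].
    apply Rle_lt_trans with (M / (1 + r)); [|apply HNs; lra].
    apply Rmult_le_compat_l; [exact HM0|]. apply Rinv_le_contravar; nra. }
  assert (Hf0 : f 0 = ((RtoC 0 * e) ^ a * W b q 0 t)%C).
  { unfold f. rewrite Rmax_left by lra.
    replace (Ci * (RtoC 0 * e) * RtoC x)%C with (RtoC 0) by ring. rewrite Cexp_0. ring. }
  rewrite <- Hf0.
  rewrite Hint in Hlim.
  replace (f 0) with (- - f 0)%C by ring. rewrite <- Hlim.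
  (* With f 0 eliminated, the two sides differ by the factor - i^2 = 1. *)
  replace (RtoC x * ray_integral e W a b q x t)%C
    with (- (Ci * Ci) * (RtoC x * ray_integral e W a b q x t))%C; [ring|].
  replace (Ci * Ci)%C with (- (1))%C by (apply C_ext; simpl; ring). ring.
Qed.
End Ray.

(** * Contours made of two rays from a common vertex *)

Section Contour.
Context (o : nat) (e1 e2 c : C) (W1 W2 : nat -> nat -> R -> R -> C).
Context (HW1 : symbol_family o e1 c W1) (HW2 : symbol_family o e2 c W2).
Context (HW0 : forall b q t, W1 b q 0 t = W2 b q 0 t).

Definition contour_integral (a b q : nat) (x t : R) : C :=
  (ray_integral e1 W1 a b q x t - ray_integral e2 W2 a b q x t)%C.

(* The boundary terms of the two rays cancel at the vertex. *)
Lemma contour_by_parts a b q x t : (a <= 2 * b + q + o)%nat -> 0 < x -> 0 < t ->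
  (RtoC x * contour_integral a b q x t =
   Ci * (RtoC (INR a) * contour_integral (pred a) b q x t
           + (- (2)) * contour_integral (S a) (S b) q x t
           + c * contour_integral a b (S q) x t))%C.
Proof.
  intros Ha Hx Ht. unfold contour_integral.
  replace (RtoC x * (ray_integral e1 W1 a b q x t - ray_integral e2 W2 a b q x t))%C
    with (RtoC x * ray_integral e1 W1 a b q x t - RtoC x * ray_integral e2 W2 a b q x t)%C by ring.
  rewrite (ray_integral_by_parts o e1 c W1 HW1), (ray_integral_by_parts o e2 c W2 HW2) by assumption.
  rewrite HW0. replace (RtoC 0 * e1)%C with (RtoC 0 * e2)%C by ring. ring.
Qed.

Lemma contour_continuous a b q : (a <= 2 * b + q + o)%nat ->
  continuous_on_quadrant (contour_integral a b q).
Proof.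
  intros Ha x t Hx Ht. apply continuous_Cminus.
  - apply (ray_integral_continuous o e1 c W1 HW1 a b q Ha); assumption.
  - apply (ray_integral_continuous o e2 c W2 HW2 a b q Ha); assumption.
Qed.

Lemma contour_derive a b q x t : (a + 1 <= 2 * b + q + o)%nat -> 0 < x -> 0 < t ->
  is_deriveC (fun y => contour_integral a b q y t) x (Ci * contour_integral (S a) b q x t)%C.
Proof.
  intros Ha Hx Ht. eapply is_derive_value.
  - apply is_deriveC_minus.
    + apply (ray_integral_derive o e1 c W1 HW1); assumption.
    + apply (ray_integral_derive o e2 c W2 HW2); assumption.
  - as_C_eq. unfold contour_integral. ring.
Qed.

(** The condition [a + 2 <= 2 * b + q + o] survives all three index changes, so integration by parts
    can be repeated; each round gains one power of x. The base case is absolute convergence uniform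
    in t. *)
Lemma contour_bound l : forall a b q, (a + 2 <= 2 * b + q + o)%nat -> forall T,
  exists M, forall x t, 1 <= x -> 0 < t <= T -> x ^ l * Cmod (contour_integral a b q x t) <= M.
Proof.
  induction l as [|l IH]; intros a b q Ha T.
  - destruct (symbol_uniform_bound _ _ _ _ HW1 a b q Ha 1 T Rlt_0_1) as [M1 HM1].
    destruct (symbol_uniform_bound _ _ _ _ HW2 a b q Ha 1 T Rlt_0_1) as [M2 HM2].
    exists (M1 + M2). intros x t Hx Ht. simpl pow. rewrite Rmult_1_l.
    unfold contour_integral, Cminus. eapply Rle_trans; [apply Cmod_triangle|]. rewrite Cmod_opp.
    apply Rplus_le_compat; apply half_line_le.
    + split; [apply (ray_integrand_continuous_r o e1 c W1 HW1)|apply HM1; assumption].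
    + split; [apply (ray_integrand_continuous_r o e2 c W2 HW2)|apply HM2; assumption].
  - destruct (IH (pred a) b q ltac:(lia) T) as [M1 HM1].
    destruct (IH (S a) (S b) q ltac:(lia) T) as [M2 HM2].
    destruct (IH a b (S q) ltac:(lia) T) as [M3 HM3].
    exists (INR a * M1 + 2 * M2 + Cmod c * M3). intros x t Hx Ht.
    specialize (HM1 x t Hx Ht); specialize (HM2 x t Hx Ht); specialize (HM3 x t Hx Ht).
    replace (x ^ S l * Cmod (contour_integral a b q x t))
      with (x ^ l * Cmod (RtoC x * contour_integral a b q x t))
      by (rewrite Cmod_mult, Cmod_R, Rabs_pos_eq by lra; simpl; ring).
    rewrite contour_by_parts by (lra || lia). rewrite Cmod_mult, Cmod_Ci, Rmult_1_l.
    assert (Hp : 0 <= x ^ l) by (apply pow_le; lra).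
    assert (Htri : Cmod (RtoC (INR a) * contour_integral (pred a) b q x t
           + (- (2)) * contour_integral (S a) (S b) q x t + c * contour_integral a b (S q) x t)
      <= INR a * Cmod (contour_integral (pred a) b q x t)
        + 2 * Cmod (contour_integral (S a) (S b) q x t)
        + Cmod c * Cmod (contour_integral a b (S q) x t)).
    { eapply Rle_trans; [apply Cmod_triangle|]. rewrite (Cmod_mult c). apply Rplus_le_compat_r.
      eapply Rle_trans; [apply Cmod_triangle|].
      rewrite !Cmod_mult, Cmod_opp, !Cmod_R, (Rabs_pos_eq 2), (Rabs_pos_eq (INR a))
        by (lra || apply pos_INR). lra. }
    pose proof (pos_INR a). pose proof (Cmod_ge_0 c).
    eapply Rle_trans; [apply Rmult_le_compat_l; [exact Hp|exact Htri]|].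
    rewrite !Rmult_plus_distr_l.
    apply Rplus_le_compat; [apply Rplus_le_compat|].
    + rewrite <- Rmult_assoc, (Rmult_comm _ (INR a)), Rmult_assoc. apply Rmult_le_compat_l; assumption.
    + rewrite <- Rmult_assoc, (Rmult_comm _ 2), Rmult_assoc. apply Rmult_le_compat_l; [lra|assumption].
    + rewrite <- Rmult_assoc, (Rmult_comm _ (Cmod c)), Rmult_assoc. apply Rmult_le_compat_l; assumption.
Qed.

(** Two units of order secure bounds uniform in t; the other n pay for n differentiations in x. *)
Lemma contour_rapid_above n : forall a b q, (a + n + 2 <= 2 * b + q + o)%nat ->
  rapid n (contour_integral a b q).
Proof.
  induction n as [|n IH]; intros a b q Ha.
  1,2: split; [split; [apply contour_continuous; lia|
    intros l T _; apply contour_bound; lia]|].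
  - exact I.
  - exists (fun x t => Ci * contour_integral (S a) b q x t)%C. split.
    + intros x t Hx Ht. apply contour_derive; [lia|assumption|assumption].
    + apply rapid_scal, IH. lia.
Qed.

(* Dividing the integration by parts identity by x trades one power of 1/x for
   one unit of decay of the symbol at infinity. *)
Lemma contour_rapid n a b q : (a <= 2 * b + q + o)%nat -> rapid n (contour_integral a b q).
Proof.
  (* k bounds the deficit of the order with respect to the value n + 2 required by
     [contour_rapid_above]; each integration by parts lowers it by one. *)
  assert (H : forall k a b q, (a + n + 2 <= 2 * b + q + o + k)%nat ->
    (a <= 2 * b + q + o)%nat -> rapid n (contour_integral a b q)).
  2: { intros Ha. apply (H (a + n + 2)%nat); lia. }
  clear a b q. induction k as [|k IH]; intros a b q Hk Ha.
  { apply contour_rapid_above. lia. }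
  apply (rapid_ext n (fun x t => RtoC (/ x) *
    (Ci * (RtoC (INR a) * contour_integral (pred a) b q x t
           + (- (2)) * contour_integral (S a) (S b) q x t
           + c * contour_integral a b (S q) x t)))%C).
  { intros x t Hx Ht. rewrite <- contour_by_parts by assumption.
    rewrite Cmult_assoc, <- RtoC_mult, Rinv_l by lra. ring. }
  apply rapid_div_x, rapid_scal, rapid_plus; [apply rapid_plus|].
  (* For a = 0 the index [pred a] does not drop and the order is not improved, but the coefficient
     [INR a] is 0. *)
  - destruct a as [|a].
    + apply (rapid_ext n (fun _ _ => RtoC 0)); [intros; simpl; ring|apply rapid_zero].
    + apply rapid_scal, IH; simpl; lia.
  - apply rapid_scal, IH; lia.
  - apply rapid_scal, IH; lia.
Qed.
End Contour.

(** * Symbols *)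

Lemma exp_le_mono x y : x <= y -> exp x <= exp y.
Proof. intros [H| ->]; [apply Rlt_le, exp_increasing, H|apply Rle_refl]. Qed.

(** A single Taylor term of exp is at most the whole series. *)
Lemma pow_le_fact_exp n v : 0 <= v -> v ^ n <= INR (fact n) * exp v.
Proof.
  intros Hv. pose proof (INR_fact_lt_0 n) as Hf.
  assert (H : v ^ n / INR (fact n) <= exp v).
  { eapply Rle_trans; [|apply (exp_ge_taylor v n Hv)].
    assert (Hpos : forall k, 0 <= v ^ k / INR (fact k)).
    { intros k. apply Rdiv_le_0_compat; [apply pow_le, Hv|apply INR_fact_lt_0]. }
    destruct n as [|n]; [apply Rle_refl|]. rewrite tech5.
    assert (0 <= sum_f_R0 (fun k => v ^ k / INR (fact k)) n) by (apply cond_pos_sum, Hpos).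
    lra. }
  replace (v ^ n) with (INR (fact n) * (v ^ n / INR (fact n))) by (field; lra).
  apply Rmult_le_compat_l; lra.
Qed.

Lemma pow_exp_neg_le n v : 0 <= v -> v ^ n * exp (- v) <= INR (fact n).
Proof.
  intros Hv. rewrite exp_Ropp. pose proof (exp_pos v).
  apply (Rmult_le_reg_r (exp v)); [assumption|]. rewrite Rmult_assoc, Rinv_l, Rmult_1_r by lra.
  apply pow_le_fact_exp, Hv.
Qed.

(** Half of the exponential absorbs the power; the other half is kept so that the Duhamel integral
    can still profit from it. *)
Lemma pow_exp_neg_half_le n v : 0 <= v ->
  v ^ n * exp (- v) <= 2 ^ n * INR (fact n) * exp (- (v / 2)).
Proof.
  intros Hv. pose proof (pow_exp_neg_le n (v / 2) ltac:(lra)) as H.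
  replace (v ^ n * exp (- v)) with (2 ^ n * ((v / 2) ^ n * exp (- (v / 2))) * exp (- (v / 2))).
  - apply Rmult_le_compat_r; [apply Rlt_le, exp_pos|].
    apply Rmult_le_compat_l; [apply pow_le; lra|exact H].
  - replace (- v) with (- (v / 2) + - (v / 2)) by field. rewrite exp_plus.
    replace (v ^ n) with (2 ^ n * (v / 2) ^ n) by (rewrite <- Rpow_mult_distr; f_equal; field). ring.
Qed.

(** For r <= 1 the bound [M1] is enough, as (1 + r)^2 <= 4; for r > 1 two of the K powers pay for (1
    + r)^2 <= 4 r^2. *)
Lemma pow_div_square a K r w M1 M2 : (a + 2 <= K)%nat -> 0 <= r -> 0 <= w ->
  w <= M1 -> r ^ K * w <= M2 -> r ^ a * w <= 4 * (M1 + M2) / (1 + r) ^ 2.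
Proof.
  intros HK Hr Hw H1 H2.
  apply (Rmult_le_reg_r ((1 + r) ^ 2)); [nra|].
  unfold Rdiv. rewrite (Rmult_assoc (4 * (M1 + M2))), Rinv_l by nra. rewrite Rmult_1_r.
  assert (0 <= r ^ K * w) by (apply Rmult_le_pos; [apply pow_le, Hr|exact Hw]).
  destruct (Rle_dec r 1) as [h|h].
  - assert (r ^ a <= 1) by (rewrite <- (pow1 a); apply pow_incr; lra).
    assert (0 <= r ^ a) by (apply pow_le, Hr).
    assert (r ^ a * w <= w) by nra. assert ((1 + r) ^ 2 <= 4) by nra.
    assert (0 <= (1 + r) ^ 2) by nra. assert (0 <= r ^ a * w) by nra.
    apply Rle_trans with (w * 4); [|lra]. apply Rmult_le_compat; assumption.
  - assert (Hp : r ^ (a + 2) <= r ^ K) by (apply Rle_pow; [lra|exact HK]).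
    rewrite pow_add in Hp. assert (0 <= r ^ a) by (apply pow_le, Hr).
    apply Rle_trans with (4 * (r ^ a * r ^ 2 * w)); [|nra].
    replace (r ^ a * w * (1 + r) ^ 2) with (r ^ a * w * ((1 + r) ^ 2)) by ring.
    replace (4 * (r ^ a * r ^ 2 * w)) with (r ^ a * w * (4 * r ^ 2)) by ring.
    apply Rmult_le_compat_l; [nra|nra].
Qed.

Lemma Cmod_ray_integrand e W a b q x t r : Cmod e = 1 -> 0 <= r ->
  Cmod (ray_integrand e W a b q x t r) =
  exp (- (Im e * r * x)) * (r ^ a * Cmod (W b q r t)).
Proof.
  intros He Hr. unfold ray_integrand. rewrite Rmax_right by exact Hr.
  rewrite !Cmod_mult, He, Cmod_Cexp, Cmod_pow, Cmod_mult, He, Cmod_R, Rabs_pos_eq by exact Hr.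
  rewrite !Rmult_1_r. f_equal. f_equal. unfold Im. simpl. ring.
Qed.

(* On the real line the decay of the symbol itself is needed. *)
Lemma symbol_family_line e c W : Cmod e = 1 -> 0 <= Im e ->
  (forall b q p, continuous (fun p : R * R => W b q (fst p) (snd p)) p) ->
  (forall b q r t, 0 < r -> 0 < t ->
    is_deriveC (fun r => W b q r t) r
      (e * (c * W b (S q) r t - 2 * (RtoC r * e) * W (S b) q r t))%C) ->
  (forall b q T, exists M, forall r t, 0 <= r -> 0 < t <= T -> Cmod (W b q r t) <= M) ->
  (forall b q T, exists M, forall r t, 0 <= r -> 0 < t <= T ->
    r ^ (2 * b + q) * Cmod (W b q r t) <= M) ->
  (forall b q eps T, 0 < eps -> exists M, forall r t, 0 <= r -> eps <= t <= T ->
    r ^ (2 * b + q + 2) * Cmod (W b q r t) <= M) ->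
  symbol_family 0 e c W.
Proof.
  intros He Hi Hc Hd H1 H2 H3.
  assert (Hexp : forall r x, 0 <= r -> 0 <= x -> exp (- (Im e * r * x)) <= 1).
  { intros r x Hr Hx. rewrite <- exp_0. apply exp_le_mono.
    assert (0 <= Im e * r * x) by (apply Rmult_le_pos; [apply Rmult_le_pos|]; assumption). lra. }
  assert (Hgen : forall a b q K r x t M1 M2, (a + 2 <= K)%nat -> 0 <= r -> 0 <= x ->
    Cmod (W b q r t) <= M1 -> r ^ K * Cmod (W b q r t) <= M2 ->
    Cmod (ray_integrand e W a b q x t r) <= 4 * (M1 + M2) / (1 + r) ^ 2).
  { intros a b q K r x t M1 M2 HK Hr Hx Ha Hb.
    rewrite Cmod_ray_integrand by assumption.
    pose proof (pow_div_square a K r _ _ _ HK Hr (Cmod_ge_0 _) Ha Hb).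
    specialize (Hexp r x Hr Hx).
    assert (0 <= r ^ a * Cmod (W b q r t)) by (apply Rmult_le_pos; [apply pow_le, Hr|apply Cmod_ge_0]).
    pose proof (exp_pos (- (Im e * r * x))). nra. }
  constructor; try assumption.
  - intros a b q Ha d eps T Hdp Hep.
    destruct (H1 b q T) as [M1 HM1], (H3 b q eps T Hep) as [M2 HM2].
    exists (4 * (M1 + M2)). intros x t Hx Ht r Hr.
    apply (Hgen a b q (2 * b + q + 2)%nat); try lia; try lra; [apply HM1; lra|apply HM2; lra].
  - intros a b q Ha d T Hdp.
    destruct (H1 b q T) as [M1 HM1], (H2 b q T) as [M2 HM2].
    exists (4 * (M1 + M2)). intros x t Hx Ht r Hr.
    apply (Hgen a b q (2 * b + q)%nat); try lia; try lra; [apply HM1; lra|apply HM2; lra].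
Qed.

(* On gamma the factor exp(i lambda x) decays exponentially. *)
Lemma symbol_family_decaying o e c W : Cmod e = 1 -> 0 < Im e ->
  (forall b q p, continuous (fun p : R * R => W b q (fst p) (snd p)) p) ->
  (forall b q r t, 0 < r -> 0 < t ->
    is_deriveC (fun r => W b q r t) r
      (e * (c * W b (S q) r t - 2 * (RtoC r * e) * W (S b) q r t))%C) ->
  (forall b q T, exists M, forall r t, 0 <= r -> 0 < t <= T -> Cmod (W b q r t) <= M) ->
  symbol_family o e c W.
Proof.
  intros He Hi Hc Hd H1.
  assert (Hgen : forall a b q d T, 0 < d -> exists M, forall x t, d <= x -> 0 < t <= T ->
    forall r, 0 <= r -> Cmod (ray_integrand e W a b q x t r) <= M / (1 + r) ^ 2).
  { intros a b q d T Hdp. destruct (H1 b q T) as [M HM].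
    (* On x >= d the factor exp(- Im e r x) decays at least at rate k, and r^(a + 2) exp(- k r) is
       at most (a + 2)! / k^(a + 2). *)
    set (k := Im e * d). assert (Hk : 0 < k) by (apply Rmult_lt_0_compat; assumption).
    set (N := INR (fact a) / k ^ a * M). set (N2 := INR (fact (a + 2)) / k ^ (a + 2) * M).
    exists (4 * (M + N2)). intros x t Hx Ht r Hr. rewrite Cmod_ray_integrand by assumption.
    specialize (HM r t Hr Ht).
    assert (HW : 0 <= Cmod (W b q r t)) by apply Cmod_ge_0.
    assert (Hle : exp (- (Im e * r * x)) <= exp (- (k * r))).
    { apply exp_le_mono. unfold k. assert (Im e * r * d <= Im e * r * x);
        [apply Rmult_le_compat_l; [nra|exact Hx]|lra]. }
    assert (Hw1 : exp (- (k * r)) * Cmod (W b q r t) <= M).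
    { assert (exp (- (k * r)) <= 1) by (rewrite <- exp_0; apply exp_le_mono; nra).
      pose proof (exp_pos (- (k * r))). nra. }
    assert (Hw2 : r ^ (a + 2) * (exp (- (k * r)) * Cmod (W b q r t)) <= N2).
    { rewrite <- Rmult_assoc. unfold N2. apply Rmult_le_compat; [|exact HW| |exact HM].
      - apply Rmult_le_pos; [apply pow_le, Hr|apply Rlt_le, exp_pos].
      - assert (Hkp : 0 < k ^ (a + 2)) by (apply pow_lt, Hk).
        apply (Rmult_le_reg_l (k ^ (a + 2))); [exact Hkp|].
        replace (k ^ (a + 2) * (INR (fact (a + 2)) / k ^ (a + 2))) with (INR (fact (a + 2))) by (field; lra).
        rewrite <- Rmult_assoc, <- Rpow_mult_distr. apply pow_exp_neg_le. nra. }
    pose proof (pow_div_square a (a + 2) r _ _ _ (Nat.le_refl _) Hr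
      (Rmult_le_pos _ _ (Rlt_le _ _ (exp_pos (- (k * r)))) HW) Hw1 Hw2) as Hfin.
    eapply Rle_trans; [|exact Hfin].
    replace (r ^ a * (exp (- (k * r)) * Cmod (W b q r t)))
      with (exp (- (k * r)) * (r ^ a * Cmod (W b q r t))) by ring.
    apply Rmult_le_compat_r; [apply Rmult_le_pos; [apply pow_le, Hr|exact HW]|exact Hle]. }
  constructor; try assumption.
  - intros a b q _ d eps T Hdp Hep. destruct (Hgen a b q d T Hdp) as [M HM].
    exists M. intros x t Hx Ht. apply HM; [exact Hx|lra].
  - intros a b q _ d T Hdp. apply Hgen, Hdp.
Qed.

(* [psi q r tau] stands for the transform of y^q f(y,tau) at lambda = r e. *)
Record transform_family (e c : C) (psi : nat -> R -> R -> C) : Prop := {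
  transform_continuous : forall q p,
    continuous (fun p : R * R => psi q (fst p) (snd p)) p;
  transform_derive : forall q r tau, 0 < r -> 0 <= tau ->
    is_deriveC (fun r => psi q r tau) r (c * e * psi (S q) r tau)%C;
  transform_bound : forall q T, exists M, forall r tau, 0 <= r -> 0 <= tau <= T ->
    Cmod (psi q r tau) <= M
}.

(** The weight y^q vanishes to order q at y = 0, so that q integrations by parts in y leave no
    boundary term. *)
Definition transform_decay (psi : nat -> R -> R -> C) : Prop :=
  forall q T, exists M, forall r tau, 0 <= r -> 0 <= tau <= T ->
    r ^ q * Cmod (psi q r tau) <= M.

(* The integrand of the Duhamel integral after the substitution s = t u; at
   u = 1 it is the contribution of the initial datum. *)
Definition duhamel_integrand (e : C) (psi : nat -> R -> R -> C) (b q : nat) (r t u : R) : C :=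
  (RtoC ((t * u) ^ b) * Cexp (- (RtoC (Rmax 0 r) * e * (RtoC (Rmax 0 r) * e) * RtoC (t * u)))
    * psi q r (t * (1 - u))%R)%C.

Definition initial_symbol e psi b q r t : C := duhamel_integrand e psi b q r t 1.

(** The factor t is the Jacobian of s = t u. With the fixed limits 0 and 1, the dependence on r and
    t under the integral sits in the integrand alone, where the theorems on parameters apply. *)
Definition duhamel_symbol e psi b q r t : C :=
  (RtoC t * CInt (duhamel_integrand e psi b q r t) 0 1)%C.

(** * Bounds and decay of the initial and Duhamel symbols *)

Section Symbols.
Context (e c : C) (psi : nat -> R -> R -> C).
Context (He : Cmod e = 1) (He2 : 0 <= Re (e * e)) (Hpsi : transform_family e c psi).

Lemma duhamel_integrand_continuous b q (z : R * (R * R)) :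
  continuous (fun z : R * (R * R) => duhamel_integrand e psi b q (fst (snd z)) (snd (snd z)) (fst z)) z.
Proof.
  assert (Hu : continuous (fun z : R * (R * R) => fst z) z) by apply continuous_fst'.
  assert (Hr : continuous (fun z : R * (R * R) => fst (snd z)) z)
    by (apply (continuous_comp snd fst); [apply continuous_snd'|apply continuous_fst']).
  assert (Ht : continuous (fun z : R * (R * R) => snd (snd z)) z)
    by (apply (continuous_comp snd snd); apply continuous_snd').
  assert (Htu : continuous (fun z : R * (R * R) => snd (snd z) * fst z) z)
    by (apply continuous_Rmult; assumption).
  assert (Hl : continuous (fun z : R * (R * R) => RtoC (Rmax 0 (fst (snd z))) * e)%C z).
  { apply continuous_Cmult; [|apply continuous_const].
    apply continuous_RtoC, continuous_Rmax0, Hr. }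
  apply continuous_Cmult; [apply continuous_Cmult|].
  - apply continuous_RtoC, continuous_Rpow, Htu.
  - apply continuous_Cexp, continuous_Copp, continuous_Cmult; [|apply continuous_RtoC, Htu].
    apply continuous_Cmult; exact Hl.
  - apply (continuous_comp_2 (U:=prod_UniformSpace R_UniformSpace (prod_UniformSpace R_UniformSpace R_UniformSpace))
       (V:=R_UniformSpace) (W:=R_UniformSpace) (X:=C_UniformSpace)
       (fun z => fst (snd z)) (fun z => snd (snd z) * (1 - fst z)) (fun r t => psi q r t)).
    + exact Hr.
    + apply continuous_Rmult; [exact Ht|]. apply continuous_Rminus; [apply continuous_const|exact Hu].
    + apply (transform_continuous _ _ _ Hpsi).
Qed.

Lemma duhamel_integrand_continuous_rt b q u (p : R * R) :
  continuous (fun p : R * R => duhamel_integrand e psi b q (fst p) (snd p) u) p.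
Proof.
  apply (continuous_comp (fun p : R * R => (u, p))
    (fun z : R * (R * R) => duhamel_integrand e psi b q (fst (snd z)) (snd (snd z)) (fst z)));
    [|apply duhamel_integrand_continuous].
  apply continuous_pair; [apply continuous_const|apply continuous_id].
Qed.

Lemma duhamel_integrand_continuous_u b q r t u :
  continuous (duhamel_integrand e psi b q r t) u.
Proof.
  apply (continuous_comp (fun u : R => (u, (r, t)))
    (fun z : R * (R * R) => duhamel_integrand e psi b q (fst (snd z)) (snd (snd z)) (fst z)));
    [|apply duhamel_integrand_continuous].
  apply continuous_pair; [apply continuous_id|apply continuous_const].
Qed.

Lemma duhamel_integrand_derive b q r t u : 0 < r -> 0 <= t -> 0 <= u <= 1 ->
  is_deriveC (fun r => duhamel_integrand e psi b q r t u) r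
    (e * (c * duhamel_integrand e psi b (S q) r t u
          - 2 * (RtoC r * e) * duhamel_integrand e psi (S b) q r t u))%C.
Proof.
  intros Hr Ht Hu.
  apply (is_deriveC_ext_pos (fun r =>
    RtoC ((t * u) ^ b) * Cexp (- (RtoC r * e * (RtoC r * e) * RtoC (t * u)))
    * psi q r (t * (1 - u))%R)%C); [exact Hr| |].
  { intros y Hy. unfold duhamel_integrand. rewrite Rmax_right by lra. reflexivity. }
  assert (Hl : is_deriveC (fun r => RtoC r * e)%C r e).
  { eapply is_derive_value.
    - apply (is_deriveC_mult (fun y => RtoC y) (fun _ => e)); [|apply is_deriveC_const].
      apply is_deriveC_RtoC, (is_derive_id (K:=R_AbsRing)).
    - as_C_eq.
      change (@one (AbsRing.Ring R_AbsRing)) with 1. ring. }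
  assert (Hq : is_deriveC (fun r => - (RtoC r * e * (RtoC r * e) * RtoC (t * u)))%C r
    (- (2 * (RtoC r * e) * e * RtoC (t * u)))%C).
  { eapply is_derive_value.
    - apply is_deriveC_opp.
      apply (is_deriveC_mult _ (fun _ => RtoC (t * u))); [|apply is_deriveC_const].
      apply is_deriveC_mult; exact Hl.
    - as_C_eq. cbv beta; ring. }
  eapply is_derive_value.
  - apply is_deriveC_mult.
    + apply (is_deriveC_mult (fun _ => RtoC ((t * u) ^ b))); [apply is_deriveC_const|].
      apply is_deriveC_Cexp, Hq.
    + apply (transform_derive _ _ _ Hpsi); [exact Hr|]. apply Rmult_le_pos; lra.
  - as_C_eq.
    unfold duhamel_integrand. rewrite Rmax_right by lra. simpl pow. rewrite (RtoC_mult (t * u) ((t * u) ^ b)). cbv beta. ring.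
Qed.

Lemma duhamel_symbol_continuous b q p :
  continuous (fun p : R * R => duhamel_symbol e psi b q (fst p) (snd p)) p.
Proof.
  apply continuous_Cmult; [apply continuous_RtoC, continuous_snd'|].
  apply (continuous_CInt_param (P:=prod_UniformSpace R_UniformSpace R_UniformSpace)
    (fun u p => duhamel_integrand e psi b q (fst p) (snd p) u) p 0 1); [lra| |].
  - exists (mkposreal 1 Rlt_0_1). intros y _.
    apply ex_CInt_continuous, duhamel_integrand_continuous_u.
  - intros s _. apply duhamel_integrand_continuous.
Qed.

Lemma duhamel_symbol_derive b q r t : 0 < r -> 0 < t ->
  is_deriveC (fun r => duhamel_symbol e psi b q r t) r
    (e * (c * duhamel_symbol e psi b (S q) r t
          - 2 * (RtoC r * e) * duhamel_symbol e psi (S b) q r t))%C.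
Proof.
  intros Hr Ht.
  set (G := fun u r => (e * c * duhamel_integrand e psi b (S q) r t u
    - 2 * e * (RtoC r * e) * duhamel_integrand e psi (S b) q r t u)%C).
  assert (HI : is_CInt (fun u => G u r) 0 1
    (e * c * CInt (duhamel_integrand e psi b (S q) r t) 0 1
     - 2 * e * (RtoC r * e) * CInt (duhamel_integrand e psi (S b) q r t) 0 1)%C).
  { apply is_CInt_minus; apply is_CInt_scal, is_CInt_CInt, ex_CInt_continuous,
      duhamel_integrand_continuous_u. }
  eapply is_derive_value.
  - apply (is_deriveC_mult (fun _ => RtoC t)); [apply is_deriveC_const|].
    apply (is_deriveC_CInt_param (fun u r => duhamel_integrand e psi b q r t u) G r 0 1).
    + lra.
    + exists (mkposreal 1 Rlt_0_1). intros y _.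
      apply ex_CInt_continuous, duhamel_integrand_continuous_u.
    + eexists; exact HI.
    + exists (mkposreal r Hr). intros y Hy s Hs. change (Rabs (y - r) < r) in Hy.
      apply Rabs_def2 in Hy. eapply is_derive_value.
      * apply duhamel_integrand_derive; lra.
      * as_C_eq. unfold G. ring.
    + intros s _.
      assert (Hc : forall b q, continuous (fun z : R * R => duhamel_integrand e psi b q (snd z) t (fst z)) (s, r)).
      { intros b' q'. apply (continuous_comp (fun z : R * R => (fst z, (snd z, t)))
          (fun z : R * (R * R) => duhamel_integrand e psi b' q' (fst (snd z)) (snd (snd z)) (fst z)));
          [|apply duhamel_integrand_continuous].
        apply continuous_pair; [apply continuous_fst'|].
        apply continuous_pair; [apply continuous_snd'|apply continuous_const]. }
      unfold G. apply continuous_Cminus.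
      * apply (continuous_Cmult (fun _ : R * R => (e * c)%C)); [apply continuous_const|apply Hc].
      * apply (continuous_Cmult (fun z : R * R => (2 * e * (RtoC (snd z) * e))%C)); [|apply Hc].
        apply continuous_Cmult; [apply continuous_const|].
        apply continuous_Cmult; [apply continuous_RtoC, continuous_snd'|apply continuous_const].
  - as_C_eq. cbv beta.
    rewrite (CInt_unique _ _ _ _ HI). unfold duhamel_symbol. ring.
Qed.

Lemma Cmod_duhamel_integrand b q r t u : 0 <= r -> 0 <= t * u ->
  Cmod (duhamel_integrand e psi b q r t u) =
  (t * u) ^ b * exp (- (Re (e * e) * r ^ 2 * (t * u))) * Cmod (psi q r (t * (1 - u))).
Proof.
  intros Hr Htu. unfold duhamel_integrand. rewrite Rmax_right by exact Hr.
  rewrite !Cmod_mult, Cmod_Cexp, Cmod_R, Rabs_pos_eq by (apply pow_le, Htu).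
  f_equal. f_equal. f_equal. destruct e as [x y]. unfold Re, Im. simpl. ring.
Qed.

Lemma duhamel_integrand_bound b q T : exists M, forall r t u,
  0 <= r -> 0 < t <= T -> 0 <= u <= 1 -> Cmod (duhamel_integrand e psi b q r t u) <= M.
Proof.
  destruct (transform_bound _ _ _ Hpsi q T) as [M HM].
  exists (T ^ b * 1 * M). intros r t u Hr Ht Hu.
  assert (Htu : 0 <= t * u <= T) by nra.
  rewrite Cmod_duhamel_integrand by lra.
  apply Rmult_le_compat; [|apply Cmod_ge_0| |apply HM; [exact Hr|nra]].
  - apply Rmult_le_pos; [apply pow_le; lra|apply Rlt_le, exp_pos].
  - apply Rmult_le_compat; [apply pow_le; lra|apply Rlt_le, exp_pos|apply pow_incr, Htu|].
    rewrite <- exp_0. apply exp_le_mono.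
    assert (0 <= Re (e * e) * r ^ 2 * (t * u)); [|lra].
    apply Rmult_le_pos; [apply Rmult_le_pos; [exact He2|nra]|lra].
Qed.

Lemma initial_symbol_bound b q T : exists M, forall r t,
  0 <= r -> 0 < t <= T -> Cmod (initial_symbol e psi b q r t) <= M.
Proof.
  destruct (duhamel_integrand_bound b q T) as [M HM]. exists M. intros r t Hr Ht.
  apply HM; lra.
Qed.

Lemma duhamel_symbol_bound b q T : exists M, forall r t,
  0 <= r -> 0 < t <= T -> Cmod (duhamel_symbol e psi b q r t) <= M.
Proof.
  destruct (duhamel_integrand_bound b q T) as [M HM]. exists (T * ((1 - 0) * M)). intros r t Hr Ht.
  unfold duhamel_symbol. rewrite Cmod_mult, Cmod_R, Rabs_pos_eq by lra.
  apply Rmult_le_compat; [lra|apply Cmod_ge_0|lra|].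
  apply CInt_bound_const; [lra|apply ex_CInt_continuous, duhamel_integrand_continuous_u|].
  intros u Hu. apply HM; assumption.
Qed.

Section Decay.
Context (He1 : Re (e * e) = 1) (Hdec : transform_decay psi).

(** The power splits: r^(2 b) joins (t u)^b to form a power of v = r^2 t u, the argument of the
    Gaussian exp(- v), and r^q is absorbed by the decay of [psi]. *)
Lemma duhamel_integrand_decay b q T : exists M, 0 <= M /\ forall r t u,
  0 <= r -> 0 < t <= T -> 0 <= u <= 1 ->
  r ^ (2 * b + q) * Cmod (duhamel_integrand e psi b q r t u)
  <= (r ^ 2 * (t * u)) ^ b * exp (- (r ^ 2 * (t * u))) * M.
Proof.
  (* For T < 0 the bound is vacuous and M may be negative, hence the maximum. *)
  destruct (Hdec q T) as [M HM]. exists (Rmax 0 M). split; [apply Rmax_l|]. intros r t u Hr Ht Hu.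
  assert (Htu : 0 <= t * u <= T) by nra.
  rewrite Cmod_duhamel_integrand, He1 by lra.
  replace (r ^ (2 * b + q)) with ((r ^ 2) ^ b * r ^ q) by (rewrite <- pow_mult, <- pow_add; reflexivity).
  rewrite Rmult_1_l, (Rpow_mult_distr (r ^ 2) (t * u) b).
  replace ((r ^ 2) ^ b * r ^ q * ((t * u) ^ b * exp (- (r ^ 2 * (t * u))) * Cmod (psi q r (t * (1 - u)))))
    with ((r ^ 2) ^ b * (t * u) ^ b * exp (- (r ^ 2 * (t * u))) * (r ^ q * Cmod (psi q r (t * (1 - u))))) by ring.
  apply Rmult_le_compat_l.
  - apply Rmult_le_pos; [apply Rmult_le_pos; apply pow_le; nra|apply Rlt_le, exp_pos].
  - eapply Rle_trans; [apply HM; [exact Hr|nra]|apply Rmax_r].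
Qed.

Lemma initial_symbol_decay b q T : exists M, forall r t,
  0 <= r -> 0 < t <= T -> r ^ (2 * b + q) * Cmod (initial_symbol e psi b q r t) <= M.
Proof.
  destruct (duhamel_integrand_decay b q T) as [M [HM0 HM]]. exists (INR (fact b) * M).
  intros r t Hr Ht. eapply Rle_trans; [apply HM; lra|].
  apply Rmult_le_compat_r; [exact HM0|]. apply pow_exp_neg_le. nra.
Qed.

(** The Gaussian yields two more powers of r at the price of 1 / t, hence the lower bound [eps] on
    t. *)
Lemma initial_symbol_decay_local b q eps T : 0 < eps -> exists M, forall r t,
  0 <= r -> eps <= t <= T -> r ^ (2 * b + q + 2) * Cmod (initial_symbol e psi b q r t) <= M.
Proof.
  intros Heps.
  destruct (duhamel_integrand_decay b q T) as [M [HM0 HM]]. exists (/ eps * (INR (fact (S b)) * M)).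
  intros r t Hr Ht.
  apply (Rmult_le_reg_l eps); [exact Heps|]. rewrite <- Rmult_assoc, <- (Rmult_assoc eps), Rinv_r, Rmult_1_l by lra.
  specialize (HM r t 1 Hr ltac:(lra) ltac:(lra)). fold (initial_symbol e psi b q r t) in HM.
  rewrite Rmult_1_r in HM. rewrite pow_add.
  assert (Hr2 : 0 <= r ^ 2) by nra.
  apply Rle_trans with (r ^ 2 * t * (r ^ (2 * b + q) * Cmod (initial_symbol e psi b q r t))).
  - assert (0 <= r ^ 2 * (r ^ (2 * b + q) * Cmod (initial_symbol e psi b q r t))).
    { apply Rmult_le_pos; [exact Hr2|apply Rmult_le_pos; [apply pow_le, Hr|apply Cmod_ge_0]]. }
    nra.
  - apply Rle_trans with (r ^ 2 * t * ((r ^ 2 * t) ^ b * exp (- (r ^ 2 * t)) * M)).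
    + apply Rmult_le_compat_l; [nra|exact HM].
    + replace (r ^ 2 * t * ((r ^ 2 * t) ^ b * exp (- (r ^ 2 * t)) * M))
        with ((r ^ 2 * t) ^ S b * exp (- (r ^ 2 * t)) * M) by (simpl; ring).
      apply Rmult_le_compat_r; [exact HM0|]. apply pow_exp_neg_le. nra.
Qed.

Lemma Cmod_pow_CInt (F : R -> C) g lg k r : 0 <= r ->
  (forall u, continuous F u) -> (forall u, 0 <= u <= 1 -> r ^ k * Cmod (F u) <= g u) ->
  is_RInt g 0 1 lg -> r ^ k * Cmod (CInt F 0 1) <= lg.
Proof.
  intros Hr HF Hg Hlg. assert (Hp : 0 <= r ^ k) by (apply pow_le, Hr).
  replace (r ^ k * Cmod (CInt F 0 1)) with (Cmod (CInt (fun u => RtoC (r ^ k) * F u)%C 0 1)).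
  - apply (CInt_bound _ g); [lra| | |exact Hlg].
    + apply ex_CInt_continuous. intros u. apply continuous_Cmult; [apply continuous_const|apply HF].
    + intros u Hu. rewrite Cmod_mult, Cmod_R, Rabs_pos_eq by exact Hp. apply Hg, Hu.
  - rewrite (CInt_unique _ _ _ _ (is_CInt_scal F 0 1 _ (RtoC (r ^ k))
      (is_CInt_CInt _ _ _ (ex_CInt_continuous F 0 1 HF)))).
    rewrite Cmod_mult, Cmod_R, Rabs_pos_eq by exact Hp. reflexivity.
Qed.

Lemma duhamel_symbol_decay b q T : exists M, forall r t,
  0 <= r -> 0 < t <= T -> r ^ (2 * b + q) * Cmod (duhamel_symbol e psi b q r t) <= M.
Proof.
  destruct (duhamel_integrand_decay b q T) as [M [HM0 HM]]. exists (T * (INR (fact b) * M)).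
  intros r t Hr Ht. unfold duhamel_symbol. rewrite Cmod_mult, Cmod_R, Rabs_pos_eq by lra.
  rewrite <- Rmult_assoc, (Rmult_comm _ t), Rmult_assoc.
  apply Rmult_le_compat; [lra|apply Rmult_le_pos; [apply pow_le, Hr|apply Cmod_ge_0]|lra|].
  apply (Cmod_pow_CInt _ (fun _ => INR (fact b) * M)); [exact Hr|apply duhamel_integrand_continuous_u| |].
  - intros u Hu. eapply Rle_trans; [apply HM; lra|].
    apply Rmult_le_compat_r; [exact HM0|]. apply pow_exp_neg_le. apply Rmult_le_pos; nra.
  - assert (H : is_RInt (fun _ => INR (fact b) * M) 0 1 ((1 - 0) * (INR (fact b) * M)))
      by exact (is_RInt_const (V:=R_NormedModule) 0 1 (INR (fact b) * M)).
    rewrite Rminus_0_r, Rmult_1_l in H. exact H.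
Qed.

(** Here the integration itself yields two more powers: the integral of exp(- k u) over [0, 1] is at
    most 1 / k with k proportional to r^2 t, and the prefactor t cancels the t in k. The bound is
    thus uniform down to t = 0. *)
Lemma duhamel_symbol_decay_extra b q T : exists M, forall r t,
  0 <= r -> 0 < t <= T -> r ^ (2 * b + q + 2) * Cmod (duhamel_symbol e psi b q r t) <= M.
Proof.
  destruct (duhamel_integrand_decay b q T) as [M [HM0 HM]].
  set (D := 2 ^ b * INR (fact b) * M).
  assert (HD : 0 <= D).
  { apply Rmult_le_pos; [apply Rmult_le_pos; [apply pow_le; lra|apply pos_INR]|exact HM0]. }
  exists (2 * D). intros r t Hr Ht.
  (* At r = 0 the rate k chosen below would vanish; there the left side is 0. *)
  destruct (Req_dec r 0) as [->|Hr0].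
  { rewrite pow_i, Rmult_0_l by lia. lra. }
  (* Half of the Gaussian exponent at u = 1: the other half has absorbed the power v^b in
     [pow_exp_neg_half_le]. *)
  set (k := r ^ 2 * t / 2).
  assert (Hk : 0 < k).
  { apply Rdiv_lt_0_compat; [|lra]. apply Rmult_lt_0_compat; [apply pow_lt; lra|lra]. }
  unfold duhamel_symbol. rewrite Cmod_mult, Cmod_R, Rabs_pos_eq by lra. rewrite pow_add.
  apply Rle_trans with (r ^ 2 * t * (D * (/ k))).
  - replace (r ^ (2 * b + q) * r ^ 2 * (t * Cmod (CInt (duhamel_integrand e psi b q r t) 0 1)))
      with (r ^ 2 * t * (r ^ (2 * b + q) * Cmod (CInt (duhamel_integrand e psi b q r t) 0 1))) by ring.
    apply Rmult_le_compat_l; [nra|].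
    apply Rle_trans with (D * (/ k * (1 - exp (- k)))).
    + apply (Cmod_pow_CInt _ (fun u => D * exp (- (k * u)))); [exact Hr|apply duhamel_integrand_continuous_u| |].
      * intros u Hu. eapply Rle_trans; [apply HM; lra|].
        assert (Hv : 0 <= r ^ 2 * (t * u)) by (apply Rmult_le_pos; nra).
        replace (k * u) with (r ^ 2 * (t * u) / 2) by (unfold k; field).
        replace (D * exp (- (r ^ 2 * (t * u) / 2)))
          with (2 ^ b * INR (fact b) * exp (- (r ^ 2 * (t * u) / 2)) * M) by (unfold D; ring).
        apply Rmult_le_compat_r; [exact HM0|]. apply pow_exp_neg_half_le, Hv.
      * replace (D * (/ k * (1 - exp (- k))))
          with (minus (- (D / k) * exp (- (k * 1))) (- (D / k) * exp (- (k * 0)))).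
        -- apply (is_RInt_derive (V:=R_CompleteNormedModule) (fun u => - (D / k) * exp (- (k * u))));
             intros u _.
           ++ auto_derive; [trivial|]. field. lra.
           ++ apply (ex_derive_continuous (V:=R_NormedModule)). auto_derive. trivial.
        -- unfold minus, plus, opp; simpl. rewrite Rmult_1_r, Rmult_0_r, Ropp_0, exp_0. field. lra.
    + apply Rmult_le_compat_l; [exact HD|]. pose proof (exp_pos (- k)).
      assert (0 < / k) by (apply Rinv_0_lt_compat, Hk). nra.
  - right. unfold k. field. lra.
Qed.
End Decay.

Lemma initial_symbol_line : Im e = 0 -> transform_decay psi ->
  symbol_family 0 e c (initial_symbol e psi).
Proof.
  intros Hi Hdec.
  assert (He1 : Re (e * e) = 1).
  { pose proof (Cmod2_alt e) as H. rewrite He, Hi in H. revert H. unfold Re, Im in *. simpl in *.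
    rewrite Hi. intros H. lra. }
  apply symbol_family_line; [exact He|rewrite Hi; lra| | | | |].
  - intros b q p. apply duhamel_integrand_continuous_rt.
  - intros b q r t Hr Ht. apply duhamel_integrand_derive; lra.
  - apply initial_symbol_bound.
  - apply initial_symbol_decay; assumption.
  - apply initial_symbol_decay_local; assumption.
Qed.

Lemma duhamel_symbol_line : Im e = 0 -> transform_decay psi ->
  symbol_family 0 e c (duhamel_symbol e psi).
Proof.
  intros Hi Hdec.
  assert (He1 : Re (e * e) = 1).
  { pose proof (Cmod2_alt e) as H. rewrite He, Hi in H. revert H. unfold Re, Im in *. simpl in *.
    rewrite Hi. intros H. lra. }
  apply symbol_family_line; [exact He|rewrite Hi; lra| | | | |].
  - apply duhamel_symbol_continuous.
  - apply duhamel_symbol_derive.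
  - apply duhamel_symbol_bound.
  - apply duhamel_symbol_decay; assumption.
  - intros b q eps T Heps. destruct (duhamel_symbol_decay_extra He1 Hdec b q T) as [M HM].
    exists M. intros r t Hr Ht. apply HM; [exact Hr|lra].
Qed.

Lemma initial_symbol_decaying o : 0 < Im e -> symbol_family o e c (initial_symbol e psi).
Proof.
  intros Hi. apply symbol_family_decaying; [exact He|exact Hi| | |].
  - intros b q p. apply duhamel_integrand_continuous_rt.
  - intros b q r t Hr Ht. apply duhamel_integrand_derive; lra.
  - apply initial_symbol_bound.
Qed.

Lemma duhamel_symbol_decaying o : 0 < Im e -> symbol_family o e c (duhamel_symbol e psi).
Proof.
  intros Hi. apply symbol_family_decaying; [exact He|exact Hi| | |].
  - apply duhamel_symbol_continuous.
  - apply duhamel_symbol_derive.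
  - apply duhamel_symbol_bound.
Qed.
End Symbols.

(** * Transforms of the data *)

(** Common interface for [u0], read as independent of tau, and for [f]. Derivatives are two-sided
    and hence confined to y > 0, while clamping turns continuity up to the boundary into continuity
    on the plane. *)
Record schwartz_data (d : nat -> R -> R -> C) : Prop := {
  schwartz_continuous : forall k p,
    continuous (fun p : R * R => d k (Rmax 0 (fst p)) (Rmax 0 (snd p))) p;
  schwartz_derive : forall k y tau, 0 < y -> 0 <= tau ->
    is_deriveC (fun y => d k y tau) y (d (S k) y tau);
  schwartz_bound : forall k l T, exists M, forall y tau, 0 <= y -> 0 <= tau <= T ->
    y ^ l * Cmod (d k y tau) <= M
}.

(** [kappa] will be [c * e], so that exp(kappa r y) is exp(-+ i lambda y). Thanks to the clamps it
    has modulus at most 1 for all real r and y once Re kappa <= 0. *)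
Definition transform_integrand (d : nat -> R -> R -> C) (kappa : C) (k q : nat) (r tau y : R) : C :=
  (Cexp (kappa * RtoC (Rmax 0 r * Rmax 0 y)) *
    (RtoC (Rmax 0 y ^ q) * d k (Rmax 0 y) (Rmax 0 tau)))%C.

Definition transform d kappa k q r tau : C :=
  CInt_half_line (transform_integrand d kappa k q r tau).

Section Transform.
Context (d : nat -> R -> R -> C) (kappa : C) (Hd : schwartz_data d) (Hk : Re kappa <= 0).

Lemma transform_integrand_continuous k q (z : R * (R * R)) :
  continuous (fun z : R * (R * R) =>
    transform_integrand d kappa k q (fst (snd z)) (snd (snd z)) (fst z)) z.
Proof.
  assert (Hy : continuous (fun z : R * (R * R) => fst z) z) by apply continuous_fst'.
  assert (Hr : continuous (fun z : R * (R * R) => fst (snd z)) z)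
    by (apply (continuous_comp snd fst); [apply continuous_snd'|apply continuous_fst']).
  assert (Ht : continuous (fun z : R * (R * R) => snd (snd z)) z)
    by (apply (continuous_comp snd snd); apply continuous_snd').
  apply continuous_Cmult; [|apply continuous_Cmult].
  - apply continuous_Cexp, continuous_Cmult; [apply continuous_const|].
    apply continuous_RtoC, continuous_Rmult; apply continuous_Rmax0; assumption.
  - apply continuous_RtoC, continuous_Rpow, continuous_Rmax0, Hy.
  - apply (continuous_comp_2 (U:=prod_UniformSpace R_UniformSpace (prod_UniformSpace R_UniformSpace R_UniformSpace))
       (V:=R_UniformSpace) (W:=R_UniformSpace) (X:=C_UniformSpace)
       (fun z => fst z) (fun z => snd (snd z)) (fun y t => d k (Rmax 0 y) (Rmax 0 t)));
      [exact Hy|exact Ht|apply (schwartz_continuous _ Hd)].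
Qed.

Lemma transform_integrand_continuous_y k q r tau y :
  continuous (transform_integrand d kappa k q r tau) y.
Proof.
  apply (continuous_comp (fun y : R => (y, (r, tau)))
    (fun z : R * (R * R) => transform_integrand d kappa k q (fst (snd z)) (snd (snd z)) (fst z)));
    [|apply transform_integrand_continuous].
  apply continuous_pair; [apply continuous_id|apply continuous_const].
Qed.

Lemma transform_dominated k q T : exists M, forall r tau, tau <= T ->
  dominated M (transform_integrand d kappa k q r tau).
Proof.
  destruct (schwartz_bound _ Hd k q (Rmax 0 T)) as [M0 H0].
  destruct (schwartz_bound _ Hd k (q + 1) (Rmax 0 T)) as [M1 H1].
  destruct (schwartz_bound _ Hd k (q + 2) (Rmax 0 T)) as [M2 H2].
  (* The coefficients are those of y^q (1 + y)^2 = y^q + 2 y^(q+1) + y^(q+2). *)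
  exists (M0 + 2 * M1 + M2). intros r tau Htau.
  split; [apply transform_integrand_continuous_y|]. intros y Hy.
  assert (Ht : 0 <= Rmax 0 tau <= Rmax 0 T).
  { split; [apply Rmax_l|]. apply Rle_max_compat_l, Htau. }
  specialize (H0 y (Rmax 0 tau) Hy Ht); specialize (H1 y (Rmax 0 tau) Hy Ht);
    specialize (H2 y (Rmax 0 tau) Hy Ht).
  unfold transform_integrand. rewrite (Rmax_right 0 y) by exact Hy.
  rewrite !Cmod_mult, Cmod_Cexp, Cmod_R, Rabs_pos_eq by (apply pow_le, Hy).
  assert (He : exp (Re (kappa * RtoC (Rmax 0 r * y))) <= 1).
  { rewrite <- exp_0. apply exp_le_mono.
    replace (Re (kappa * RtoC (Rmax 0 r * y))) with (Re kappa * (Rmax 0 r * y))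
      by (unfold Re; simpl; ring).
    assert (0 <= Rmax 0 r * y) by (apply Rmult_le_pos; [apply Rmax_l|exact Hy]). nra. }
  pose proof (exp_pos (Re (kappa * RtoC (Rmax 0 r * y)))) as Hp.
  assert (Hw : 0 <= y ^ q * Cmod (d k y (Rmax 0 tau)))
    by (apply Rmult_le_pos; [apply pow_le, Hy|apply Cmod_ge_0]).
  apply Rle_trans with (y ^ q * Cmod (d k y (Rmax 0 tau))); [nra|].
  apply (Rmult_le_reg_r ((1 + y) ^ 2)); [nra|].
  unfold Rdiv. rewrite (Rmult_assoc (M0 + _ + _)), Rinv_l, Rmult_1_r by nra.
  rewrite pow_add in H1, H2. simpl in H1, H2 |- *. nra.
Qed.

Lemma transform_cont k q (p : R * R) :
  continuous (fun p : R * R => transform d kappa k q (fst p) (snd p)) p.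
Proof.
  destruct (transform_dominated k q (snd p + 1)) as [M HM].
  apply (continuous_half_line_param (P:=prod_UniformSpace R_UniformSpace R_UniformSpace)
    (fun y p => transform_integrand d kappa k q (fst p) (snd p) y) p M).
  - exists (mkposreal 1 Rlt_0_1). intros y [_ Hy]. apply HM.
    change (Rabs (snd y - snd p) < 1) in Hy. apply Rabs_def2 in Hy. lra.
  - intros s _. apply transform_integrand_continuous.
Qed.

Lemma transform_der k q r tau : 0 < r ->
  is_deriveC (fun r => transform d kappa k q r tau) r (kappa * transform d kappa k (S q) r tau)%C.
Proof.
  intros Hr.
  destruct (transform_dominated k q tau) as [M1 HM1].
  destruct (transform_dominated k (S q) tau) as [M2 HM2].
  eapply is_derive_value;
    [|exact (half_line_scal M2 (transform_integrand d kappa k (S q) r tau) kappa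
        (HM2 r tau (Rle_refl _)))].
  pose proof (dominated_pos _ _ (HM1 r tau (Rle_refl _))).
  pose proof (fun r => dominated_scal _ _ kappa (HM2 r tau (Rle_refl _))) as HD.
  pose proof (dominated_pos _ _ (HD r)).
  apply (is_deriveC_half_line_param (fun y r => transform_integrand d kappa k q r tau y)
    (fun y r => kappa * transform_integrand d kappa k (S q) r tau y)%C r (M1 + Cmod kappa * M2)).
  - exists (mkposreal 1 Rlt_0_1). intros s _. apply (dominated_le M1); [lra|apply HM1, Rle_refl].
  - exists (mkposreal 1 Rlt_0_1). intros s _. apply (dominated_le (Cmod kappa * M2)); [lra|apply HD].
  - exists (mkposreal r Hr). intros s Hs y Hy. change (Rabs (s - r) < r) in Hs.
    apply Rabs_def2 in Hs. assert (Hs0 : 0 < s) by lra.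
    apply (is_deriveC_ext_pos (fun s => Cexp (kappa * RtoC (s * y)) *
      (RtoC (Rmax 0 y ^ q) * d k (Rmax 0 y) (Rmax 0 tau)))%C); [exact Hs0| |].
    { intros s' Hs'. unfold transform_integrand. rewrite (Rmax_right 0 s'), (Rmax_right 0 y) by lra.
      reflexivity. }
    eapply is_derive_value.
    + apply (is_deriveC_mult _ (fun _ => _)); [|apply is_deriveC_const].
      apply is_deriveC_Cexp. apply (is_deriveC_mult (fun _ => kappa)); [apply is_deriveC_const|].
      apply is_deriveC_RtoC, (is_derive_Rmult (fun s => s) (fun _ => y));
        [apply (is_derive_id (K:=R_AbsRing))|apply (is_derive_const (V:=R_NormedModule))].
    + as_C_eq.
      unfold transform_integrand. rewrite (Rmax_right 0 s), (Rmax_right 0 y) by lra.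
      change (@one (AbsRing.Ring R_AbsRing)) with 1.
      change (@zero (NormedModule.AbelianMonoid R_AbsRing R_NormedModule)) with 0.
      replace (1 * y + s * 0) with y by ring. cbv beta. simpl pow.
      rewrite (RtoC_mult y (y ^ q)). ring.
  - intros s _. apply continuous_Cmult; [apply continuous_const|].
    apply (continuous_comp (fun z : R * R => (fst z, (snd z, tau)))
      (fun z : R * (R * R) => transform_integrand d kappa k (S q) (fst (snd z)) (snd (snd z)) (fst z)));
      [|apply transform_integrand_continuous].
    apply continuous_pair; [apply continuous_fst'|].
    apply continuous_pair; [apply continuous_snd'|apply continuous_const].
Qed.

Lemma transform_le k q T : exists M, forall r tau, 0 <= r -> 0 <= tau <= T ->
  Cmod (transform d kappa k q r tau) <= M.
Proof.
  destruct (transform_dominated k q T) as [M HM]. exists M. intros r tau _ Ht.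
  apply half_line_le, HM, Ht.
Qed.

(** The integrated term vanishes at infinity by domination, and at 0 because of the weight y^(q+1);
    this is why the identity starts from the weight [S q]. *)
Lemma transform_by_parts k q r tau : 0 <= r -> 0 <= tau ->
  (kappa * RtoC r * transform d kappa k (S q) r tau =
   - (RtoC (INR (S q)) * transform d kappa k q r tau + transform d kappa (S k) (S q) r tau))%C.
Proof.
  intros Hr Ht.
  destruct (transform_dominated k (S q) tau) as [M0 HM0].
  destruct (transform_dominated k q tau) as [M1 HM1].
  destruct (transform_dominated (S k) (S q) tau) as [M2 HM2].
  specialize (HM0 r tau (Rle_refl _)); specialize (HM1 r tau (Rle_refl _));
    specialize (HM2 r tau (Rle_refl _)).
  set (f := transform_integrand d kappa k (S q) r tau).
  set (g := fun y => (kappa * RtoC r * f y + (RtoC (INR (S q)) * transform_integrand d kappa k q r tau y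
    + transform_integrand d kappa (S k) (S q) r tau y))%C).
  pose proof (dominated_scal _ _ (kappa * RtoC r)%C HM0) as D0.
  pose proof (dominated_scal _ _ (RtoC (INR (S q))) HM1) as D1.
  pose proof (dominated_plus _ _ _ _ D1 HM2) as D12.
  pose proof (dominated_plus _ _ _ _ D0 D12) as D.
  assert (Hint : CInt_half_line g = (kappa * RtoC r * transform d kappa k (S q) r tau
    + (RtoC (INR (S q)) * transform d kappa k q r tau + transform d kappa (S k) (S q) r tau))%C).
  { unfold g, f, transform.
    rewrite (half_line_plus _ _ _ _ D0 D12), (half_line_plus _ _ _ _ D1 HM2).
    rewrite (half_line_scal _ _ _ HM0), (half_line_scal _ _ _ HM1). reflexivity. }
  assert (Hfg : forall y, 0 < y -> is_deriveC f y (g y)).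
  { intros y Hy.
    apply (is_deriveC_ext_pos (fun y => Cexp (kappa * RtoC (r * y)) *
      (RtoC (y ^ S q) * d k y tau))%C); [exact Hy| |].
    { intros s Hs. unfold f, transform_integrand. rewrite !Rmax_right by lra. reflexivity. }
    eapply is_derive_value.
    - apply is_deriveC_mult.
      + apply is_deriveC_Cexp. apply (is_deriveC_mult (fun _ => kappa)); [apply is_deriveC_const|].
        apply is_deriveC_RtoC, (is_derive_Rmult (fun _ => r) (fun y => y));
          [apply (is_derive_const (V:=R_NormedModule))|apply (is_derive_id (K:=R_AbsRing))].
      + apply is_deriveC_mult; [|apply (schwartz_derive _ Hd); assumption].
        apply is_deriveC_RtoC. apply (is_derive_pow (fun y => y) (S q) y 1).
        apply (is_derive_id (K:=R_AbsRing)).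
    - as_C_eq.
      unfold g, f, transform_integrand. rewrite !Rmax_right by lra.
      change (@one (AbsRing.Ring R_AbsRing)) with 1.
      change (@zero (NormedModule.AbelianMonoid R_AbsRing R_NormedModule)) with 0.
      replace (0 * y + r * 1) with r by ring. cbv beta.
      replace (INR (S q) * 1 * y ^ pred (S q)) with (INR (S q) * y ^ q) by (simpl pred; ring).
      rewrite (RtoC_mult (INR (S q)) (y ^ q)). ring. }
  assert (Hf0 : f 0 = RtoC 0).
  { unfold f, transform_integrand. rewrite (Rmax_left 0 0) by lra.
    rewrite pow_i by lia. ring. }
  assert (Hlim : CInt_half_line g = RtoC 0).
  { apply (half_line_unique _ _ _ D).
    apply (filterlim_ext_loc f).
    { exists 0. intros y Hy. symmetry. transitivity (f y - f 0)%C.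
      - apply CInt_FTC; [exact Hy|apply HM0|apply D|exact Hfg].
      - rewrite Hf0. ring. }
    intros P [eps HP]. pose proof (dominated_pos _ _ HM0) as Hpos.
    destruct (Rdiv_small M0 eps Hpos (cond_pos eps)) as [N [HN HNs]].
    exists N. intros y Hy. apply HP, ball_C_Cmod.
    replace (f y - 0)%C with (f y) by ring.
    eapply Rle_lt_trans; [apply HM0; lra|].
    apply Rle_lt_trans with (M0 / (1 + y)); [|apply HNs; lra].
    apply Rmult_le_compat_l; [exact Hpos|]. apply Rinv_le_contravar; nra. }
  rewrite Hint in Hlim.
  match type of Hlim with (?u + ?v)%C = _ => replace u with (u + v - v)%C by ring end.
  rewrite Hlim. ring.
Qed.

(** Each power of r is traded by [transform_by_parts] for a weight lowered by one or a derivative of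
    the next order. Hence q and k stay general in the induction, and p <= q ensures that a weight is
    left. *)
Lemma transform_decay_le T : Cmod kappa = 1 -> forall p q k, (p <= q)%nat ->
  exists M, forall r tau, 0 <= r -> 0 <= tau <= T ->
    r ^ p * Cmod (transform d kappa k q r tau) <= M.
Proof.
  intros Hk1. induction p as [|p IH]; intros q k Hp.
  - destruct (transform_le k q T) as [M HM]. exists M. intros r tau Hr Ht.
    simpl pow. rewrite Rmult_1_l. apply HM; assumption.
  - destruct q as [|q]; [lia|].
    destruct (IH q k ltac:(lia)) as [M1 HM1].
    destruct (IH (S q) (S k) ltac:(lia)) as [M2 HM2].
    exists (INR (S q) * M1 + M2). intros r tau Hr Ht.
    specialize (HM1 r tau Hr Ht); specialize (HM2 r tau Hr Ht).
    replace (r ^ S p * Cmod (transform d kappa k (S q) r tau))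
      with (r ^ p * Cmod (kappa * RtoC r * transform d kappa k (S q) r tau))
      by (rewrite !Cmod_mult, Hk1, Cmod_R, Rabs_pos_eq by exact Hr; simpl; ring).
    rewrite transform_by_parts by lra. rewrite Cmod_opp.
    assert (Hrp : 0 <= r ^ p) by (apply pow_le, Hr).
    eapply Rle_trans; [apply Rmult_le_compat_l; [exact Hrp|apply Cmod_triangle]|].
    rewrite Cmod_mult, Cmod_R, Rabs_pos_eq by apply pos_INR.
    rewrite Rmult_plus_distr_l. apply Rplus_le_compat; [|exact HM2].
    rewrite <- Rmult_assoc, (Rmult_comm _ (INR (S q))), Rmult_assoc.
    apply Rmult_le_compat_l; [apply pos_INR|exact HM1].
Qed.

Lemma transform_is_family e c : kappa = (c * e)%C ->
  transform_family e c (transform d kappa 0).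
Proof.
  intros E. constructor.
  - intros q p. apply transform_cont.
  - intros q r tau Hr Ht. rewrite <- E. apply transform_der, Hr.
  - intros q T. apply transform_le.
Qed.

Lemma transform_is_decaying : Cmod kappa = 1 -> transform_decay (transform d kappa 0).
Proof. intros H1 q T. apply (transform_decay_le T H1). apply Nat.le_refl. Qed.

(** On the line [kappa] is - i e; on gamma, where the transform is taken at minus the contour point,
    it is i e. Both have nonpositive real part. *)
Lemma hat_transform (u : R -> C) lambda r tau : 0 <= r -> 0 <= tau ->
  (forall y, 0 < y -> u y = d 0%nat y tau) ->
  (- (Ci * lambda) = kappa * RtoC r)%C ->
  hat u lambda = transform d kappa 0 0 r tau.
Proof.
  intros Hr Ht Hu E. destruct (transform_dominated 0 0 tau) as [M HM].
  apply (half_line_ext M); [apply HM, Rle_refl|]. intros y Hy.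
  unfold transform_integrand. rewrite !Rmax_right by lra. rewrite (Hu y Hy).
  replace (- (Ci * lambda * RtoC y))%C with (kappa * RtoC (r * y))%C;
    [simpl pow; ring|].
  rewrite RtoC_mult, Cmult_assoc, <- E. ring.
Qed.
End Transform.

(** The boundary datum does not depend on lambda, so its lambda-derivatives, which occupy the
    indices q >= 1, are 0. This makes the boundary term a Duhamel symbol. *)
Definition boundary_transform (g : R -> C) (q : nat) (r tau : R) : C :=
  match q with O => g (Rmax 0 tau) | S _ => RtoC 0 end.

Lemma boundary_transform_family g e c :
  (forall tau, continuous (fun tau => g (Rmax 0 tau)) tau) ->
  transform_family e c (boundary_transform g).
Proof.
  intros Hg. constructor.
  - intros [|q] p; [|apply continuous_const].
    apply (continuous_comp snd (fun tau => g (Rmax 0 tau))); [apply continuous_snd'|apply Hg].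
  - intros q r tau _ _. apply (is_derive_value (V:=C_R_NormedModule) _ _ (RtoC 0)).
    + exact (is_deriveC_const (boundary_transform g q 0 tau) r).
    + as_C_eq. simpl. ring.
  - intros [|q] T; [|exists 0; intros; simpl; rewrite Cmod_0; apply Rle_refl].
    destruct (Rle_dec 0 T) as [HT|HT]; [|exists 0; intros; lra].
    set (h := fun tau => @norm R_AbsRing C_R_NormedModule (g (Rmax 0 tau))).
    assert (Hh : forall tau, 0 <= tau <= T -> continuity_pt h tau).
    { intros tau _. apply continuity_pt_filterlim.
      exact (filterlim_comp _ _ _ _ _ _ _ _ (Hg tau)
        (filterlim_norm (V:=C_R_NormedModule) (g (Rmax 0 tau)))). }
    destruct (continuity_ab_maj h 0 T HT Hh) as [m [Hm _]].
    exists (h m). intros r tau _ Ht. simpl. rewrite <- norm_Cmod. apply (Hm tau Ht).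
Qed.

(** * The terms of the formula *)

(** The two-sided improper integral is split at 0 and its negative half reflected; [H1] and [H2]
    carry the continuity and the domination. *)
Lemma CInt_line_rays (F : C -> C) M1 M2 H1 H2 :
  dominated M1 H1 -> dominated M2 H2 ->
  (forall s, 0 < s -> F (RtoC s) = H1 s) -> (forall s, 0 < s -> F (RtoC (- s)) = H2 s) ->
  CInt_line F = (CInt_half_line H2 + CInt_half_line H1)%C.
Proof.
  intros D1 D2 E1 E2. unfold CInt_line.
  apply (is_RInt_gen_unique (V:=C_R_CompleteNormedModule)
    (Fa:=Rbar_locally m_infty) (Fb:=Rbar_locally p_infty)).
  apply (is_RInt_gen_Chasles (V:=C_R_NormedModule) (fun s => F (RtoC s)) 0).
  - intros P HP. pose proof (half_line_lim M2 H2 D2 P HP) as [N HN].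
    apply (Filter_prod _ _ _ (fun a => a < 0 /\ a < - N) (fun b => b = 0)).
    + exists (Rmin 0 (- N)). intros a Ha. pose proof (Rmin_l 0 (- N)); pose proof (Rmin_r 0 (- N)).
      split; lra.
    + reflexivity.
    + intros a b [Ha HaN] ->. exists (CInt H2 0 (- a)). split; [|apply HN; lra].
      apply (is_RInt_ext (V:=C_R_NormedModule) (fun s => opp (opp (H2 (- s))))).
      * simpl fst; simpl snd. rewrite Rmin_left, Rmax_right by lra. intros s Hs.
        change (- - H2 (- s)%R = F (RtoC s))%C.
        rewrite <- E2 by lra. rewrite Ropp_involutive. ring.
      * simpl fst; simpl snd.
        apply (is_RInt_comp_opp (V:=C_R_NormedModule) (fun s => opp (H2 s)) a 0).
        rewrite Ropp_0.
        replace (CInt H2 0 (- a)) with (- - CInt H2 0 (- a))%C by ring.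
        apply (is_RInt_swap (V:=C_R_NormedModule)).
        apply (is_RInt_opp (V:=C_R_NormedModule) H2 0 (- a) (CInt H2 0 (- a))).
        apply is_CInt_CInt, ex_CInt_continuous, D2.
  - apply is_CInt_half_line_lim.
    + intros b Hb. apply (ex_RInt_ext H1); [|apply ex_CInt_continuous, D1].
      rewrite Rmin_left, Rmax_right by exact Hb. intros s Hs. symmetry; apply E1; lra.
    + apply (filterlim_ext_loc (fun b => CInt H1 0 b)); [|apply (half_line_lim M1), D1].
      exists 0. intros b Hb. apply CInt_ext; [lra|]. intros s Hs. symmetry; apply E1; lra.
Qed.

Lemma kernel_split x t lambda :
  kernel x t lambda = (Cexp (Ci * lambda * RtoC x) * Cexp (- (lambda * lambda * RtoC t)))%C.
Proof. unfold kernel. rewrite <- Cexp_plus. reflexivity. Qed.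

(* The function of lambda, restricted to a ray, whose integral is a [ray_integral]. *)
Definition on_ray (e : C) (W : nat -> nat -> R -> R -> C) (a : nat) (k : C) (x t : R) (F : C -> C) : Prop :=
  forall r, 0 < r -> F (RtoC r * e)%C =
    (k * (Cexp (Ci * (RtoC r * e) * RtoC x) * ((RtoC r * e) ^ a * W 0%nat 0%nat r t)))%C.

Lemma ray_integral_eq o e c W a k x t F : symbol_family o e c W -> (a <= o)%nat ->
  0 < x -> 0 < t -> on_ray e W a k x t F ->
  CInt_half_line (fun r => F (RtoC r * e) * e)%C = (k * ray_integral e W a 0 0 x t)%C.
Proof.
  intros HW Ha Hx Ht HF.
  destruct (ray_dominated o e c W HW a 0 0 x t t ltac:(lia) Hx Ht) as [M HM].
  specialize (HM x t ltac:(lra) ltac:(lra)). unfold ray_integral.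
  rewrite <- (half_line_scal M) by exact HM.
  apply (half_line_ext _ _ _ (dominated_scal _ _ k HM)). intros r Hr.
  unfold ray_integrand. rewrite Rmax_right by lra. rewrite (HF r Hr). ring.
Qed.

Lemma line_integral_eq o c W1 W2 a k x t F :
  symbol_family o (RtoC 1) c W1 -> symbol_family o (- (1))%C c W2 -> (a <= o)%nat ->
  0 < x -> 0 < t -> on_ray (RtoC 1) W1 a k x t F -> on_ray (- (1))%C W2 a k x t F ->
  CInt_line F = (k * contour_integral (RtoC 1) (- (1))%C W1 W2 a 0 0 x t)%C.
Proof.
  intros HW1 HW2 Ha Hx Ht HF1 HF2.
  destruct (ray_dominated o _ c W1 HW1 a 0 0 x t t ltac:(lia) Hx Ht) as [M1 HM1].
  destruct (ray_dominated o _ c W2 HW2 a 0 0 x t t ltac:(lia) Hx Ht) as [M2 HM2].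
  specialize (HM1 x t ltac:(lra) ltac:(lra)). specialize (HM2 x t ltac:(lra) ltac:(lra)).
  (* On the ray e = -1 the integrand contains d lambda = - dr, whereas the reflected half line
     counts positively: hence the constant - k. *)
  rewrite (CInt_line_rays F _ _ _ _ (dominated_scal _ _ k HM1) (dominated_scal _ _ (- k)%C HM2)).
  - rewrite (half_line_scal _ _ _ HM1), (half_line_scal _ _ _ HM2).
    unfold contour_integral, ray_integral. ring.
  - intros s Hs. unfold ray_integrand. rewrite Rmax_right by lra.
    replace (RtoC s) with (RtoC s * RtoC 1)%C at 1 by ring. rewrite (HF1 s Hs). ring.
  - intros s Hs. unfold ray_integrand. rewrite Rmax_right by lra.
    replace (RtoC (- s)) with (RtoC s * (- (1)))%C by (rewrite RtoC_opp; ring).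
    rewrite (HF2 s Hs). ring.
Qed.

Definition gamma_out : C := Cexp (Ci * RtoC (PI / 4)).
Definition gamma_in : C := Cexp (Ci * RtoC (3 * PI / 4)).

Lemma gamma_integral_eq o c W1 W2 a k x t F :
  symbol_family o gamma_out c W1 -> symbol_family o gamma_in c W2 -> (a <= o)%nat ->
  0 < x -> 0 < t -> on_ray gamma_out W1 a k x t F -> on_ray gamma_in W2 a k x t F ->
  CInt_gamma F = (k * contour_integral gamma_out gamma_in W1 W2 a 0 0 x t)%C.
Proof.
  intros HW1 HW2 Ha Hx Ht HF1 HF2. unfold CInt_gamma, CInt_ray, contour_integral.
  fold gamma_out gamma_in.
  rewrite (ray_integral_eq o gamma_out c W1 a k x t), (ray_integral_eq o gamma_in c W2 a k x t)
    by assumption. ring.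
Qed.

Lemma Cexp_unit theta : Cmod (Cexp (Ci * RtoC theta)) = 1.
Proof.
  rewrite Cmod_Cexp. replace (Re (Ci * RtoC theta)) with 0 by (unfold Re; simpl; ring). apply exp_0.
Qed.

Lemma Im_Cexp theta : Im (Cexp (Ci * RtoC theta)) = sin theta.
Proof.
  unfold Cexp, Im, Re; simpl. unfold Im, Re; simpl. replace (0 * theta - 1 * 0) with 0 by ring. rewrite exp_0.
  replace (0 * 0 + 1 * theta) with theta by ring. ring.
Qed.

Lemma Re_Cexp_square theta : Re (Cexp (Ci * RtoC theta) * Cexp (Ci * RtoC theta)) = cos (2 * theta).
Proof.
  rewrite <- Cexp_plus. unfold Cexp, Re; simpl. unfold Im, Re; simpl.
  replace (0 * theta - 1 * 0 + (0 * theta - 1 * 0)) with 0 by ring. rewrite exp_0.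
  replace (0 * 0 + 1 * theta + (0 * 0 + 1 * theta)) with (2 * theta) by ring. ring.
Qed.

(** lambda^2 is purely imaginary on both rays of gamma: the heat factor has modulus one there, and
    Im lambda > 0 has to provide the decay. *)
Lemma gamma_out_spec : Cmod gamma_out = 1 /\ 0 < Im gamma_out /\ 0 <= Re (gamma_out * gamma_out).
Proof.
  unfold gamma_out. split; [apply Cexp_unit|]. rewrite Im_Cexp, Re_Cexp_square.
  replace (2 * (PI / 4)) with (PI / 2) by field. rewrite cos_PI2. split; [|lra].
  apply sin_gt_0; pose proof PI_RGT_0; lra.
Qed.

Lemma gamma_in_spec : Cmod gamma_in = 1 /\ 0 < Im gamma_in /\ 0 <= Re (gamma_in * gamma_in).
Proof.
  unfold gamma_in. split; [apply Cexp_unit|]. rewrite Im_Cexp, Re_Cexp_square.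
  replace (2 * (3 * PI / 4)) with (3 * (PI / 2)) by field. rewrite cos_3PI2. split; [|lra].
  apply sin_gt_0; pose proof PI_RGT_0; lra.
Qed.

Lemma initial_symbol_eq e psi r t : 0 <= r ->
  initial_symbol e psi 0 0 r t
  = (Cexp (- (RtoC r * e * (RtoC r * e) * RtoC t)) * psi 0%nat r 0)%C.
Proof.
  intros Hr. unfold initial_symbol, duhamel_integrand. rewrite Rmax_right by exact Hr.
  rewrite Rmult_1_r. replace (t * (1 - 1)) with 0 by ring. simpl pow. ring.
Qed.

(** The possibly growing factor exp(lambda^2 tau) is merged with exp(- lambda^2 t): for tau = t (1 -
    u) only exp(- lambda^2 t u) is left, which is bounded where Re(lambda^2) >= 0. *)
Lemma duhamel_symbol_eq e c psi h r t : transform_family e c psi -> 0 <= r -> 0 < t ->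
  (forall tau, 0 < tau < t -> h tau = psi 0%nat r tau) ->
  (Cexp (- (RtoC r * e * (RtoC r * e) * RtoC t)) *
    CInt (fun tau => Cexp (RtoC r * e * (RtoC r * e) * RtoC tau) * h tau) 0 t)%C
  = duhamel_symbol e psi 0 0 r t.
Proof.
  intros Hpsi Hr Ht Hh. set (l := (RtoC r * e * (RtoC r * e))%C).
  set (G := fun tau => (Cexp (l * RtoC tau) * psi 0%nat r tau)%C).
  assert (HG : forall tau, continuous G tau).
  { intros tau. apply continuous_Cmult.
    - apply continuous_Cexp, continuous_Cmult; [apply continuous_const|].
      apply continuous_RtoC, continuous_id.
    - apply (continuous_comp (fun tau : R => (r, tau)) (fun p : R * R => psi 0%nat (fst p) (snd p)));
        [|apply (transform_continuous _ _ _ Hpsi)].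
      apply continuous_pair; [apply continuous_const|apply continuous_id]. }
  rewrite (CInt_ext _ G 0 t); [|lra|].
  2: { intros tau Htau. unfold G. rewrite Hh by exact Htau. reflexivity. }
  (* The substitution reverses the orientation; the limits are swapped afterwards. *)
  assert (HI : is_CInt (fun u => scal (- t) (G (- t * u + t))) 1 0 (CInt G 0 t)).
  { apply (is_RInt_comp_lin (V:=C_R_NormedModule)).
    replace (- t * 1 + t) with 0 by ring. replace (- t * 0 + t) with t by ring.
    apply is_CInt_CInt, ex_CInt_continuous, HG. }
  apply (is_RInt_swap (V:=C_R_NormedModule)) in HI.
  apply (is_CInt_scal _ _ _ _ (- Cexp (- (l * RtoC t)))%C) in HI.
  assert (HJ : is_CInt (fun u => RtoC t * duhamel_integrand e psi 0 0 r t u)%C 0 1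
    (RtoC t * CInt (duhamel_integrand e psi 0 0 r t) 0 1)%C).
  { apply is_CInt_scal, is_CInt_CInt, ex_CInt_continuous.
    intros u. apply (duhamel_integrand_continuous_u e c psi Hpsi). }
  unfold duhamel_symbol. rewrite <- (CInt_unique _ _ _ _ HJ).
  transitivity (- Cexp (- (l * RtoC t)) * @opp C_R_NormedModule (CInt G 0 t))%C.
  { change (@opp C_R_NormedModule (CInt G 0 t)) with (- CInt G 0 t)%C. ring. }
  rewrite <- (CInt_unique _ _ _ _ HI).
  apply CInt_ext; [lra|]. intros u Hu. unfold duhamel_integrand, G. rewrite Rmax_right by exact Hr.
  replace (- t * u + t) with (t * (1 - u)) by ring. fold l.
  assert (Es : forall z : C, @scal R_AbsRing C_R_NormedModule (- t) z = (- RtoC t * z)%C).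
  { intros [z1 z2]. apply C_ext; unfold scal; simpl; unfold scal; simpl; unfold mult; simpl; ring. }
  rewrite Es. simpl pow.
  replace (- (l * RtoC (t * u)))%C with (- (l * RtoC t) + l * RtoC (t * (1 - u)))%C.
  - rewrite Cexp_plus. ring.
  - rewrite !RtoC_mult, RtoC_minus. ring.
Qed.

(** * The five terms of the formula as contour integrals *)

Section Formula.
Context (u0 g0 : R -> C) (f : R -> R -> C) (du df : nat -> R -> R -> C).
Context (Hdu : schwartz_data du) (Hdf : schwartz_data df).
Context (Hu0 : forall y, 0 < y -> u0 y = du 0%nat y 0).
Context (Hf : forall y tau, 0 < y -> 0 <= tau -> f y tau = df 0%nat y tau).
Context (Hg0 : forall tau, continuous (fun tau => g0 (Rmax 0 tau)) tau).

(** At r = 0 the exponentials no longer see the direction [e]. This supplies the agreement at the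
    vertex by which the boundary terms of two rays cancel. *)
Lemma duhamel_integrand_vertex d c e e' b q t u :
  duhamel_integrand e (transform d (c * e)%C 0) b q 0 t u =
  duhamel_integrand e' (transform d (c * e')%C 0) b q 0 t u.
Proof.
  unfold duhamel_integrand. rewrite Rmax_left by lra. f_equal.
  - f_equal. f_equal. ring.
  - unfold transform. f_equal. apply functional_extensionality. intros y.
    unfold transform_integrand. rewrite (Rmax_left 0 0) by lra. rewrite Rmult_0_l.
    f_equal. f_equal. ring.
Qed.

Lemma line_kappa (e : C) : Im e = 0 -> Re (- Ci * e) <= 0.
Proof. unfold Re, Im. simpl. intros ->. lra. Qed.

Lemma gamma_kappa (e : C) : 0 < Im e -> Re (Ci * e) <= 0.
Proof. unfold Re, Im. simpl. intros H. lra. Qed.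

Lemma unified_transform_rapid n : rapid n (unified_transform u0 g0 f).
Proof.
  destruct gamma_out_spec as [Eo [Io Ro]], gamma_in_spec as [Ei [Ii Ri]].
  assert (El1 : Cmod (RtoC 1) = 1) by apply Cmod_1.
  assert (El2 : Cmod (- (1)) = 1) by apply Cmod_m1.
  assert (Il1 : Im (RtoC 1) = 0) by reflexivity.
  assert (Il2 : Im (- (1))%C = 0) by (unfold Im; simpl; ring).
  assert (Rl1 : 0 <= Re (RtoC 1 * RtoC 1)) by (unfold Re; simpl; lra).
  assert (Rl2 : 0 <= Re (- (1) * - (1))) by (unfold Re; simpl; lra).
  assert (Kl : forall e, Cmod e = 1 -> Cmod (- Ci * e) = 1).
  { intros e He. rewrite Cmod_mult, Cmod_opp, Cmod_Ci, He. ring. }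
  assert (Tl : forall d e, schwartz_data d -> Im e = 0 ->
    transform_family e (- Ci)%C (transform d (- Ci * e)%C 0)).
  { intros d e Hd He. apply transform_is_family; [exact Hd|apply line_kappa, He|reflexivity]. }
  assert (Dl : forall d e, schwartz_data d -> Im e = 0 -> Cmod e = 1 ->
    transform_decay (transform d (- Ci * e)%C 0)).
  { intros d e Hd He H1. apply transform_is_decaying; [exact Hd|apply line_kappa, He|apply Kl, H1]. }
  assert (Tg : forall d e, schwartz_data d -> 0 < Im e ->
    transform_family e Ci (transform d (Ci * e)%C 0)).
  { intros d e Hd He. apply transform_is_family; [exact Hd|apply gamma_kappa, He|reflexivity]. }
  assert (Hl : forall d h e r tau, schwartz_data d -> Im e = 0 -> 0 <= r -> 0 <= tau ->
    (forall y, 0 < y -> h y = d 0%nat y tau) ->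
    hat h (RtoC r * e) = transform d (- Ci * e)%C 0 0 r tau).
  { intros d h e r tau Hd He Hr Ht Hh.
    apply hat_transform; [exact Hd|apply line_kappa, He|exact Hr|exact Ht|exact Hh|ring]. }
  assert (Hg : forall d h e r tau, schwartz_data d -> 0 < Im e -> 0 <= r -> 0 <= tau ->
    (forall y, 0 < y -> h y = d 0%nat y tau) ->
    hat h (- (RtoC r * e)) = transform d (Ci * e)%C 0 0 r tau).
  { intros d h e r tau Hd He Hr Ht Hh.
    apply hat_transform; [exact Hd|apply gamma_kappa, He|exact Hr|exact Ht|exact Hh|ring]. }
  set (J1 := contour_integral (RtoC 1) (- (1))%C
    (initial_symbol (RtoC 1) (transform du (- Ci * RtoC 1)%C 0))
    (initial_symbol (- (1))%C (transform du (- Ci * - (1))%C 0)) 0 0 0).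
  set (J2 := contour_integral gamma_out gamma_in
    (initial_symbol gamma_out (transform du (Ci * gamma_out)%C 0))
    (initial_symbol gamma_in (transform du (Ci * gamma_in)%C 0)) 0 0 0).
  (* The factor lambda in front of the boundary transform becomes the index a = 1; the constant 2 i
     stays outside. *)
  set (J3 := contour_integral gamma_out gamma_in
    (duhamel_symbol gamma_out (boundary_transform g0))
    (duhamel_symbol gamma_in (boundary_transform g0)) 1 0 0).
  set (J4 := contour_integral (RtoC 1) (- (1))%C
    (duhamel_symbol (RtoC 1) (transform df (- Ci * RtoC 1)%C 0))
    (duhamel_symbol (- (1))%C (transform df (- Ci * - (1))%C 0)) 0 0 0).
  set (J5 := contour_integral gamma_out gamma_in
    (duhamel_symbol gamma_out (transform df (Ci * gamma_out)%C 0))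
    (duhamel_symbol gamma_in (transform df (Ci * gamma_in)%C 0)) 0 0 0).
  pose proof (Tl du _ Hdu Il1) as T1a; pose proof (Tl du _ Hdu Il2) as T1b.
  pose proof (Tg du _ Hdu Io) as T2a; pose proof (Tg du _ Hdu Ii) as T2b.
  pose proof (boundary_transform_family g0 gamma_out Ci Hg0) as T3a.
  pose proof (boundary_transform_family g0 gamma_in Ci Hg0) as T3b.
  pose proof (Tl df _ Hdf Il1) as T4a; pose proof (Tl df _ Hdf Il2) as T4b.
  pose proof (Tg df _ Hdf Io) as T5a; pose proof (Tg df _ Hdf Ii) as T5b.
  pose proof (initial_symbol_line _ _ _ El1 Rl1 T1a Il1 (Dl du _ Hdu Il1 El1)) as S1a.
  pose proof (initial_symbol_line _ _ _ El2 Rl2 T1b Il2 (Dl du _ Hdu Il2 El2)) as S1b.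
  (* On gamma the offset [o] is free; 1 is the least value that admits a = 1, b = q = 0 in the
     boundary term. *)
  pose proof (initial_symbol_decaying _ _ _ Eo Ro T2a 1%nat Io) as S2a.
  pose proof (initial_symbol_decaying _ _ _ Ei Ri T2b 1%nat Ii) as S2b.
  pose proof (duhamel_symbol_decaying _ _ _ Eo Ro T3a 1%nat Io) as S3a.
  pose proof (duhamel_symbol_decaying _ _ _ Ei Ri T3b 1%nat Ii) as S3b.
  pose proof (duhamel_symbol_line _ _ _ El1 Rl1 T4a Il1 (Dl df _ Hdf Il1 El1)) as S4a.
  pose proof (duhamel_symbol_line _ _ _ El2 Rl2 T4b Il2 (Dl df _ Hdf Il2 El2)) as S4b.
  pose proof (duhamel_symbol_decaying _ _ _ Eo Ro T5a 1%nat Io) as S5a.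
  pose proof (duhamel_symbol_decaying _ _ _ Ei Ri T5b 1%nat Ii) as S5b.
  assert (V0 : forall e e' d c b q t, initial_symbol e (transform d (c * e)%C 0) b q 0 t =
    initial_symbol e' (transform d (c * e')%C 0) b q 0 t).
  { intros. apply duhamel_integrand_vertex. }
  assert (V1 : forall e e' d c b q t, duhamel_symbol e (transform d (c * e)%C 0) b q 0 t =
    duhamel_symbol e' (transform d (c * e')%C 0) b q 0 t).
  { intros. apply (f_equal (Cmult (RtoC t))), CInt_ext; [lra|].
    intros. apply duhamel_integrand_vertex. }
  assert (V3 : forall e e' b q t, duhamel_symbol e (boundary_transform g0) b q 0 t =
    duhamel_symbol e' (boundary_transform g0) b q 0 t).
  { intros. apply (f_equal (Cmult (RtoC t))), CInt_ext; [lra|].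
    intros s _. unfold duhamel_integrand, boundary_transform. rewrite (Rmax_left 0 0) by lra.
    replace (RtoC 0 * e)%C with (RtoC 0 * e')%C by ring. reflexivity. }
  assert (R1 : rapid n J1).
  { apply (contour_rapid 0 _ _ (- Ci)%C _ _ S1a S1b); [intros; apply V0|lia]. }
  assert (R2 : rapid n J2).
  { apply (contour_rapid 1 _ _ Ci _ _ S2a S2b); [intros; apply V0|lia]. }
  assert (R3 : rapid n J3).
  { apply (contour_rapid 1 _ _ Ci _ _ S3a S3b); [intros; apply V3|lia]. }
  assert (R4 : rapid n J4).
  { apply (contour_rapid 0 _ _ (- Ci)%C _ _ S4a S4b); [intros; apply V1|lia]. }
  assert (R5 : rapid n J5).
  { apply (contour_rapid 1 _ _ Ci _ _ S5a S5b); [intros; apply V1|lia]. }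
  apply (rapid_ext n (fun x t => J1 x t + (- (1)) * J2 x t + (- (2 * Ci)) * J3 x t
    + J4 x t + (- (1)) * J5 x t)%C).
  2: { exact (rapid_plus n _ _ (rapid_plus n _ _ (rapid_plus n _ _ (rapid_plus n _ _ R1
         (rapid_scal n (- (1))%C _ R2)) (rapid_scal n (- (2 * Ci))%C _ R3)) R4)
         (rapid_scal n (- (1))%C _ R5)). }
  intros x t Hx Ht. unfold unified_transform.
  assert (Einit : forall e psi h, (forall r, 0 < r -> h (RtoC r * e)%C = psi 0%nat r 0) ->
    on_ray e (initial_symbol e psi) 0 (RtoC 1) x t (fun l => kernel x t l * h l)%C).
  { intros e psi h Hh r Hr. rewrite kernel_split, (Hh r Hr), initial_symbol_eq by lra. simpl Cpow. ring. }
  assert (Eduh : forall e c psi h, transform_family e c psi ->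
    (forall r tau, 0 < r -> 0 < tau < t -> h tau (RtoC r * e)%C = psi 0%nat r tau) ->
    on_ray e (duhamel_symbol e psi) 0 (RtoC 1) x t
      (fun l => kernel x t l * tilde (fun tau => h tau l) l t)%C).
  { intros e c psi h Hpsi Hh r Hr. rewrite kernel_split.
    rewrite <- (duhamel_symbol_eq e c psi (fun tau => h tau (RtoC r * e)%C) r t Hpsi)
      by (lra || (intros; apply Hh; lra)).
    unfold tilde. simpl Cpow. ring. }
  assert (E1 : CInt_line (fun l => kernel x t l * hat u0 l)%C = (1 * J1 x t)%C).
  { apply (line_integral_eq 0 (- Ci)%C _ _ 0 _ x t _ S1a S1b (le_n 0) Hx Ht); apply Einit;
      intros r Hr; apply Hl; try assumption; lra. }
  assert (E2 : CInt_gamma (fun l => kernel x t l * hat u0 (- l))%C = (1 * J2 x t)%C).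
  { apply (gamma_integral_eq 1 Ci _ _ 0 _ x t _ S2a S2b (le_S _ _ (le_n 0)) Hx Ht);
      [apply (Einit gamma_out _ (fun l => hat u0 (- l)%C))|apply (Einit gamma_in _ (fun l => hat u0 (- l)%C))];
      intros r Hr; apply Hg; try assumption; lra. }
  assert (E3 : CInt_gamma (fun l => kernel x t l * (2 * Ci * l) * tilde g0 l t)%C = (2 * Ci * J3 x t)%C).
  { assert (Hray : forall e, transform_family e Ci (boundary_transform g0) ->
      on_ray e (duhamel_symbol e (boundary_transform g0)) 1 (2 * Ci)%C x t
        (fun l => kernel x t l * (2 * Ci * l) * tilde g0 l t)%C).
    { intros e He r Hr. rewrite kernel_split. unfold tilde.
      rewrite <- (duhamel_symbol_eq e Ci _ g0 r t He); [simpl Cpow; ring|lra|exact Ht|].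
      intros tau Htau. simpl. rewrite Rmax_right by lra. reflexivity. }
    exact (gamma_integral_eq 1 Ci _ _ 1 _ x t _ S3a S3b (le_n 1) Hx Ht (Hray _ T3a) (Hray _ T3b)). }
  assert (E4 : CInt_line (fun l => kernel x t l * tilde_hat f l t)%C = (1 * J4 x t)%C).
  { apply (line_integral_eq 0 (- Ci)%C _ _ 0 _ x t _ S4a S4b (le_n 0) Hx Ht);
      [apply (Eduh _ _ _ (fun tau l => hat (fun y => f y tau) l) T4a)
      |apply (Eduh _ _ _ (fun tau l => hat (fun y => f y tau) l) T4b)];
      intros r tau Hr Htau; apply Hl; try assumption; try lra; intros y Hy; apply Hf; lra. }
  (* The weight in [tilde] depends on lambda^2 only, so the sign affects the inner transform
     alone. *)
  assert (Hneg : forall l, tilde_hat f (- l) t = tilde (fun tau => hat (fun y => f y tau) (- l)%C) l t).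
  { intros l. unfold tilde_hat, tilde. replace (- l * - l)%C with (l * l)%C by ring. reflexivity. }
  assert (E5 : CInt_gamma (fun l => kernel x t l * tilde_hat f (- l) t)%C = (1 * J5 x t)%C).
  { assert (Hray : forall e, 0 < Im e -> transform_family e Ci (transform df (Ci * e)%C 0) ->
      on_ray e (duhamel_symbol e (transform df (Ci * e)%C 0)) 0 (RtoC 1) x t
        (fun l => kernel x t l * tilde_hat f (- l) t)%C).
    { intros e He HT r Hr. rewrite Hneg.
      refine (Eduh e Ci _ (fun tau l => hat (fun y => f y tau) (- l)%C) HT _ r Hr).
      intros r' tau Hr' Htau. apply Hg; try assumption; try lra. intros y Hy. apply Hf; lra. }
    exact (gamma_integral_eq 1 Ci _ _ 0 _ x t _ S5a S5b (le_S _ _ (le_n 0)) Hx Ht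
      (Hray _ Io T5a) (Hray _ Ii T5b)). }
  rewrite E1, E2, E3, E4, E5. ring.
Qed.
End Formula.

(** * Derivatives of the solution *)

Lemma is_filter_lim_within {T : UniformSpace} (A : T -> Prop) (x : T) :
  is_filter_lim (within A (locally x)) x.
Proof. intros P HP. exact (filter_le_within A P HP). Qed.

Lemma within_proper {T : UniformSpace} (A : T -> Prop) (x : T) :
  A x -> ProperFilter (within A (locally x)).
Proof.
  intros HA. constructor; [|apply within_filter, locally_filter].
  intros P HP. exists x. exact (locally_singleton _ _ HP HA).
Qed.

Lemma is_derive_on_interior A u x l : locally x A -> is_derive_on A u x l -> is_deriveC u x l.
Proof.
  intros HA [Hl H]. split; [exact Hl|]. intros y Hy eps.
  specialize (H y (is_filter_lim_filter_le _ (filter_le_within A) Hy) eps).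
  unfold within in H. generalize (filter_and _ _ HA H). apply filter_imp.
  intros z [Hz Hz']. apply Hz', Hz.
Qed.

Lemma is_deriveC_derive_on A u x l : A x -> is_deriveC u x l -> is_derive_on A u x l.
Proof.
  intros HA H. pose proof (within_proper A x HA).
  apply (filterdiff_locally (V:=C_R_NormedModule) u x); [apply is_filter_lim_within|exact H].
Qed.

Lemma is_derive_on_continuous A u x l :
  is_derive_on A u x l -> filterlim u (within A (locally x)) (locally (u x)).
Proof.
  intros H. apply (filterdiff_continuous_aux (U:=R_NormedModule) (V:=C_R_NormedModule)).
  - eexists; exact H.
  - apply is_filter_lim_within.
Qed.

Lemma locally_positive x : 0 < x -> locally x (fun y : R => 0 < y).
Proof. apply (open_gt 0 x). Qed.

Lemma locally_closed_half_line x : 0 < x -> locally x closed_half_line.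
Proof.
  intros Hx. generalize (locally_positive x Hx). apply filter_imp.
  intros y Hy. apply Rlt_le, Hy.
Qed.

(** Clamping lands in the closed half line, so composition with it turns one-sided limits into
    ordinary continuity on R. *)
Lemma filterlim_Rmax0 y :
  filterlim (Rmax 0) (locally y) (within closed_half_line (locally (Rmax 0 y))).
Proof.
  intros P HP. unfold within in HP. unfold filtermap.
  pose proof (continuous_Rmax0 (T:=R_UniformSpace) (fun y => y) y (continuous_id y) _ HP) as H.
  unfold filtermap in H. revert H. apply filter_imp. intros z Hz. apply Hz. apply Rmax_l.
Qed.

Lemma derivatives_on_continuous u d k y : derivatives_on closed_half_line u d ->
  continuous (fun y => d k (Rmax 0 y)) y.
Proof.
  intros [_ H]. apply (filterlim_comp _ _ _ (Rmax 0) (d k) _ _ _ (filterlim_Rmax0 y)).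
  apply (is_derive_on_continuous _ _ _ (d (S k) (Rmax 0 y))), H, Rmax_l.
Qed.

Lemma initial_schwartz_data u d : derivatives_on closed_half_line u d ->
  (forall k l : nat, exists M : R, forall x, 0 <= x -> Cmod (RtoC (x ^ l) * d k x)%C <= M) ->
  schwartz_data (fun k y _ => d k y).
Proof.
  intros Hd Hb. constructor.
  - intros k p. apply (continuous_comp fst (fun y => d k (Rmax 0 y))); [apply continuous_fst'|].
    apply (derivatives_on_continuous u), Hd.
  - intros k y _ Hy _. apply (is_derive_on_interior closed_half_line).
    + apply locally_closed_half_line, Hy.
    + apply Hd, Rlt_le, Hy.
  - intros k l T. destruct (Hb k l) as [M HM]. exists M. intros y _ Hy _.
    specialize (HM y Hy). rewrite Cmod_mult, Cmod_R, Rabs_pos_eq in HM by (apply pow_le, Hy). exact HM.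
Qed.

Lemma partials_on_continuous f d k m p : partials_on closed_half_line f d ->
  continuous (fun p : R * R => d k m (Rmax 0 (fst p)) (Rmax 0 (snd p))) p.
Proof.
  intros [_ H]. destruct p as [x t].
  destruct (H k m (Rmax 0 x) (Rmax 0 t) (Rmax_l _ _) (Rmax_l _ _)) as [_ [_ Hc]].
  refine (filterlim_comp _ _ _ (fun p : R * R => (Rmax 0 (fst p), Rmax 0 (snd p)))
    (fun p : R * R => d k m (fst p) (snd p)) _ _ _ _ Hc).
  intros P HP. unfold within in HP. unfold filtermap.
  assert (Hcont : continuous (fun p : R * R => (Rmax 0 (fst p), Rmax 0 (snd p))) (x, t)).
  { apply continuous_pair; apply continuous_Rmax0; [apply continuous_fst'|apply continuous_snd']. }
  specialize (Hcont _ HP). unfold filtermap in Hcont. revert Hcont. apply filter_imp.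
  intros z Hz. apply Hz. split; apply Rmax_l.
Qed.

Lemma forcing_schwartz_data f d : partials_on closed_half_line f d ->
  (forall (k l : nat) (T : R), 0 < T -> exists M : R, forall x t, 0 <= x -> 0 <= t <= T ->
     Cmod (RtoC (x ^ l) * d k 0%nat x t)%C <= M) ->
  schwartz_data (fun k => d k 0%nat).
Proof.
  intros Hd Hb. constructor.
  - intros k p. apply (partials_on_continuous f), Hd.
  - intros k y tau Hy Ht. apply (is_derive_on_interior closed_half_line).
    + apply locally_closed_half_line, Hy.
    + apply Hd; [apply Rlt_le, Hy|exact Ht].
  (* The given bounds are stated for positive times only, hence the enlargement of T. *)
  - intros k l T. destruct (Hb k l (Rmax 1 T)) as [M HM].
    { pose proof (Rmax_l 1 T); lra. }
    exists M. intros y tau Hy Ht. pose proof (Rmax_r 1 T).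
    specialize (HM y tau Hy ltac:(lra)).
    rewrite Cmod_mult, Cmod_R, Rabs_pos_eq in HM by (apply pow_le, Hy). exact HM.
Qed.

Section Interior.
Context (f : R -> R -> C) (d : nat -> nat -> R -> R -> C) (Hd : partials_on closed_half_line f d).

Lemma partial_x k m x t : 0 < x -> 0 < t -> is_deriveC (fun y => d k m y t) x (d (S k) m x t).
Proof.
  intros Hx Ht. apply (is_derive_on_interior closed_half_line); [apply locally_closed_half_line, Hx|].
  apply Hd; apply Rlt_le; assumption.
Qed.

Lemma partial_t k m x t : 0 < x -> 0 < t -> is_deriveC (fun s => d k m x s) t (d k (S m) x t).
Proof.
  intros Hx Ht. apply (is_derive_on_interior closed_half_line); [apply locally_closed_half_line, Ht|].
  apply Hd; apply Rlt_le; assumption.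
Qed.

Lemma partial_continuous k m : continuous_on_quadrant (d k m).
Proof.
  apply (continuous_on_quadrant_ext (fun x t => d k m (Rmax 0 x) (Rmax 0 t))).
  - intros x t Hx Ht. rewrite !Rmax_right by lra. reflexivity.
  - intros x t _ _. apply (partials_on_continuous f), Hd.
Qed.
End Interior.

(** Each decay assumption on f comes with its own family of partial derivatives; this transfers the
    bounds to a single one. Inside the quadrant the derivatives are two-sided, hence determined,
    first along x and then along t. *)
Lemma partials_on_unique f d d' :
  partials_on closed_half_line f d -> partials_on closed_half_line f d' ->
  forall k m x t, 0 < x -> 0 < t -> d k m x t = d' k m x t.
Proof.
  intros Hd Hd'.
  assert (H0 : forall k x t, 0 < x -> 0 < t -> d k 0%nat x t = d' k 0%nat x t).
  { induction k as [|k IH]; intros x t Hx Ht.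
    - destruct Hd as [Hd _], Hd' as [Hd' _].
      rewrite Hd, Hd' by (apply Rlt_le; assumption). reflexivity.
    - apply (is_deriveC_unique (fun y => d k 0%nat y t) x); [apply (partial_x f d Hd); assumption|].
      apply (is_deriveC_ext_pos (fun y => d' k 0%nat y t)); [exact Hx| |apply (partial_x f d' Hd'); assumption].
      intros y Hy. symmetry. apply IH; assumption. }
  intros k m. revert k. induction m as [|m IH]; intros k x t Hx Ht; [apply H0; assumption|].
  apply (is_deriveC_unique (fun s => d k m x s) t); [apply (partial_t f d Hd); assumption|].
  apply (is_deriveC_ext_pos (fun s => d' k m x s)); [exact Ht| |apply (partial_t f d' Hd'); assumption].
  intros s Hs. symmetry. apply IH; assumption.
Qed.

(** A canonical total choice of the x-derivative, which can be iterated; [rapid] asserts mere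
    existence. *)
Definition deriv_x (h : R -> R -> C) (x t : R) : C :=
  (Derive (fun y => Re (h y t)) x, Derive (fun y => Im (h y t)) x).

Lemma deriv_x_eq h h' x t : is_deriveC (fun y => h y t) x h' -> deriv_x h x t = h'.
Proof.
  intros H. apply C_ext; simpl; apply is_derive_unique;
    [apply is_deriveC_Re, H|apply is_deriveC_Im, H].
Qed.

(** The derivative granted by [rapid (S n)] might depend on n; uniqueness identifies all of them
    with [deriv_x h]. *)
Lemma rapid_deriv_x h : (forall n, rapid n h) ->
  (forall n, rapid n (deriv_x h)) /\
  forall x t, 0 < x -> 0 < t -> is_deriveC (fun y => h y t) x (deriv_x h x t).
Proof.
  intros Hh. split.
  - intros n. destruct (Hh (S n)) as [_ [h' [Hd Hn]]].
    apply (rapid_ext n h'); [|exact Hn]. intros x t Hx Ht. symmetry. apply deriv_x_eq, Hd; assumption.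
  - intros x t Hx Ht. destruct (Hh 1%nat) as [_ [h' [Hd _]]].
    rewrite (deriv_x_eq h (h' x t)); apply Hd; assumption.
Qed.

Fixpoint iter_deriv_x (h : R -> R -> C) (k : nat) : R -> R -> C :=
  match k with O => h | S k => deriv_x (iter_deriv_x h k) end.

Lemma iter_deriv_x_rapid h k : (forall n, rapid n h) -> forall n, rapid n (iter_deriv_x h k).
Proof. intros Hh. induction k as [|k IH]; [exact Hh|]. apply rapid_deriv_x, IH. Qed.

Lemma iter_deriv_x_derive h k x t : (forall n, rapid n h) -> 0 < x -> 0 < t ->
  is_deriveC (fun y => iter_deriv_x h k y t) x (iter_deriv_x h (S k) x t).
Proof. intros Hh. apply rapid_deriv_x, iter_deriv_x_rapid, Hh. Qed.

Lemma continuous_on_quadrant_t h x t : continuous_on_quadrant h -> 0 < x -> 0 < t ->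
  continuous (fun s => h x s) t.
Proof.
  intros Hh Hx Ht.
  apply (continuous_comp (fun s : R => (x, s)) (fun p : R * R => h (fst p) (snd p)));
    [|apply Hh; assumption].
  apply continuous_pair; [apply continuous_const|apply continuous_id].
Qed.

(** * Derivatives in t by means of the heat equation *)

Section Solution.
Context (U f : R -> R -> C) (d : nat -> nat -> R -> R -> C).
Context (HU : forall n, rapid n U) (Hd : partials_on closed_half_line f d).
Context (Hpde : solves_heat_equation U f).

Notation D := (iter_deriv_x U).

Definition heat_rhs (k : nat) (x t : R) : C := (D (S (S k)) x t + d k 0%nat x t)%C.

Lemma heat_rhs_continuous k : continuous_on_quadrant (heat_rhs k).
Proof.
  intros x t Hx Ht. apply continuous_Cplus.
  - apply (rapid_rapid0 0 _ (iter_deriv_x_rapid U (S (S k)) HU 0)); assumption.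
  - apply (partial_continuous f d Hd); assumption.
Qed.

Lemma ex_CInt_heat_rhs k x t0 t : 0 < x -> 0 < t0 <= t -> ex_CInt (fun s => heat_rhs k x s) t0 t.
Proof.
  intros Hx Ht. apply (ex_RInt_continuous (V:=C_R_CompleteNormedModule)).
  rewrite Rmin_left, Rmax_right by lra. intros s Hs.
  apply continuous_on_quadrant_t; [apply heat_rhs_continuous|exact Hx|lra].
Qed.

Lemma heat_rhs_derive k x t : 0 < x -> 0 < t ->
  is_deriveC (fun y => heat_rhs k y t) x (heat_rhs (S k) x t).
Proof.
  intros Hx Ht. apply is_deriveC_plus.
  - apply iter_deriv_x_derive; assumption.
  - apply (partial_x f d Hd); assumption.
Qed.

(** The hypothesis provides [Ux] and [Uxx] without continuity; uniqueness identifies them with the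
    iterated x-derivatives, whose continuity is known. *)
Lemma solution_t x t : 0 < x -> 0 < t -> is_deriveC (fun s => U x s) t (heat_rhs 0 x t).
Proof.
  intros Hx Ht. destruct Hpde as [Ux [Uxx [Ut H]]].
  assert (E1 : forall y, 0 < y -> Ux y t = D 1 y t).
  { intros y Hy. destruct (H y t Hy Ht) as [H1 _]. symmetry. apply (deriv_x_eq U), H1. }
  assert (E2 : Uxx x t = D 2 x t).
  { destruct (H x t Hx Ht) as [_ [H2 _]].
    apply (is_deriveC_unique (fun y => Ux y t) x); [exact H2|].
    apply (is_deriveC_ext_pos (fun y => D 1 y t)); [exact Hx| |].
    - intros y Hy. symmetry. apply E1, Hy.
    - apply iter_deriv_x_derive; assumption. }
  destruct (H x t Hx Ht) as [_ [_ [H3 H4]]].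
  eapply is_derive_value; [exact H3|].
  as_C_eq. unfold heat_rhs. rewrite <- E2.
  destruct Hd as [Hd0 _]. rewrite Hd0 by (apply Rlt_le; assumption). rewrite <- H4. ring.
Qed.

(* The heat equation in integrated form may be differentiated in x under the integral. *)
Lemma iter_deriv_x_increment k : forall x t0 t, 0 < x -> 0 < t0 <= t ->
  CInt (fun s => heat_rhs k x s) t0 t = (D k x t - D k x t0)%C.
Proof.
  induction k as [|k IH]; intros x t0 t Hx Ht.
  - apply CInt_unique.
    apply (is_RInt_derive (V:=C_R_CompleteNormedModule) (fun s => U x s));
      rewrite Rmin_left, Rmax_right by lra; intros s Hs.
    + apply solution_t; lra.
    + apply continuous_on_quadrant_t; [apply heat_rhs_continuous|exact Hx|lra].
  (* Both sides of the induction hypothesis are differentiated in x; uniqueness of the derivative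
     gives the next order. *)
  - apply (is_deriveC_unique (fun y => CInt (fun s => heat_rhs k y s) t0 t) x).
    + apply (is_deriveC_CInt_param (fun s y => heat_rhs k y s) (fun s y => heat_rhs (S k) y s)).
      * lra.
      * generalize (locally_positive x Hx). apply filter_imp. intros y Hy.
        apply ex_CInt_heat_rhs; assumption.
      * apply ex_CInt_heat_rhs; assumption.
      * generalize (locally_positive x Hx). apply filter_imp. intros y Hy s Hs.
        apply heat_rhs_derive; [exact Hy|lra].
      * intros s Hs.
        apply (continuous_comp (fun z : R * R => (snd z, fst z)) (fun p : R * R => heat_rhs (S k) (fst p) (snd p)));
          [|apply heat_rhs_continuous; simpl; lra].
        apply continuous_pair; [apply continuous_snd'|apply continuous_fst'].
    + apply (is_deriveC_ext_pos (fun y => D k y t - D k y t0)%C); [exact Hx| |].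
      * intros y Hy. symmetry. apply IH; assumption.
      * apply is_deriveC_minus; apply iter_deriv_x_derive; try assumption; lra.
Qed.

Lemma iter_deriv_x_t k x t : 0 < x -> 0 < t ->
  is_deriveC (fun s => D k x s) t (heat_rhs k x t).
Proof.
  (* The base point stays inside the quadrant, since the x-derivatives of U are not controlled at t
     = 0. *)
  intros Hx Ht. set (t0 := t / 2).
  assert (Ht2 : 0 < t / 2) by lra.
  assert (Hloc : locally t (fun s : R => t0 <= s)).
  { exists (mkposreal _ Ht2). intros s Hs. change (Rabs (s - t) < t / 2) in Hs.
    apply Rabs_def2 in Hs. unfold t0. lra. }
  apply (is_derive_ext_loc (V:=C_R_NormedModule) (fun s => CInt (fun s => heat_rhs k x s) t0 s + D k x t0)%C).
  - revert Hloc. apply filter_imp. intros s Hs. rewrite iter_deriv_x_increment by (unfold t0 in *; lra).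
    as_C_eq. ring.
  - eapply is_derive_value.
    + apply is_deriveC_plus; [|apply (is_deriveC_const (D k x t0) t)].
      apply (is_derive_RInt (V:=C_R_NormedModule) (fun s => heat_rhs k x s) _ t0).
      * revert Hloc. apply filter_imp. intros s Hs. apply is_CInt_CInt, ex_CInt_heat_rhs;
          [exact Hx|unfold t0 in *; lra].
      * apply continuous_on_quadrant_t; [apply heat_rhs_continuous|exact Hx|exact Ht].
    + as_C_eq. ring.
Qed.

(* The sum over j < m of d_x^(k + 2 (m - 1 - j)) d_t^j f. *)
Fixpoint forcing_terms (m k : nat) (x t : R) : C :=
  match m with
  | O => RtoC 0
  | S m => (forcing_terms m (S (S k)) x t + d k m x t)%C
  end.

Lemma forcing_terms_x m : forall k x t, 0 < x -> 0 < t ->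
  is_deriveC (fun y => forcing_terms m k y t) x (forcing_terms m (S k) x t).
Proof.
  induction m as [|m IH]; intros k x t Hx Ht; [exact (is_deriveC_const (RtoC 0) x)|].
  simpl. apply is_deriveC_plus; [apply IH; assumption|apply (partial_x f d Hd); assumption].
Qed.

(** Differentiation in t shifts j to j + 1, so the term j = 0 of the sum for [S m] is missing. In
    [solution_partials] it is supplied by [heat_rhs (k + 2 * m)]. *)
Lemma forcing_terms_t m : forall k x t, 0 < x -> 0 < t ->
  is_deriveC (fun s => forcing_terms m k x s) t
    (forcing_terms (S m) k x t - d (k + 2 * m)%nat 0%nat x t)%C.
Proof.
  induction m as [|m IH]; intros k x t Hx Ht.
  - apply (is_derive_value (V:=C_R_NormedModule) _ _ (RtoC 0)).
    + exact (is_deriveC_const (RtoC 0) t).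
    + as_C_eq. simpl.
      rewrite Nat.add_0_r. ring.
  - eapply is_derive_value.
    + apply (is_deriveC_plus (fun s => forcing_terms m (S (S k)) x s) (fun s => d k m x s));
        [apply IH; assumption|apply (partial_t f d Hd); assumption].
    + as_C_eq.
      replace (k + 2 * S m)%nat with (S (S k) + 2 * m)%nat by lia.
      change (forcing_terms (S (S m)) k x t)
        with (forcing_terms (S m) (S (S k)) x t + d k (S m) x t)%C. ring.
Qed.

Lemma forcing_terms_continuous m : forall k, continuous_on_quadrant (forcing_terms m k).
Proof.
  induction m as [|m IH]; intros k x t Hx Ht; [apply continuous_const|].
  apply continuous_Cplus; [apply IH; assumption|apply (partial_continuous f d Hd); assumption].
Qed.

Definition solution_partial (k m : nat) (x t : R) : C :=
  (D (k + 2 * m) x t + forcing_terms m k x t)%C.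

Lemma solution_partials : partials_on open_half_line U solution_partial.
Proof.
  split.
  - intros x t _ _. unfold solution_partial. simpl. ring.
  - intros k m x t Hx Ht. split; [|split].
    + apply is_deriveC_derive_on; [exact Hx|]. apply is_deriveC_plus.
      * apply (iter_deriv_x_derive U (k + 2 * m)); assumption.
      * apply forcing_terms_x; assumption.
    + apply is_deriveC_derive_on; [exact Ht|]. eapply is_derive_value.
      * apply is_deriveC_plus; [apply iter_deriv_x_t; assumption|apply forcing_terms_t; assumption].
      * as_C_eq. unfold heat_rhs, solution_partial.
        replace (k + 2 * S m)%nat with (S (S (k + 2 * m))) by lia. ring.
    + apply (filterlim_filter_le_1 _ (filter_le_within _)).
      change (continuous (fun p : R * R => solution_partial k m (fst p) (snd p)) (x, t)).
      apply continuous_Cplus.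
      * apply (rapid_rapid0 0 _ (iter_deriv_x_rapid U (k + 2 * m) HU 0)); assumption.
      * apply forcing_terms_continuous; assumption.
Qed.

Definition decays (T : R) (h : R -> R -> C) : Prop :=
  forall l : nat, exists M, forall x t, 1 <= x -> 0 < t <= T -> x ^ l * Cmod (h x t) <= M.

Lemma decays_plus T h k : decays T h -> decays T k -> decays T (fun x t => h x t + k x t)%C.
Proof.
  intros Hh Hk l. destruct (Hh l) as [M HM], (Hk l) as [N HN]. exists (M + N). intros x t Hx Ht.
  specialize (HM x t Hx Ht); specialize (HN x t Hx Ht).
  assert (0 <= x ^ l) by (apply pow_le; lra).
  pose proof (Rmult_le_compat_l _ _ _ H (Cmod_triangle (h x t) (k x t))). lra.
Qed.

Lemma decays_lim T h l : decays T h ->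
  lim_at_infinity_uniformly (fun x t => RtoC (x ^ l) * h x t)%C T.
Proof.
  (* One extra power of x turns boundedness into decay; beyond M / eps the quotient M / x is below
     eps. *)
  intros Hh eps Heps. destruct (Hh (S l)) as [M HM].
  exists (Rmax 1 (M / eps)). intros x t Hx0 Hx Ht.
  pose proof (Rmax_l 1 (M / eps)); pose proof (Rmax_r 1 (M / eps)).
  specialize (HM x t ltac:(lra) Ht). simpl in HM.
  rewrite Cmod_mult, Cmod_R, Rabs_pos_eq by (apply pow_le; lra).
  apply (Rmult_lt_reg_l x); [exact Hx0|]. rewrite <- Rmult_assoc.
  apply Rle_lt_trans with M; [exact HM|].
  replace M with (M / eps * eps) by (field; lra). apply Rmult_lt_compat_r; lra.
Qed.

Lemma forcing_terms_decays T m : forall k,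
  (forall j k, (j < m)%nat -> decays T (d k j)) -> decays T (forcing_terms m k).
Proof.
  induction m as [|m IH]; intros k H.
  - intros l. exists 0. intros. simpl. rewrite Cmod_0, Rmult_0_r. apply Rle_refl.
  - apply decays_plus; [apply IH; intros; apply H; lia|apply H; lia].
Qed.

Lemma dt_schwartz_decays j k T : 0 < T -> dt_schwartz_in_x j f -> decays T (d k j).
Proof.
  intros HT [d' [Hd' Hb]] l. destruct (Hb k l T HT) as [M HM]. exists M. intros x t Hx Ht.
  rewrite (partials_on_unique f d d' Hd Hd') by lra.
  specialize (HM x t ltac:(lra) ltac:(lra)).
  rewrite Cmod_mult, Cmod_R, Rabs_pos_eq in HM by (apply pow_le; lra). exact HM.
Qed.
End Solution.

Theorem theorem3 (u0 g0 : R -> C) (f U : R -> R -> C)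
  (hu0 : schwartz_half_line u0)
  (hg0 : smooth_on closed_half_line g0)
  (hf : smooth2_on closed_half_line f)
  (hfx : schwartz_in_x f)
  (hU : forall x t, 0 < x -> 0 < t ->
     (RtoC (2 * PI) * U x t)%C = unified_transform u0 g0 f x t)
  (hpde : solves_heat_equation U f)
  (hinit : forall x, 0 < x ->
     filterlim (fun t => U x t) (at_right 0) (locally (u0 x)))
  (hbdry : forall t, 0 < t ->
     filterlim (fun x => U x t) (at_right 0) (locally (g0 t))) :
  exists dU : nat -> nat -> R -> R -> C,
    partials_on open_half_line U dU /\
    forall (k m l : nat) (T0 : R), 0 < T0 ->
      dt_schwartz_below m f ->
      lim_at_infinity_uniformly (fun x t => (RtoC (x ^ l) * dU k m x t)%C) T0.
Proof.
  destruct hu0 as [du [Hdu Hbu]], hg0 as [dg [Hg Hdg]], hfx as [df [Hdf Hbf]].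
  assert (HU : forall n, rapid n U).
  { intros n. pose proof PI_RGT_0.
    apply (rapid_ext n (fun x t => RtoC (/ (2 * PI)) * unified_transform u0 g0 f x t)%C).
    - intros x t Hx Ht. rewrite <- hU by assumption.
      rewrite Cmult_assoc, <- RtoC_mult, Rinv_l by lra. ring.
    - apply rapid_scal.
      apply (unified_transform_rapid u0 g0 f (fun k y _ => du k y) (fun k => df k 0%nat)).
      + apply (initial_schwartz_data u0); assumption.
      + apply (forcing_schwartz_data f); assumption.
      + intros y Hy. symmetry. apply Hdu, Rlt_le, Hy.
      + intros y tau Hy Ht. symmetry. apply Hdf; [apply Rlt_le, Hy|exact Ht].
      + intros tau. apply (continuous_ext (fun tau => dg 0%nat (Rmax 0 tau))).
        * intros s. apply Hg, Rmax_l.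
        * apply (derivatives_on_continuous g0). split; assumption. }
  exists (solution_partial U df). split.
  - apply (solution_partials U f df HU Hdf hpde).
  - intros k m l T0 HT Hm. apply decays_lim. apply decays_plus.
    + intros l'. destruct (rapid_rapid0 0 _ (iter_deriv_x_rapid U (k + 2 * m) HU 0)) as [_ H].
      exact (H l' T0 HT).
    + apply forcing_terms_decays. intros j k' Hj. apply (dt_schwartz_decays f df Hdf); [exact HT|].
      (* j = 0 is the Schwartz assumption on f itself; 0 < j < m is the range of
         [dt_schwartz_below]. *)
      destruct j as [|j]; [exists df; split; assumption|]. apply Hm. lia.
Qed.
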